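(* For a connected locally noetherian scheme $E$, there is a natural isomorphism $$\gamma_E:\pi_1^{cs}(E)\xrightarrow{\ \cong\ }\pi_1(\Gamma(E)).$$
   Context: Completely split fundamental group. For a connected topological space $S$ let $\mathrm{Cov}(S)$ be the category of topological coverings of $S$ (possibly of infinite degree). For $s_0\in S$, $\pi_1^{cs}(S,s_0)$ is the automorphism group of the fiber functor $\mathrm{Cov}(S)\to\mathrm{Sets}$, $S'\mapsto S'\times_Ss_0$; the base point is omitted from the notation. For a connected scheme $S$, $\pi_1^{cs}(S)$ denotes this group for the underlying Zariski topological space. Dual complex. Let $E$ be a locally noetherian scheme with set of irreducible components $\{E_v\}_{v\in K}$; fix a linear ordering of $K$. For a finite subset $\sigma=\{v_0<\dots<v_m\}\subset K$ let $E_\sigma=E_{v_0}\cap\dots\cap E_{v_m}$ and let $\{E_\alpha\}_{\alpha\in K_\sigma}$ be its connected components ($K_\sigma=\varnothing$ if $E_\sigma=\varnothing$). Let $\Delta_\sigma=\{\sum_it_iv_i: t_i\ge0,\ \sum_it_i=1\}\subset\mathbb R^K$ and for $\alpha\in K_\sigma$ let $\Delta_{\sigma,\alpha}$ be a copy of $\Delta_\sigma$. Then $\Gamma(E)=\coprod_{\sigma}\coprod_{\alpha\in K_\sigma}\Delta_{\sigma,\alpha}/\sim$, where for $\tau\subset\sigma$, $\alpha\in K_\sigma$, $\beta\in K_\tau$ with $E_\alpha\subset E_\beta$, $\Delta_{\tau,\beta}$ is identified with a face of $\Delta_{\sigma,\alpha}$ via the inclusion $\Delta_\tau\hookrightarrow\Delta_\sigma$.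 This is a $\Delta$-complex (a CW-complex), independent of the ordering as a topological space. *)

(* Defs.v *)
From HB Require Import structures.
From Stdlib Require Import Relation_Operators.
From mathcomp Require Import all_boot all_order all_algebra.
From mathcomp Require Import generic_quotient finmap.
From mathcomp Require Import all_classical all_reals all_analysis.
From mathcomp Require Import continuous_path lra.
Set Implicit Arguments.
Unset Strict Implicit.
Unset Printing Implicit Defensive.
Import Order.TTheory GRing.Theory Num.Theory numFieldNormedType.Exports.
Local Open Scope classical_set_scope.
Local Open Scope ring_scope.

Section CommutativeAlgebra.
Variable A : comPzRingType.

Definition is_ideal (I : set A) : Prop :=
  [/\ I 0, (forall x y, I x -> I y -> I (x + y)) &
      forall a x, I x -> I (a * x)].

Definition is_prime_ideal (P : set A) : Prop :=
  [/\ is_ideal P, ~ P 1 & forall x y, P (x * y) -> P x \/ P y].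

Definition noetherian_ring : Prop :=
  forall I : set A, is_ideal I ->
  exists (n : nat) (g : 'I_n -> A),
    I = [set x | exists c : 'I_n -> A, x = \sum_(i < n) c i * g i].

Definition spec : Type := set_type [set P : set A | is_prime_ideal P].
HB.instance Definition _ := Choice.on spec.

Definition prime_of (p : spec) : set A := set_val p.

Lemma prime_ofP (p : spec) : is_prime_ideal (prime_of p).
Proof. exact: set_mem (valP p). Qed.

Definition zariski_open (W : set spec) : Prop :=
  exists I : set A, W = [set p | ~ I `<=` prime_of p].

Lemma zariski_openT : zariski_open setT.
Proof.
exists setT; apply/seteqP; split=> // p _ /= h.
by have [_ /(_ (h _ I))] := prime_ofP p.
Qed.

Lemma zariski_openI : setI_closed zariski_open.
Proof.
move=> _ _ [I ->] [J ->].
exists [set z | exists x y, [/\ I x, J y & z = x * y]].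
apply/seteqP; split=> [p /= [nI nJ] sub|p /= nIJ]; last first.
  have [[_ _ pM] _ _] := prime_ofP p.
  split=> sub; apply: nIJ => _ [x [y [Ix Jy ->]]]; last exact/pM/sub.
  by rewrite mulrC; exact/pM/sub.
have [_ _ pP] := prime_ofP p.
apply: nI => x Ix; apply: contrapT => npx; apply: nJ => y Jy.
by have [||] := pP x y => //; apply: sub; exists x, y.
Qed.

Lemma zariski_open_bigU (T : Type) (f : T -> set spec) :
  (forall i, zariski_open (f i)) -> zariski_open (\bigcup_i f i).
Proof.
move=> /choice[J fJ]; exists (\bigcup_i J i); apply/seteqP; split=> p /=.
  move=> [i _]; rewrite fJ /= => nJ sub; apply: nJ => x Jx; apply: sub.
  by exists i.
move=> nJ; apply: contrapT => nf; apply: nJ => x [i _ Jix].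
apply: contrapT => npx; apply: nf; exists i => //.
by rewrite fJ /= => /(_ _ Jix).
Qed.

HB.instance Definition _ := isOpenTopological.Build spec
  zariski_openT zariski_openI zariski_open_bigU.

Definition basic_open (f : A) : set spec := [set p | ~ prime_of p f].

End CommutativeAlgebra.

(* [h] identifies [B] with the localization [A_f]: [f] becomes invertible,
   every element of [B] is a fraction [a / f ^+ n], and [h a = 0] only if
   [a / 1 = 0] in [A_f]. *)
Definition is_localization_away (A B : comPzRingType) (f : A)
    (h : {rmorphism A -> B}) : Prop :=
  [/\ exists b : B, h f * b = 1,
      (forall b : B, exists n a, b * h f ^+ n = h a) &
      (forall a : A, h a = 0 -> exists n, f ^+ n * a = 0)].

Record opens (X : topologicalType) := Opens {
  open_set :> set X;
  open_setP : open open_set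
}.

Record ringed_space := RingedSpace {
  rs_space :> topologicalType;
  sections : opens rs_space -> comPzRingType;
  res : forall U V : opens rs_space, V `<=` U ->
    {rmorphism sections U -> sections V};
  res_id : forall (U : opens rs_space) (UU : U `<=` U) s, res UU s = s;
  res_comp : forall (U V W : opens rs_space)
    (VU : V `<=` U) (WV : W `<=` V) (WU : W `<=` U) s,
    res WV (res VU s) = res WU s;
  sheaf_axiom : forall (I : Type) (U : I -> opens rs_space)
    (W : opens rs_space) (UW : forall i, U i `<=` W),
    W `<=` \bigcup_i U i ->
    forall s : (forall i, sections (U i)),
    (forall i j (V : opens rs_space) (Vi : V `<=` U i) (Vj : V `<=` U j),
       res Vi (s i) = res Vj (s j)) ->
    exists! t : sections W, forall i, res (UW i) t = s i
}.

(* [(U, O_X|U)] is isomorphic to [Spec A] with its structure sheaf, the latter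
   being the unique sheaf of rings with sections [A_f] on each [D(f)]. *)
Definition is_spec (X : ringed_space) (U : opens X) (A : comPzRingType) : Prop :=
  exists (psi : spec A -> X) (theta : {rmorphism A -> sections U}),
    [/\ continuous psi, injective psi,
        (forall W : set (spec A), open W -> open (psi @` W)),
        range psi = U &
        forall (f : A) (V : opens X) (VU : V `<=` U),
          V = psi @` basic_open f :> set X ->
          is_localization_away f (res VU \o theta)].

Record scheme := Scheme {
  sch_rs :> ringed_space;
  schemeP : forall x : sch_rs, exists (U : opens sch_rs) (A : comPzRingType),
    open_set U x /\ is_spec U A
}.

Definition locally_noetherian (X : scheme) : Prop :=
  forall x : X, exists (U : opens X) (A : comPzRingType),
    [/\ open_set U x, is_spec U A & noetherian_ring A].

(* The last clause says that [p] is an open map on the sheet [V i]: as [p] is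
   continuous, it restricts to a homeomorphism from [V i] onto [U].  There may
   be no sheets at all over [U]. *)
Definition is_covering (S' S : topologicalType) (p : S' -> S) : Prop :=
  continuous p /\
  forall s : S, exists U : set S, [/\ open U, U s &
    exists (I : Type) (V : I -> set S'),
      [/\ (forall i, open (V i)),
          trivIset setT V,
          p @^-1` U = \bigcup_i V i &
          forall i, set_bij (V i) U p /\
            (forall W, open W -> W `<=` V i -> open (p @` W))]].

Record covering (S : topologicalType) := Covering {
  cov_space :> topologicalType;
  cov_proj : cov_space -> S;
  cov_projP : is_covering cov_proj
}.

Record cov_hom (S : topologicalType) (C D : covering S) := CovHom {
  cov_fun :> C -> D;
  cov_fun_continuous : continuous cov_fun;
  cov_fun_proj : forall y, cov_proj (cov_fun y) = cov_proj y
}.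

Definition fiber (S : topologicalType) (s : S) (C : covering S) : Type :=
  {y : C | cov_proj y = s}.

Definition fiber_map (S : topologicalType) (s : S) (C D : covering S)
    (h : cov_hom C D) (y : fiber s C) : fiber s D :=
  exist _ (h (sval y)) (etrans (cov_fun_proj h (sval y)) (svalP y)).

Section Pi1cs.
Variables (S : topologicalType) (s : S).

(* The type quantifies over all [topologicalType]s, so it is too
   large to be a [choiceType], hence a [groupType]: its group structure is
   given by [cs_mul], [cs_one], [cs_inv] and the laws below. *)
Record pi1cs := Pi1cs {
  cs_act :> forall C : covering S, fiber s C -> fiber s C;
  cs_bij : forall C, bijective (@cs_act C);
  cs_nat : forall (C D : covering S) (h : cov_hom C D) (y : fiber s C),
    cs_act (fiber_map h y) = fiber_map h (cs_act y)
}.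

Lemma pi1csP (a b : pi1cs) :
  (forall C (y : fiber s C), a C y = b C y) -> a = b.
Proof.
case: a b => [a a1 a2] [b b1 b2] /= ab.
have {}ab : a = b.
  by apply: functional_extensionality_dep => C; apply/funext => y; exact: ab.
by subst b; congr Pi1cs; exact: Prop_irrelevance.
Qed.

Lemma cs_mul_nat (a b : pi1cs) (C D : covering S) (h : cov_hom C D)
    (y : fiber s C) :
  a D (b D (fiber_map h y)) = fiber_map h (a C (b C y)).
Proof. by rewrite !cs_nat. Qed.

Definition cs_mul (a b : pi1cs) : pi1cs :=
  @Pi1cs (fun C y => a C (b C y))
    (fun C => bij_comp (cs_bij a C) (cs_bij b C)) (cs_mul_nat a b).

Definition cs_one : pi1cs :=
  @Pi1cs (fun C y => y) (fun C => inv_bij (fun y => erefl y))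
    (fun C D h y => erefl).

End Pi1cs.

Section Pi1csInv.
Variables (S : topologicalType) (s : S).

Lemma cs_inv_subproof (a : pi1cs s) :
  exists b : pi1cs s, cs_mul b a = cs_one s /\ cs_mul a b = cs_one s.
Proof.
have /(_ _)/cid-/all_sig[g gK] C : exists g, cancel (a C) g /\ cancel g (a C).
  by have [g] := cs_bij a C; exists g.
have gbij C : bijective (g C) by have [] := gK C; exists (a C).
have gnat (C D : covering S) (h : cov_hom C D) y :
    g D (fiber_map h y) = fiber_map h (g C y).
  apply: (can_inj (gK D).1); rewrite (gK D).2 cs_nat.
  by rewrite (gK C).2.
exists (Pi1cs gbij gnat); split; apply: pi1csP => C y /=.
  exact: (gK C).1.
exact: (gK C).2.
Qed.

Definition cs_inv (a : pi1cs s) : pi1cs s := projT1 (cid (cs_inv_subproof a)).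

Lemma cs_mulA : associative (@cs_mul S s).
Proof. by move=> a b c; exact: pi1csP. Qed.
Lemma cs_mul1g : left_id (cs_one s) (@cs_mul S s).
Proof. by move=> a; exact: pi1csP. Qed.
Lemma cs_mulg1 : right_id (cs_one s) (@cs_mul S s).
Proof. by move=> a; exact: pi1csP. Qed.
Lemma cs_mulVg : left_inverse (cs_one s) cs_inv (@cs_mul S s).
Proof. by move=> a; rewrite /cs_inv; case: cid => ? []. Qed.
Lemma cs_mulgV : right_inverse (cs_one s) cs_inv (@cs_mul S s).
Proof. by move=> a; rewrite /cs_inv; case: cid => ? []. Qed.

End Pi1csInv.

Lemma pair_continuous (X Y Z : topologicalType) (f : X -> Y) (g : X -> Z) :
  continuous f -> continuous g -> continuous (fun x => (f x, g x)).
Proof. by move=> cf cg x; apply: cvg_pair; [exact: cf|exact: cg]. Qed.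

Lemma comp_continuous (X Y Z : topologicalType) (f : X -> Y) (g : Y -> Z) :
  continuous f -> continuous g -> continuous (fun x => g (f x)).
Proof. by move=> cf cg x; apply: continuous_comp; [exact: cf|exact: cg]. Qed.

Section Pullback.
Variables (S' S : topologicalType) (f : continuousType S' S).

Definition pullback_space (C : covering S) : topologicalType :=
  set_type [set z : S' * C | f z.1 = cov_proj z.2].

Definition pullback_fst (C : covering S) (z : pullback_space C) : S' :=
  (set_val z).1.
Definition pullback_snd (C : covering S) (z : pullback_space C) : C :=
  (set_val z).2.

Lemma pullbackP (C : covering S) (z : pullback_space C) :
  f (pullback_fst z) = cov_proj (pullback_snd z).
Proof. exact: set_mem (valP z). Qed.

Definition pullback_pair (C : covering S) (x : S') (y : C)
    (xy : f x = cov_proj y) : pullback_space C :=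
  exist _ (x, y) (mem_set xy).

Lemma pullback_inj (C : covering S) (z w : pullback_space C) :
  pullback_fst z = pullback_fst w -> pullback_snd z = pullback_snd w -> z = w.
Proof.
rewrite /pullback_fst /pullback_snd => zw1 zw2; apply: val_inj.
by move: zw1 zw2; rewrite /set_val/=; case: (\val z) (\val w) => ? ? [? ?] /= -> ->.
Qed.

Lemma pullback_fst_continuous C : continuous (@pullback_fst C).
Proof.
move=> z; apply: (@continuous_comp _ _ _ set_val fst).
  exact: initial_continuous.
exact: cvg_fst.
Qed.

Lemma pullback_snd_continuous C : continuous (@pullback_snd C).
Proof.
move=> z; apply: (@continuous_comp _ _ _ set_val snd).
  exact: initial_continuous.
exact: cvg_snd.
Qed.

Lemma pullback_covering (C : covering S) : is_covering (@pullback_fst C).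
Proof.
split; first exact: pullback_fst_continuous.
move=> x; have [U [oU Ux [I [V [oV tV UV VU]]]]] := (cov_projP C).2 (f x).
exists (f @^-1` U); split => //.
  by apply: open_comp => // ? _; exact: cts_fun.
exists I, (fun i => @pullback_snd C @^-1` V i); split.
- by move=> i; apply: open_comp => // ? _; exact: pullback_snd_continuous.
- by move=> i j _ _ [z [/= zi zj]]; apply: tV => //; exists (pullback_snd z).
- apply/seteqP; split=> z /=; rewrite pullbackP.
    move=> Uz; have : (@cov_proj _ C @^-1` U) (pullback_snd z) by [].
    by rewrite UV => -[i _ Vi]; exists i.
  move=> [i _ /= Vi].
  have : (\bigcup_i V i) (pullback_snd z) by exists i.
  by rewrite -UV.
- move=> i; have [[Vsub Vinj Vsurj] Vopen] := VU i; split; first split.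
  + move=> z /= zi; rewrite pullbackP; exact: Vsub.
  + move=> z w /set_mem /= zi /set_mem /= wi zw; apply: pullback_inj => //.
    by apply: Vinj; rewrite ?inE// -!pullbackP zw.
  + move=> x' /= Ux'; have [y Vy yx] := Vsurj _ Ux'.
    by exists (pullback_pair (esym yx)).
  + move=> W [W0 oW0 <-] Wsub; rewrite openE => _ [z /= Wz <-].
    move: (oW0); rewrite openE => /(_ _ Wz)[[A B] /= [nA nB] AB].
    have [B' [oB' B'z B'B]] : exists B' : set C,
        [/\ open B', B' (pullback_snd z) & B' `<=` B `&` V i].
      exists (B^° `&` V i); split; first by apply: openI => //; exact: open_interior.
        by split=> //; exact: Wsub.
      by move=> y [/interior_subset].
    have oB : open (cov_proj (c:=C) @` B') by apply: Vopen => // y /B'B[].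
    have nB' : nbhs (pullback_fst z) (f @^-1` (cov_proj (c:=C) @` B')).
      apply: (@cts_fun _ _ f); apply: open_nbhs_nbhs; split=> //.
      by exists (pullback_snd z) => //; rewrite pullbackP.
    apply: filterS2 nA nB' => x' Ax' [y B'y yx'].
    exists (pullback_pair (esym yx')) => //=.
    apply: AB; split=> //=; by case: (B'B _ B'y).
Qed.

Definition pullback (C : covering S) : covering S' :=
  Covering (pullback_covering C).

Lemma pullback_hom_proj (C D : covering S) (h : cov_hom C D)
    (z : pullback C) : f (pullback_fst z) = cov_proj (h (pullback_snd z)).
Proof. by rewrite cov_fun_proj pullbackP. Qed.

Definition pullback_map (C D : covering S) (h : cov_hom C D)
    (z : pullback C) : pullback D := pullback_pair (pullback_hom_proj h z).

Lemma pullback_map_continuous (C D : covering S) (h : cov_hom C D) :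
  continuous (pullback_map h).
Proof.
apply: continuous_comp_initial.
apply: pair_continuous; first exact: pullback_fst_continuous.
move=> z; apply: continuous_comp; first exact: pullback_snd_continuous.
exact: cov_fun_continuous.
Qed.

Definition pullback_hom (C D : covering S) (h : cov_hom C D) :
    cov_hom (pullback C) (pullback D) :=
  @CovHom _ (pullback C) (pullback D) _
    (@pullback_map_continuous C D h) (fun z => erefl).

Variable s' : S'.

Lemma fiber_snd_proof (C : covering S) (z : fiber s' (pullback C)) :
  cov_proj (pullback_snd (sval z)) = f s'.
Proof. by rewrite -pullbackP; congr (f _); exact: svalP z. Qed.

Definition fiber_snd (C : covering S) (z : fiber s' (pullback C)) :
  fiber (f s') C := exist _ (pullback_snd (sval z)) (fiber_snd_proof z).

Definition fiber_pair (C : covering S) (y : fiber (f s') C) :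
    fiber s' (pullback C) :=
  exist (fun z : pullback C => cov_proj z = s')
    (pullback_pair (esym (svalP y))) erefl.

Lemma fiber_inj (T : topologicalType) (t : T) (C : covering T)
  (y z : fiber t C) : sval y = sval z -> y = z.
Proof. exact: eq_sig_hprop. Qed.

Lemma fiber_pairK C : cancel (@fiber_pair C) (@fiber_snd C).
Proof. by move=> y; exact: fiber_inj. Qed.

Lemma fiber_sndK C : cancel (@fiber_snd C) (@fiber_pair C).
Proof.
by move=> z; apply/fiber_inj/pullback_inj => //; exact/esym/(svalP z).
Qed.

Lemma pi1cs_map_bij (a : pi1cs s') C :
  bijective (fun y : fiber (f s') C => fiber_snd (a (pullback C) (fiber_pair y))).
Proof.
apply: (@bij_comp _ _ _ (@fiber_snd C) (fun y => a _ (fiber_pair y))).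
  exact: Bijective (@fiber_sndK C) (@fiber_pairK C).
apply: bij_comp; first exact: cs_bij.
exact: Bijective (@fiber_pairK C) (@fiber_sndK C).
Qed.

Lemma pi1cs_map_nat (a : pi1cs s') (C D : covering S) (h : cov_hom C D)
    (y : fiber (f s') C) :
  fiber_snd (a (pullback D) (fiber_pair (fiber_map h y))) =
  fiber_map h (fiber_snd (a (pullback C) (fiber_pair y))).
Proof.
have -> : fiber_pair (fiber_map h y) = fiber_map (pullback_hom h) (fiber_pair y).
  by apply/fiber_inj/pullback_inj.
by rewrite cs_nat; exact: fiber_inj.
Qed.

Definition pi1cs_map (a : pi1cs s') : pi1cs (f s') :=
  Pi1cs (pi1cs_map_bij a) (pi1cs_map_nat a).

End Pullback.

Section UnitInterval.
Variable R : realType.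

Definition unit_interval : Type := set_type (`[0, 1]%classic : set R).
HB.instance Definition _ := Topological.copy unit_interval
  (set_type (`[0, 1]%classic : set R)).

Lemma clamp_subproof (x : R) : Num.max 0 (Num.min 1 x) \in `[0, 1]%classic.
Proof.
by rewrite inE /= in_itv /= le_max lexx /= ge_max ler01 ge_min lexx.
Qed.

Definition clamp (x : R) : unit_interval := 
  exist (fun y : R => y \in `[0, 1]%classic) _ (clamp_subproof x).

Lemma unit_intervalP (t : unit_interval) : 0 <= set_val t <= 1.
Proof. by have := set_mem (valP t); rewrite /= in_itv. Qed.

Lemma val_clamp (x : R) : 0 <= x <= 1 -> set_val (clamp x) = x.
Proof. by move=> /andP[x0 x1]; rewrite /set_val /= min_r // max_r. Qed.

Lemma clampK : cancel set_val clamp.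
Proof. by move=> t; apply: val_inj; exact/val_clamp/unit_intervalP. Qed.

Lemma clamp_continuous : continuous clamp.
Proof.
apply: continuous_comp_initial => x.
apply: (@continuous_max _ _ (cst 0) (fun x : R^o => Num.min 1 x)).
  exact: cvg_cst.
by apply: (@continuous_min _ _ (cst 1) id); [exact: cvg_cst|exact: cvg_id].
Qed.

Lemma set_val_continuous : continuous (set_val : unit_interval -> R).
Proof. exact: initial_continuous. Qed.

Lemma clamp01 : clamp 0 != clamp 1.
Proof.
apply/eqP => /(congr1 set_val); rewrite !val_clamp ?lexx ?ler01 //.
by move=> /esym/eqP; rewrite oner_eq0.
Qed.

HB.instance Definition _ :=
  isBiPointed.Build unit_interval clamp01.

End UnitInterval.

Section Paths.
Variables (R : realType) (X : topologicalType).
Local Notation I := (unit_interval R).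

Lemma val_zero : set_val (zero : I) = 0 :> R.
Proof. by rewrite val_clamp // lexx ler01. Qed.
Lemma val_one : set_val (one : I) = 1 :> R.
Proof. by rewrite val_clamp // lexx ler01. Qed.

Lemma pasting (T : topologicalType) (h : T -> R) (c : R) (f g : T -> X) :
  continuous h -> continuous f -> continuous g ->
  (forall x, h x = c -> f x = g x) ->
  continuous (fun x => if h x <= c then f x else g x).
Proof.
move=> ch cf cg fg.
pose A := [set x | h x <= c]; pose B := [set x | c <= h x].
have cA : closed A.
  exact: (@closed_comp _ _ h [set y | y <= c] (fun x _ => ch x) (@closed_le R c)).
have cB : closed B.
  exact: (@closed_comp _ _ h [set y | c <= y] (fun x _ => ch x) (@closed_ge R c)).
have AB : A `|` B = setT.
  apply/seteqP; split=> // x _; rewrite /A /B /=.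
  by case: (leP (h x) c) => [|/ltW]; [left|right].
rewrite continuous_subspace_setT -AB.
apply: withinU_continuous => //.
- apply: (@subspace_eq_continuous _ _ _ f); last exact: continuous_subspaceT.
  by move=> x /set_mem Ax; rewrite /from_subspace /= ifT.
- apply: (@subspace_eq_continuous _ B _ g); last exact: continuous_subspaceT.
  move=> x /set_mem cx; rewrite /from_subspace /=; case: ifP => // xc.
  by apply/esym/fg/le_anti; rewrite xc cx.
Qed.

Lemma clamp_comp (T : topologicalType) (h : T -> R) :
  continuous h -> continuous (fun t => clamp (h t)).
Proof. move=> ch; exact: comp_continuous ch (@clamp_continuous R). Qed.

Lemma affine_comp (T : topologicalType) (h : T -> I) (a b : R) :
  continuous h -> continuous (fun t => a * set_val (h t) + b).
Proof.
move=> ch t; apply: cvgD; last exact: cvg_cst.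
apply: cvgM; first exact: cvg_cst.
exact: (comp_continuous ch (@set_val_continuous R)).
Qed.

Lemma first_half_continuous (T : topologicalType) (h : T -> I) :
  continuous h -> continuous (fun t => clamp (2 * set_val (h t))).
Proof.
move=> ch; apply: clamp_comp => t; apply: cvgM; first exact: cvg_cst.
exact: (comp_continuous ch (@set_val_continuous R)).
Qed.

Lemma second_half_continuous (T : topologicalType) (h : T -> I) :
  continuous h -> continuous (fun t => clamp (2 * set_val (h t) - 1)).
Proof. by move=> ch; apply/clamp_comp/affine_comp. Qed.

Lemma one_minus_continuous : continuous (fun t : I => clamp (1 - set_val t)).
Proof.
rewrite (_ : (fun _ => _) = fun t : I => clamp (-1 * set_val t + 1)).
  by apply/clamp_comp/affine_comp => t; exact: cvg_id.
by apply/funext => t; rewrite mulN1r addrC.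
Qed.

Variable x : X.
Definition loop := {path I from x to x in X}.

Section Concat.
Variables p q : loop.

Definition concat_fun (t : I) : X :=
  if set_val t <= 2^-1 then p (clamp (2 * set_val t))
  else q (clamp (2 * set_val t - 1)).

Lemma concat_continuous : continuous concat_fun.
Proof.
apply: pasting; first exact: set_val_continuous.
- apply: (comp_continuous _ (@cts_fun _ _ p)).
  by apply: first_half_continuous => t; exact: cvg_id.
- apply: (comp_continuous _ (@cts_fun _ _ q)).
  by apply: second_half_continuous => t; exact: cvg_id.
- move=> t ->; rewrite divff // subrr.
  by rewrite [LHS](@path_one I X) [RHS](@path_zero I X).
Qed.

Lemma concat_zero : concat_fun zero = x.
Proof.
rewrite /concat_fun val_zero invr_ge0 ler0n mulr0.
exact: (@path_zero I X).
Qed.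

Lemma concat_one : concat_fun one = x.
Proof.
rewrite /concat_fun val_one ifF; last by apply/negbTE; rewrite -ltNge; lra.
by rewrite mulr1 (_ : 2 - 1 = 1 :> R); [exact: (@path_one I X)|lra].
Qed.

Definition concat : loop :=
  mk_path concat_continuous concat_zero concat_one.

Lemma concatE t : concat t = if set_val t <= 2^-1
  then p (clamp (2 * set_val t)) else q (clamp (2 * set_val t - 1)).
Proof. by []. Qed.

End Concat.

Definition const_loop : loop := cst x.

Section Reverse.
Variable p : loop.
Definition reverse_fun (t : I) : X := p (clamp (1 - set_val t)).
Lemma reverse_continuous : continuous reverse_fun.
Proof. exact: (comp_continuous one_minus_continuous (@cts_fun _ _ p)). Qed.
Lemma reverse_zero : reverse_fun zero = x.
Proof. by rewrite /reverse_fun val_zero subr0; exact: (@path_one I X). Qed.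
Lemma reverse_one : reverse_fun one = x.
Proof. by rewrite /reverse_fun val_one subrr; exact: (@path_zero I X). Qed.
Definition reverse : loop :=
  mk_path reverse_continuous reverse_zero reverse_one.
Lemma reverseE t : reverse t = p (clamp (1 - set_val t)).
Proof. by []. Qed.
End Reverse.

Definition homotopic (p q : loop) : Prop :=
  exists H : I * I -> X,
    [/\ continuous H,
        (forall t, H (zero, t) = p t), (forall t, H (one, t) = q t) &
        (forall s, H (s, zero) = x /\ H (s, one) = x)].

Lemma homotopic_refl p : homotopic p p.
Proof.
exists (fun st => p st.2); split => //.
- by apply: (comp_continuous _ (@cts_fun _ _ p)) => st; exact: cvg_snd.
- by move=> s; rewrite [X in X = _](@path_zero I X) (@path_one I X).
Qed.

Lemma homotopic_sym p q : homotopic p q -> homotopic q p.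
Proof.
move=> [H [cH H0 H1 Hx]].
exists (fun st => H (clamp (1 - set_val st.1), st.2)); split.
- apply: (comp_continuous _ cH); apply: pair_continuous => [|st].
    apply: (comp_continuous _ one_minus_continuous) => st; exact: cvg_fst.
  exact: cvg_snd.
- by move=> t /=; rewrite val_zero subr0 H1.
- by move=> t /=; rewrite val_one subrr H0.
- by move=> s; exact: Hx.
Qed.

Lemma homotopic_trans p q r : homotopic p q -> homotopic q r -> homotopic p r.
Proof.
move=> [H [cH H0 H1 Hx]] [K [cK K0 K1 Kx]].
exists (fun st => if set_val st.1 <= 2^-1 then H (clamp (2 * set_val st.1), st.2)
  else K (clamp (2 * set_val st.1 - 1), st.2)); split.
- apply: pasting.
  + by apply: (comp_continuous _ (@set_val_continuous R)) => st; exact: cvg_fst.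
  + apply: (comp_continuous _ cH); apply: pair_continuous => [|st].
      by apply: first_half_continuous => st; exact: cvg_fst.
    exact: cvg_snd.
  + apply: (comp_continuous _ cK); apply: pair_continuous => [|st].
      by apply: second_half_continuous => st; exact: cvg_fst.
    exact: cvg_snd.
  + move=> [s t] /= ->; rewrite divff // subrr.
    by rewrite [LHS]H1 [RHS]K0.
- by move=> t /=; rewrite val_zero invr_ge0 ler0n mulr0 H0.
- move=> t /=; rewrite val_one ifF; last by apply/negbTE; rewrite -ltNge; lra.
  by rewrite mulr1 (_ : 2 - 1 = 1 :> R); [exact: K1|lra].
- by move=> s /=; case: ifP.
Qed.

Lemma concat_homotopic p p' q q' : homotopic p p' -> homotopic q q' ->
  homotopic (concat p q) (concat p' q').
Proof.
move=> [H [cH H0 H1 Hx]] [K [cK K0 K1 Kx]].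
exists (fun st => if set_val st.2 <= 2^-1 then H (st.1, clamp (2 * set_val st.2))
  else K (st.1, clamp (2 * set_val st.2 - 1))); split.
- apply: pasting.
  + by apply: (comp_continuous _ (@set_val_continuous R)) => st; exact: cvg_snd.
  + apply: (comp_continuous _ cH); apply: pair_continuous => [st|].
      exact: cvg_fst.
    by apply: first_half_continuous => st; exact: cvg_snd.
  + apply: (comp_continuous _ cK); apply: pair_continuous => [st|].
      exact: cvg_fst.
    by apply: second_half_continuous => st; exact: cvg_snd.
  + move=> [s t] /= ->; rewrite divff // subrr.
    by rewrite [LHS](Hx s).2 [RHS](Kx s).1.
- by move=> t /=; rewrite H0 K0.
- by move=> t /=; rewrite H1 K1.
- move=> s /=; rewrite val_zero val_one invr_ge0 ler0n mulr0 mulr1.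
  rewrite (Hx s).1 ifF; last by apply/negbTE; rewrite -ltNge; lra.
  by rewrite (_ : 2 - 1 = 1 :> R); [rewrite (Kx s).2|lra].
Qed.

Lemma reparam_homotopic (p a b : loop) (phi psi : I -> R) :
  continuous phi -> continuous psi ->
  phi zero = psi zero -> phi one = psi one ->
  (forall t, a t = p (clamp (phi t))) -> (forall t, b t = p (clamp (psi t))) ->
  homotopic a b.
Proof.
move=> cphi cpsi e0 e1 aE bE.
exists (fun st => p (clamp ((1 - set_val st.1) * phi st.2
                          + set_val st.1 * psi st.2))); split.
- apply: (comp_continuous _ (@cts_fun _ _ p)); apply: clamp_comp => st.
  have c1 : {for st, continuous (fun st : I * I => set_val st.1)}.
    apply: (comp_continuous _ (@set_val_continuous R)) => ?; exact: cvg_fst.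
  apply: cvgD; apply: cvgM.
  + by apply: cvgB; [exact: cvg_cst|exact: c1].
  + by apply: (comp_continuous _ cphi) => ?; exact: cvg_snd.
  + exact: c1.
  + by apply: (comp_continuous _ cpsi) => ?; exact: cvg_snd.
- by move=> t /=; rewrite val_zero subr0 mul1r mul0r addr0 aE.
- by move=> t /=; rewrite val_one subrr mul1r mul0r add0r bE.
- move=> s /=; rewrite -e0 -e1 -!mulrDl subrK !mul1r -!aE.
  by rewrite [X in X = _](@path_zero I X) (@path_one I X).
Qed.

Definition homotopic_rel : rel loop := fun p q => `[< homotopic p q >].

Lemma homotopic_rel_equiv : equiv_class_of homotopic_rel.
Proof.
split=> [p|p q|q p r].
- exact/asboolP/homotopic_refl.
- by apply/asboolP/asboolP; exact: homotopic_sym.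
- by move=> /asboolP pq /asboolP qr; apply/asboolP; exact: homotopic_trans pq qr.
Qed.

Canonical homotopic_equiv := EquivRelPack homotopic_rel_equiv.

Local Open Scope quotient_scope.

Definition pi1 : Type := {eq_quot homotopic_equiv}.
HB.instance Definition _ := Quotient.on pi1.
HB.instance Definition _ := Choice.on pi1.

Definition loop_class (p : loop) : pi1 := \pi_pi1 p.

Lemma loop_classP p q : loop_class p = loop_class q <-> homotopic p q.
Proof. by split=> [/eqmodP/asboolP//|pq]; apply/eqmodP/asboolP. Qed.

Lemma loop_class_repr (a : pi1) : loop_class (repr a) = a.
Proof. exact: reprK. Qed.

Definition pi1_one : pi1 := loop_class const_loop.
Definition pi1_mul (a b : pi1) : pi1 := loop_class (concat (repr a) (repr b)).
Definition pi1_inv (a : pi1) : pi1 := loop_class (reverse (repr a)).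

Lemma pi1_mulE p q :
  pi1_mul (loop_class p) (loop_class q) = loop_class (concat p q).
Proof.
by apply/loop_classP/concat_homotopic; apply/loop_classP; rewrite loop_class_repr.
Qed.

Lemma max_continuous (T : topologicalType) (f g : T -> R) :
  continuous f -> continuous g -> continuous (fun t => Num.max (f t) (g t)).
Proof.
by move=> cf cg t; apply: (@continuous_max R T f g t); [exact: cf|exact: cg].
Qed.

Lemma min_continuous (T : topologicalType) (f g : T -> R) :
  continuous f -> continuous g -> continuous (fun t => Num.min (f t) (g t)).
Proof.
by move=> cf cg t; apply: (@continuous_min R T f g t); [exact: cf|exact: cg].
Qed.

Lemma affine_continuous (a b : R) : continuous (fun t : I => a * set_val t + b).
Proof. by apply: affine_comp => t; exact: cvg_id. Qed.

Lemma const_continuous (a : R) : continuous (fun t : I => a).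
Proof. exact: cst_continuous. Qed.

Lemma abs_continuous : continuous (fun t : I => `|2 * set_val t - 1|).
Proof.
exact: (@comp_continuous _ _ _ _ (fun y : R => `|y|) (@affine_continuous 2 (-1))
  (@norm_continuous R R)).
Qed.

Lemma const_concat p : homotopic (concat const_loop p) p.
Proof.
apply: (@reparam_homotopic p _ _ (fun t => Num.max 0 (2 * set_val t - 1)) set_val).
- by apply: max_continuous; [exact: const_continuous|exact: affine_continuous].
- exact: set_val_continuous.
- by rewrite val_zero mulr0 add0r max_l // oppr_le0 ler01.
- by rewrite val_one mulr1 max_r; lra.
- move=> t; rewrite [LHS]concatE; case: ifP => ht.
    rewrite max_l; last lra.
    by rewrite [RHS](@path_zero I X).
  rewrite max_r //; move/negbT: ht; rewrite -ltNge; lra.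
- by move=> t; rewrite clampK.
Qed.

Lemma concat_const p : homotopic (concat p const_loop) p.
Proof.
apply: (@reparam_homotopic p _ _ (fun t => Num.min 1 (2 * set_val t)) set_val).
- apply: min_continuous; first exact: const_continuous.
  rewrite (_ : (fun _ => _) = fun t : I => 2 * set_val t + 0).
    exact: affine_continuous.
  by apply/funext => t; rewrite addr0.
- exact: set_val_continuous.
- by rewrite val_zero mulr0 min_r // ler01.
- by rewrite val_one mulr1 min_l; lra.
- move=> t; rewrite [LHS]concatE; case: ifP => ht.
    by rewrite min_r //; lra.
  rewrite min_l; last by move/negbT: ht; rewrite -ltNge; lra.
  by rewrite [RHS](@path_one I X).
- by move=> t; rewrite clampK.
Qed.

Lemma concat_reverse p : homotopic (concat (reverse p) p) const_loop.
Proof.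
apply: (@reparam_homotopic p _ _ (fun t => `|2 * set_val t - 1|) (fun=> 1)).
- exact: abs_continuous.
- exact: const_continuous.
- by rewrite val_zero mulr0 add0r normrN normr1.
- by rewrite val_one mulr1 ger0_norm; lra.
- move=> t; have /andP[t0 t1] := unit_intervalP t.
  rewrite [LHS]concatE; case: ifP => ht.
    rewrite ler0_norm; last lra.
    by rewrite [LHS]reverseE val_clamp ?opprB //; apply/andP; split; lra.
  by rewrite ger0_norm //; move/negbT: ht; rewrite -ltNge; lra.
- by move=> t; rewrite [RHS](@path_one I X).
Qed.

Lemma concat_reverseR p : homotopic (concat p (reverse p)) const_loop.
Proof.
apply: (@reparam_homotopic p _ _
  (fun t => Num.min (2 * set_val t + 0) (- 2 * set_val t + 2)) (fun=> 0)).
- by apply: min_continuous; exact: affine_continuous.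
- exact: const_continuous.
- by rewrite val_zero !mulr0 add0r min_l; lra.
- by rewrite val_one !mulr1 min_r; lra.
- move=> t; have /andP[t0 t1] := unit_intervalP t.
  rewrite [LHS]concatE; case: ifP => ht.
    by rewrite min_l ?addr0 //; lra.
  move/negbT: ht; rewrite -ltNge => ht.
  rewrite min_r; last lra.
  rewrite [LHS]reverseE val_clamp; last by apply/andP; split; lra.
  by congr (p (clamp _)); lra.
- by move=> t; rewrite [RHS](@path_zero I X).
Qed.

Lemma concatA p q r : homotopic (concat p (concat q r)) (concat (concat p q) r).
Proof.
apply: homotopic_sym.
pose phi (t : I) : R := Num.min (Num.min (2 * set_val t + 0)
  (1 * set_val t + 4^-1)) (2^-1 * set_val t + 2^-1).
apply: (@reparam_homotopic (concat p (concat q r)) _ _ phi set_val).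
- apply: min_continuous; last exact: affine_continuous.
  by apply: min_continuous; exact: affine_continuous.
- exact: set_val_continuous.
- by rewrite /phi val_zero !mulr0 !add0r !min_l; lra.
- rewrite /phi val_one min_r; first lra.
  by rewrite le_min; apply/andP; split; lra.
- move=> t; have /andP[t0 t1] := unit_intervalP t.
  have [t4|t4] := leP (set_val t) 4^-1.
    have -> : phi t = 2 * set_val t by rewrite /phi addr0 min_l ?min_l //; lra.
    rewrite [LHS]concatE ifT; last lra.
    rewrite [LHS]concatE val_clamp; last by apply/andP; split; lra.
    rewrite ifT; last lra.
    rewrite [RHS]concatE val_clamp; last by apply/andP; split; lra.
    by rewrite ifT; last lra.
  have [t2|t2] := leP (set_val t) 2^-1.
    have -> : phi t = set_val t + 4^-1.
      by rewrite /phi mul1r addr0 (@min_r _ _ _ (set_val t + _)) ?min_l //; lra.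
    rewrite [LHS]concatE ifT; last lra.
    rewrite [LHS]concatE val_clamp; last by apply/andP; split; lra.
    rewrite ifF; last by apply/negbTE; rewrite -ltNge; lra.
    rewrite [RHS]concatE val_clamp; last by apply/andP; split; lra.
    rewrite ifF; last by apply/negbTE; rewrite -ltNge; lra.
    rewrite [RHS]concatE val_clamp; last by apply/andP; split; lra.
    rewrite ifT; last lra.
    by congr (q (clamp _)); lra.
  have -> : phi t = 2^-1 * set_val t + 2^-1.
    by rewrite /phi min_r // le_min; apply/andP; split; lra.
  rewrite [LHS]concatE ifF; last by apply/negbTE; rewrite -ltNge; lra.
  rewrite [RHS]concatE val_clamp; last by apply/andP; split; lra.
  rewrite ifF; last by apply/negbTE; rewrite -ltNge; lra.
  rewrite [RHS]concatE val_clamp; last by apply/andP; split; lra.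
  rewrite ifF; last by apply/negbTE; rewrite -ltNge; lra.
  by congr (r (clamp _)); lra.
- by move=> t; rewrite clampK.
Qed.

Lemma pi1_mulA : associative pi1_mul.
Proof.
move=> a b c; rewrite -(loop_class_repr a) -(loop_class_repr b).
by rewrite -(loop_class_repr c) !pi1_mulE; exact/loop_classP/concatA.
Qed.
Lemma pi1_mul1g : left_id pi1_one pi1_mul.
Proof.
move=> a; rewrite -{2}(loop_class_repr a) -{1}(loop_class_repr a) pi1_mulE.
exact/loop_classP/const_concat.
Qed.
Lemma pi1_mulg1 : right_id pi1_one pi1_mul.
Proof.
move=> a; rewrite -{2}(loop_class_repr a) -{1}(loop_class_repr a) pi1_mulE.
exact/loop_classP/concat_const.
Qed.
Lemma pi1_mulVg : left_inverse pi1_one pi1_inv pi1_mul.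
Proof.
move=> a; rewrite -{2}(loop_class_repr a) pi1_mulE.
exact/loop_classP/concat_reverse.
Qed.
Lemma pi1_mulgV : right_inverse pi1_one pi1_inv pi1_mul.
Proof.
move=> a; rewrite -{1}(loop_class_repr a) pi1_mulE.
exact/loop_classP/concat_reverseR.
Qed.

HB.instance Definition _ :=
  isGroup.Build pi1 pi1_mulA pi1_mul1g pi1_mulg1 pi1_mulVg pi1_mulgV.

End Paths.

Section Pi1Map.
Variables (R : realType) (X Y : topologicalType) (f : continuousType X Y).
Variable x : X.

Definition pi1_map (a : pi1 R x) : pi1 R (f x) :=
  loop_class (f \o repr a : loop R (f x)).

Lemma pi1_mapE (p : loop R x) :
  pi1_map (loop_class p) = loop_class (f \o p : loop R (f x)).
Proof.
apply/loop_classP.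
have /loop_classP [H [cH H0 H1 Hx]] := loop_class_repr (loop_class p).
exists (f \o H); split.
- exact: (comp_continuous cH (@cts_fun _ _ f)).
- by move=> t /=; rewrite H0.
- by move=> t /=; rewrite H1.
- by move=> s /=; rewrite (Hx s).1 (Hx s).2.
Qed.

End Pi1Map.

Section Components.
Variable E : topologicalType.

Definition irreducible (A : set E) : Prop :=
  A !=set0 /\ forall F G : set E, closed F -> closed G ->
    A `<=` F `|` G -> A `<=` F \/ A `<=` G.

Definition irreducible_component (A : set E) : Prop :=
  irreducible A /\ forall B, irreducible B -> A `<=` B -> B = A.

Definition irr_comp : Type := set_type [set A : set E | irreducible_component A].
HB.instance Definition _ := Choice.on irr_comp.

Definition comp_set (v : irr_comp) : set E := set_val v.

Definition stratum (sigma : {fset irr_comp}) : set E :=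
  [set x | forall v, v \in sigma -> comp_set v x].

Definition stratum_comp (sigma : {fset irr_comp}) : Type :=
  set_type [set A : set E | exists2 x, stratum sigma x &
    A = connected_component (stratum sigma) x].
HB.instance Definition _ sigma := Choice.on (stratum_comp sigma).

Definition cell : Type := {sigma : {fset irr_comp} & stratum_comp sigma}.
HB.instance Definition _ := Choice.on cell.

Definition cell_verts (c : cell) : {fset irr_comp} := projT1 c.
Definition cell_set (c : cell) : set E := set_val (projT2 c).

Lemma cell_setP (c : cell) : exists2 x, stratum (cell_verts c) x &
  cell_set c = connected_component (stratum (cell_verts c)) x.
Proof. exact: set_mem (valP (projT2 c)). Qed.

End Components.

(* The topology is that of pointwise convergence in [R^K]; as the coordinates
   outside the finite set [sigma] vanish, it is the Euclidean one.  The simplex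
   is empty for [sigma] empty, so the stratum of [fset0] contributes nothing to
   the dual complex. *)
Definition simplex (R : realType) (K : choiceType) (sigma : {fset K}) : Type :=
  set_type [set t : {ptws K -> R} | [/\ (forall v, 0 <= t v),
    (forall v, v \notin sigma -> t v = 0) & \sum_(v <- sigma) t v = 1]].
HB.instance Definition _ R K sigma := Topological.on (@simplex R K sigma).

Definition simplex_coord (R : realType) (K : choiceType) (sigma : {fset K})
  (t : simplex R sigma) : K -> R := set_val t.

Section DualComplex.
Variables (R : realType) (E : topologicalType).

Definition dual_cells : Type := {c : cell E & simplex R (cell_verts c)}.
HB.instance Definition _ := Topological.on dual_cells.

(* [x] in [Delta_(tau,beta)] is identified with its image [y] in
   [Delta_(sigma,alpha)], when [tau `<=` sigma] and [E_alpha `<=` E_beta] *)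
Definition face_glue (x y : dual_cells) : Prop :=
  [/\ (cell_verts (tag x) `<=` cell_verts (tag y))%fset,
      cell_set (tag y) `<=` cell_set (tag x) &
      simplex_coord (tagged x) = simplex_coord (tagged y)].

Definition glue_rel : rel dual_cells :=
  fun x y => `[< clos_refl_sym_trans _ face_glue x y >].

Lemma glue_rel_equiv : equiv_class_of glue_rel.
Proof.
split=> [x|x y|y x z].
- exact/asboolP/rst_refl.
- by apply/asboolP/asboolP; exact: rst_sym.
- by move=> /asboolP xy /asboolP yz; apply/asboolP; exact: rst_trans xy yz.
Qed.

Canonical glue_equiv := EquivRelPack glue_rel_equiv.

Local Open Scope quotient_scope.

(* Barycentric coordinates make the gluing independent of an ordering of the
   irreducible components: an ordering would only orient the simplices. *)
Definition dual_complex : Type := quotient_topology {eq_quot glue_equiv}.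
HB.instance Definition _ := Topological.on dual_complex.
HB.instance Definition _ := Quotient.on dual_complex.

Definition dual_point (x : dual_cells) : dual_complex := \pi_dual_complex x.

Lemma dual_pointP x y :
  dual_point x = dual_point y <-> clos_refl_sym_trans _ face_glue x y.
Proof.
have e : (dual_point x = dual_point y) =
         (\pi_({eq_quot glue_equiv}) x = \pi_({eq_quot glue_equiv}) y) by [].
by rewrite e; split=> [/eqmodP/asboolP|xy]; last exact/eqmodP/asboolP.
Qed.

End DualComplex.

Section PointwiseContinuity.
Variables (K : choiceType) (T : topologicalType) (Z : topologicalType).

Lemma ptws_continuous (g : T -> {ptws K -> Z}) :
  (forall v, continuous (fun x => g x v)) -> continuous g.
Proof.
move=> cg x; apply/cvg_sup => v.
exact: (@continuous_comp_initial _ _ _ (fun t : {ptws K -> Z} => t v) g (cg v) x).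
Qed.

Lemma ptws_eval_continuous (v : K) : continuous (fun t : {ptws K -> Z} => t v).
Proof. exact: proj_continuous. Qed.

End PointwiseContinuity.

(* A continuous [f] maps each irreducible component into at least one
   irreducible component; [phi] is a choice of one. *)
Section DualMap.
Variables (R : realType) (E' E : topologicalType) (f : continuousType E' E).
Variable phi : irr_comp E' -> irr_comp E.
Hypothesis f_phi : forall v, f @` comp_set v `<=` comp_set (phi v).

Definition push_verts (sigma : {fset irr_comp E'}) : {fset irr_comp E} :=
  [fset phi v | v in sigma]%fset.

Lemma push_vertsP sigma v : v \in sigma -> phi v \in push_verts sigma.
Proof. exact: in_imfset. Qed.

Lemma push_stratum sigma x :
  stratum sigma x -> stratum (push_verts sigma) (f x).
Proof.
by move=> sx _ /imfsetP[v /= vs ->]; apply: f_phi; exists x => //; exact: sx.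
Qed.

(* the connected component of [E_(phi sigma)] containing [f (E'_alpha)] *)
Definition push_set (c : cell E') : set E :=
  \bigcup_(x in cell_set c)
    connected_component (stratum (push_verts (cell_verts c))) (f x).

Lemma cell_sub (c : cell E') : cell_set c `<=` stratum (cell_verts c).
Proof. by have [x _ ->] := cell_setP c; exact: connected_component_sub. Qed.

Lemma push_setE (c : cell E') x : cell_set c x ->
  push_set c = connected_component (stratum (push_verts (cell_verts c))) (f x).
Proof.
move=> cx; apply/seteqP; split=> [y [z cz]|y yx]; last by exists x.
suff fxz : connected_component (stratum (push_verts (cell_verts c))) (f x) (f z).
  by rewrite (same_connected_component fxz).
have [x0 _ cE] := cell_setP c.
exists (f @` cell_set c); last by exists z.
split; first by exists x.
  by move=> _ [w cw <-]; apply/push_stratum/cell_sub.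
apply: connected_continuous_connected.
  by rewrite cE; exact: component_connected.
by apply: continuous_subspaceT; exact: cts_fun.
Qed.

Lemma push_set_comp (c : cell E') : exists2 x,
  stratum (push_verts (cell_verts c)) x &
  push_set c = connected_component (stratum (push_verts (cell_verts c))) x.
Proof.
have [x sx cE] := cell_setP c.
have cx : cell_set c x by rewrite cE; exact: connected_component_refl.
by exists (f x); [exact: push_stratum|exact: push_setE].
Qed.

Definition push_cell (c : cell E') : cell E :=
  existT (fun s => stratum_comp s) (push_verts (cell_verts c))
    (exist _ (push_set c) (mem_set (push_set_comp c))).

Definition push_coord (sigma : {fset irr_comp E'}) (t : irr_comp E' -> R) :
    irr_comp E -> R :=
  fun w => \sum_(v <- sigma | phi v == w) t v.

Lemma push_coordP (sigma : {fset irr_comp E'}) (t : simplex R sigma) :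
  [/\ (forall w, 0 <= push_coord sigma (simplex_coord t) w),
      (forall w, w \notin push_verts sigma ->
         push_coord sigma (simplex_coord t) w = 0) &
      \sum_(w <- push_verts sigma) push_coord sigma (simplex_coord t) w = 1].
Proof.
have [t0 ts t1] := set_mem (valP t); split.
- by move=> w; apply: sumr_ge0 => v _; exact: t0.
- move=> w wn; rewrite /push_coord big1_seq // => v /andP[/eqP vw vs].
  by move: wn => /negP[]; rewrite -vw; exact: push_vertsP.
- rewrite -[RHS]t1 /push_coord.
  under eq_bigr do rewrite big_mkcond.
  rewrite exchange_big /=; apply: eq_big_seq => v vs.
  rewrite (bigD1_seq (phi v)) /= ?push_vertsP ?fset_uniq //.
  by rewrite eqxx big1 ?addr0 // => w; rewrite eq_sym => /negbTE ->.
Qed.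

Definition push_simplex (sigma : {fset irr_comp E'}) (t : simplex R sigma) :
    simplex R (push_verts sigma) :=
  exist _ (push_coord sigma (simplex_coord t)) (mem_set (push_coordP t)).

Lemma simplex_coord_continuous (K : choiceType) (sigma : {fset K}) (v : K) :
  continuous (fun t : simplex R sigma => simplex_coord t v).
Proof.
apply: (comp_continuous (f := set_val) _ (@ptws_eval_continuous K R v)).
exact: initial_continuous.
Qed.

Lemma push_simplex_continuous sigma : continuous (@push_simplex sigma).
Proof.
apply: continuous_comp_initial; apply: ptws_continuous => w.
apply: (@continuous_big _ _ _ _ _ _ _ sigma (fun v t => simplex_coord t v)).
  exact: add_continuous.
by move=> v _; exact: simplex_coord_continuous.
Qed.

Definition push_cells (x : dual_cells R E') : dual_cells R E :=
  existT (fun c => simplex R (cell_verts c)) (push_cell (tag x))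
    (push_simplex (tagged x)).

Lemma push_face_glue x y :
  face_glue x y -> face_glue (push_cells x) (push_cells y).
Proof.
move=> [xy yx txy]; split.
- apply/fsubsetP => _ /imfsetP[v /= vx ->]; apply: push_vertsP.
  exact: (fsubsetP xy).
- move=> z [w yw zw]; exists w; first exact: yx.
  case: zw => C [Cfw Csub Cc] Cz; exists C => //; split => //.
  move=> u /Csub su v /imfsetP[v' /= v'x ->]; apply: su.
  by apply: push_vertsP; exact: (fsubsetP xy).
- apply/funext => w; rewrite /simplex_coord /= /push_coord.
  rewrite [LHS]big_mkcond [RHS]big_mkcond /= txy.
  apply: big_fset_incl => // v vy vx; case: ifP => // _.
  have [_ ts _] := set_mem (valP (tagged x)).
  by rewrite -txy; exact: ts.
Qed.

Local Open Scope quotient_scope.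

Lemma push_glue x y : clos_refl_sym_trans _ (@face_glue R E') x y ->
  dual_point (push_cells x) = dual_point (push_cells y).
Proof.
elim=> {x y} [x y xy|//|x y _ -> //|x y z _ -> _ -> //].
by apply/dual_pointP; apply: rst_step; exact: push_face_glue.
Qed.

Definition dual_map_fun (x : dual_complex R E') : dual_complex R E :=
  dual_point (push_cells (repr x)).

Lemma dual_map_funE x :
  dual_map_fun (dual_point x) = dual_point (push_cells x).
Proof. by apply/push_glue/dual_pointP; exact: reprK. Qed.

Lemma push_cells_continuous : continuous push_cells.
Proof.
apply: (@sigT_continuous (cell E') (fun c => simplex R (cell_verts c)) _
  (fun c t => existT (fun c => simplex R (cell_verts c)) (push_cell c)
    (push_simplex t))) => c.
apply: (comp_continuous _ (@existT_continuous _
  (fun c : cell E => simplex R (cell_verts c)) (push_cell c))).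
exact: push_simplex_continuous.
Qed.

Lemma dual_map_continuous : continuous dual_map_fun.
Proof.
apply/quotient_continuous.
rewrite (_ : _ \o _ = @dual_point R E \o push_cells); last first.
  by apply/funext => x; exact: dual_map_funE.
exact: (comp_continuous push_cells_continuous (@pi_continuous _ _)).
Qed.

(* In coordinates, the vertex [v] goes to [phi v] and the cell [E'_alpha] to
   the cell whose stratum component contains [f (E'_alpha)]. *)
Definition dual_map : dual_complex R E' -> dual_complex R E :=
  mkcts dual_map_continuous.
HB.instance Definition _ := Continuous.on dual_map.

End DualMap.

(* [s] lies in the connected component [E_alpha] of a cell carrying [x], so that
   the fibre over [s] of a covering of [E] is canonically identified with the
   fibre over [x] of the corresponding covering of the dual complex. *)
Definition incident (R : realType) (E : topologicalType) (s : E)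
    (x : dual_complex R E) : Prop :=
  exists2 y : dual_cells R E, cell_set (tag y) s & x = dual_point y.

(* Main.v *)
Require Import Defs.
From HB Require Import structures.
From Stdlib Require Import Relation_Operators.
From mathcomp Require Import all_boot all_order all_algebra.
From mathcomp Require Import generic_quotient finmap.
From mathcomp Require Import all_classical all_reals all_analysis.
From mathcomp Require Import continuous_path lra.

(** The cells [c] of [E], pairs of a finite set of irreducible components and a
    connected component of their intersection, are preordered by [cell_le]: the
    simplex of [c] is a face of that of [d].  Two maps land in this preorder.
    [carrier] sends a point of the dual complex to the cell whose open simplex
    contains it; since open stars are open, it only increases near a point
    ([carrier_near]).  [top_cell] sends [s] in [E] to the largest cell around it;
    as the irreducible components of a locally noetherian space are locally
    finite, it only decreases near a point ([top_cell_near]).  Local systems on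
    the preorder therefore pull back to coverings on both sides, and both
    fundamental groups turn out to be that of the preorder.

    On the side of [E]: any two non-empty open subsets of an irreducible space
    meet, so coverings of it split.  Hence a covering splits over every cell,
    the splittings are compatible, and the leaves form a local system
    ([leaf_system]); conversely a local system [L] glues to a covering
    ([etale_cover]).

    On the side of the dual complex: along a path the elements of a local system
    can be transported, uniquely and invariantly under homotopy
    ([path_lift], [transport_unique], [transport_homotopy]).  The universal
    local system at [x] is [path_system]: over [c], the paths from [x] to the
    closed simplex of [c], up to homotopies whose endpoint stays in that simplex.
    Convexity of simplices makes it a local system, and contractibility of open
    stars shows that transport of the constant path along [q] yields [q] itself
    ([prefix_near], [path_transport]).

    Let [U] be the covering of [E] glued from [path_system], and suppose that
    [s] and [x] are incident.  The class of the constant path is a point of [U]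
    over [s], and transport shows that [U] maps to every covering with a chosen
    point over [s] ([etale_hom_exists]).  An automorphism of the fibre functor is
    thus determined by the image of the constant path, which is a homotopy class
    of loops ([monodromy]), and any loop occurs because it acts on all fibres by
    transport ([monodromy_loop_aut]).  Products come out in the opposite order,
    so the isomorphism is the monodromy of the inverse.  It is natural because
    paths can be pushed forward ([push_etale]).  When [s] and [x] are not
    incident, [s] is first moved inside the connected space [E] to a point
    incident to [x]: all the fibre functors are isomorphic
    ([fiber_iso_connected]). *)

Set Implicit Arguments.
Unset Strict Implicit.
Unset Printing Implicit Defensive.
Import Order.TTheory GRing.Theory Num.Theory numFieldNormedType.Exports.
Local Open Scope classical_set_scope.
Local Open Scope ring_scope.

Lemma slice_continuous (X Y : topologicalType) (y : Y) :
  continuous (fun x : X => (x, y)).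
Proof.
by apply: pair_continuous; [move=> x; exact: cvg_id|exact: cst_continuous].
Qed.

Lemma coslice_continuous (X Y : topologicalType) (x : X) :
  continuous (fun y : Y => (x, y)).
Proof.
by apply: pair_continuous; [exact: cst_continuous|move=> y; exact: cvg_id].
Qed.

(** * Connectedness arguments and the unit interval *)

Lemma near_all (T : topologicalType) (t : T) (Q : T -> Prop) :
  (forall u, Q u) -> \forall u \near t, Q u.
Proof. by move=> Qu; exact: nearW. Qed.

(** All continuation arguments below have this form: the assertion to be
    propagated is shown to be locally constant along a connected set. *)
Lemma connected_locally_constant (T : topologicalType) (A : set T)
    (Q : T -> Prop) : connected A ->
  (forall s, A s -> \forall t \near s, A t -> (Q s <-> Q t)) ->
  forall s t, A s -> A t -> Q s -> Q t.
Proof.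
move=> cA lQ s t As At Qs.
suff AQ : A `&` Q = A by move: At; rewrite -AQ => -[].
apply: cA; first by exists s.
  exists [set u | A u -> Q u]^°; first exact: open_interior.
  apply/seteqP; split=> u [Au].
    move=> Qu; split=> //; apply: filterS (lQ _ Au) => v /= uv Av.
    by apply/(uv Av).
  by move=> /interior_subset/(_ Au).
exists (~` [set u | A u -> ~ Q u]^°).
  exact/open_closedC/open_interior.
apply/seteqP; split=> u [Au].
  by move=> Qu; split=> // /interior_subset /(_ Au).
move=> nQ; split=> //; apply: contrapT => nQu; apply: nQ.
by apply: filterS (lQ _ Au) => v /= uv Av Qv; apply/nQu/(uv Av).
Qed.

Section UnitIntervalTopology.
Variable R : realType.
Local Notation I := (unit_interval R).

Lemma clamp_image_connected (J : interval R) : connected (@clamp R @` [set` J]).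
Proof.
apply: connected_continuous_connected.
  exact/connected_intervalP/interval_is_interval.
exact/continuous_subspaceT/clamp_continuous.
Qed.

Lemma unit_interval_image : @clamp R @` `[0, 1] = [set: I].
Proof.
apply/seteqP; split=> // t _; exists (set_val t); last exact: clampK.
by rewrite /= in_itv /=; exact: unit_intervalP.
Qed.

Lemma unit_interval_connected : connected [set: I].
Proof. rewrite -unit_interval_image; exact: clamp_image_connected. Qed.

Lemma unit_interval_ball (t : I) (M : set I) : nbhs t M ->
  exists2 e : R, 0 < e & forall u : R, `|u - set_val t| < e -> M (clamp u).
Proof.
rewrite -{1}[t]clampK => /clamp_continuous /nbhs_ballP[e /= e0 eM].
by exists e => // u ut; apply: eM; rewrite /ball /= distrC.
Qed.

Lemma near_val_itv (J : interval R) (t : I) :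
  (\forall y \near (set_val t : R), y \in J) -> \forall u \near t, set_val u \in J.
Proof. exact: (@set_val_continuous R t [set y | y \in J]). Qed.

Lemma unit_interval_locally_connected (t : I) (M : set I) : nbhs t M ->
  exists A : set I, [/\ nbhs t A, A `<=` M & connected A].
Proof.
move=> /unit_interval_ball[e e0 eM].
exists (@clamp R @` `]set_val t - e, set_val t + e[); split.
- have : \forall u \near t, set_val u \in `]set_val t - e, set_val t + e[.
    apply/near_val_itv/near_in_itvoo.
    by rewrite in_itv /=; apply/andP; split; lra.
  by apply: filterS => u tu; exists (set_val u) => //; exact: clampK.
- move=> _ [u + <-]; rewrite /= in_itv /= => /andP[u1 u2]; apply: eM.
  by rewrite ltr_norml; apply/andP; split; lra.
- exact: clamp_image_connected.
Qed.

End UnitIntervalTopology.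

(** * Local systems on a preorder *)

(** A covering of the preorder [P]: inequalities lift uniquely, upwards and
    downwards.  The elements are themselves only preordered, so that
    representatives such as paths can be used without dividing by homotopy; two
    elements in the same position count as equal once they are comparable. *)
Record local_system (P : Type) (le : P -> P -> Prop) := LocalSystem {
  ls_elt :> Type;
  ls_pos : ls_elt -> P;
  ls_le : ls_elt -> ls_elt -> Prop;
  ls_refl : forall z, ls_le z z;
  ls_trans : forall z2 z1 z3, ls_le z1 z2 -> ls_le z2 z3 -> ls_le z1 z3;
  ls_mono : forall z w, ls_le z w -> le (ls_pos z) (ls_pos w);
  ls_up : forall z d, le (ls_pos z) d -> exists2 w, ls_pos w = d & ls_le z w;
  ls_down : forall w c, le c (ls_pos w) -> exists2 z, ls_pos z = c & ls_le z w;
  ls_up_unique : forall z w w', ls_le z w -> ls_le z w' ->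
    ls_pos w = ls_pos w' -> ls_le w w';
  ls_down_unique : forall w z z', ls_le z w -> ls_le z' w ->
    ls_pos z = ls_pos z' -> ls_le z z'
}.

(** Continuity for the topology on [Z] whose open sets are the upward closed
    ones. *)
Definition germ_mono (T : topologicalType) (Z : Type) (r : Z -> Z -> Prop)
    (f : T -> Z) : Prop :=
  forall t, \forall u \near t, r (f t) (f u).

Lemma germ_mono_comp (T U : topologicalType) (Z : Type) (r : Z -> Z -> Prop)
    (f : U -> Z) (h : T -> U) :
  continuous h -> germ_mono r f -> germ_mono r (f \o h).
Proof. by move=> ch fr t; exact: ch (fr (h t)). Qed.

Section LocalSystem.
Variables (P : Type) (le : P -> P -> Prop) (L : local_system le).
Implicit Types z w : L.
Local Notation pos := (@ls_pos P le L).
Local Notation lle := (@ls_le P le L).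

(** The lift of [b] to the position of [z] also lies above [a], hence is [z]. *)
Lemma ls_fill_up a b z : lle a b -> lle a z -> le (pos b) (pos z) -> lle b z.
Proof.
move=> ab az bz; have [w wz bw] := ls_up bz.
apply: (ls_trans bw); apply: (ls_up_unique _ az wz); exact: ls_trans ab bw.
Qed.

Lemma ls_fill_down a b z : lle a b -> lle z b -> le (pos z) (pos a) -> lle z a.
Proof.
move=> ab zb za; have [w wz wa] := ls_down za.
apply: (ls_trans _ wa); apply: (ls_down_unique zb _ (esym wz)); exact: ls_trans wa ab.
Qed.

Definition is_lift (T : topologicalType) (k : T -> P) (f : T -> L) : Prop :=
  (forall t, pos (f t) = k t) /\ germ_mono lle f.

(** A map that increases near each point can neither leave nor enter the part
    above [z] as long as its position stays above that of [z]. *)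
Lemma lift_compare (T : topologicalType) (A : set T) (f : T -> L) z :
  germ_mono lle f -> connected A -> (forall t, A t -> le (pos z) (pos (f t))) ->
  forall s t, A s -> A t -> lle z (f s) -> lle z (f t).
Proof.
move=> mf cA zf; apply: connected_locally_constant => // s As.
apply: filterS (mf s) => u su Au; split=> [zs|zu]; first exact: ls_trans zs su.
exact: (ls_fill_down su zu (zf _ As)).
Qed.

Lemma lift_unique (T : topologicalType) (k : T -> P) (f g : T -> L) :
  connected [set: T] -> is_lift k f -> is_lift k g ->
  forall s t, lle (f s) (g s) -> lle (f t) (g t).
Proof.
move=> cT [fk mf] [gk mg] s t.
apply: (connected_locally_constant cT (Q := fun t => lle (f t) (g t))) => // {}s _.
have fg u : pos (f u) = pos (g u) by rewrite fk gk.
near=> u => _; have fsu : lle (f s) (f u) by near: u; exact: mf.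
have gsu : lle (g s) (g u) by near: u; exact: mg.
split=> [fgs|fgu].
  by apply: (ls_up_unique fsu _ (fg u)); exact: ls_trans fgs gsu.
by apply: (ls_down_unique _ gsu (fg s)); exact: ls_trans fsu fgu.
Unshelve. all: by end_near. Qed.

Lemma lift_compare_above (T : topologicalType) (f : T -> L) z :
  germ_mono lle f -> connected [set: T] ->
  (forall t, le (pos (f t)) (pos z)) ->
  forall s t, lle (f s) z -> lle (f t) z.
Proof.
move=> mf cT fz s t.
apply: (connected_locally_constant cT (Q := fun t => lle (f t) z)) => // {}s _.
apply: filterS (mf s) => u su _; split=> [sz|]; last exact: ls_trans.
exact: (ls_fill_up su sz (fz u)).
Qed.

(** * Lifting and transport along paths *)

Section PathLifting.
Variable R : realType.
Local Notation I := (unit_interval R).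

Lemma val_lt_near (t : I) (c : R) :
  \forall u \near t, (set_val t < c -> set_val u < c) /\
                     (c < set_val t -> c < set_val u).
Proof.
have below : \forall u \near t, set_val t < c -> set_val u < c.
  have [tc|tc] := ltP (set_val t) c; last by apply: near_all => u.
  have tI : set_val t \in `]-oo, c[ by rewrite in_itv.
  by apply: filterS (near_val_itv (near_in_itvNyo tI)) => u; rewrite in_itv.
have above : \forall u \near t, c < set_val t -> c < set_val u.
  have [tc|tc] := ltP c (set_val t); last by apply: near_all => u.
  have tI : set_val t \in `]c, +oo[ by rewrite in_itv /= tc.
  by apply: filterS (near_val_itv (near_in_itvoy tI)) => u; rewrite in_itv /= andbT.
by apply: filterS2 below above.
Qed.

Let lifts_until (k : I -> P) (z : L) (t : I) : Prop :=
  exists f : I -> L, [/\ f zero = z,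
    forall u : I, set_val u <= set_val t :> R -> pos (f u) = k u &
    forall u : I, set_val u <= set_val t :> R ->
      \forall v \near u, set_val v <= set_val t :> R -> lle (f u) (f v)].

Let lifts_until_extend (k : I -> P) (z : L) (c : P) (s t : I) :
  germ_mono le k ->
  (forall u : I, set_val s <= set_val u <= set_val t -> le c (k u)) ->
  lifts_until k z s -> lifts_until k z t.
Proof.
move=> mk ck [f [f0 fk mf]].
have [ts|st] := leP (set_val t) (set_val s).
  exists f; split=> // u ut; first exact/fk/(le_trans ut).
  apply: filterS (mf u (le_trans ut ts)) => v fuv vt.
  exact/fuv/(le_trans vt).
have [w wc wfs] : exists2 w, pos w = c & lle w (f s).
  by apply: ls_down; rewrite fk //; apply: ck; rewrite lexx ltW.
have /choice[g gP] (u : I) : exists y,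
    set_val s <= set_val u <= set_val t -> pos y = k u /\ lle w y.
  have [/ck ku|nu] := boolP (set_val s <= set_val u <= set_val t); last by exists z.
  by rewrite -wc in ku; have [y yk wy] := ls_up ku; exists y.
exists (fun u => if set_val u <= set_val s then f u else g u); split.
- by rewrite val_zero ifT //; have /andP[] := unit_intervalP s.
- move=> u ut; case: leP => us; first exact: fk.
  by have [] := gP u; first by rewrite (ltW us).
move=> u ut.
have fnear : \forall v \near u, set_val u <= set_val s ->
    set_val v <= set_val s -> lle (f u) (f v).
  have [us|us] := leP (set_val u) (set_val s); last by apply: near_all => v.
  by apply: filterS (mf u us) => v fuv _.
near=> v => vt.
have fuv : set_val u <= set_val s -> set_val v <= set_val s -> lle (f u) (f v).
  by near: v.
have [vs vs'] : (set_val u < set_val s -> set_val v < set_val s) /\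
    (set_val s < set_val u -> set_val s < set_val v).
  by near: v; exact: val_lt_near.
have kuv : le (k u) (k v) by near: v; exact: mk.
case: (ltgtP (set_val u) (set_val s)) => us.
- by rewrite (ltW (vs us)); apply: fuv; apply: ltW => //; exact: vs.
(* two elements above [w] compare as their positions do *)
- rewrite leNgt (vs' us) /=.
  have [gu wu] : pos (g u) = k u /\ lle w (g u) by apply: gP; rewrite (ltW us).
  have [gv wv] : pos (g v) = k v /\ lle w (g v).
    by apply: gP; rewrite (ltW (vs' us)).
  by apply: (ls_fill_up wu wv); rewrite gu gv.
- have us' : u = s by exact: val_inj.
  case: leP => [vs0|sv]; first by apply: fuv => //; rewrite us.
  have [gv wv] : pos (g v) = k v /\ lle w (g v) by apply: gP; rewrite (ltW sv).
  apply: (ls_fill_up _ wv (a := w)); rewrite ?us' //.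
  by rewrite gv fk // -us'.
Unshelve. all: by end_near. Qed.

(** Lifts exist over short intervals, where [k] stays above one value: descend
    to that value and go up again.  The times until which a lift exists are
    therefore open and closed. *)
Lemma path_lift (k : I -> P) (z : L) : germ_mono le k -> pos z = k zero ->
  exists2 f, is_lift k f & f zero = z.
Proof.
move=> mk zk; have le1 (u : I) : set_val u <= set_val (one : I) :> R.
  by rewrite val_one; have /andP[] := unit_intervalP u.
suff [f [f0 fk mf]] : lifts_until k z one.
  exists f => //; split=> t; first exact/fk/le1.
  by apply: filterS (mf t (le1 t)) => u; apply; exact: le1.
apply: (connected_locally_constant (@unit_interval_connected R)
  (Q := lifts_until k z) _ (s := zero)) => // [s _|].
  have /unit_interval_ball[e e0 ke] := mk s.
  have : \forall u \near s, set_val u \in `]set_val s - e, set_val s + e[.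
    apply/near_val_itv/near_in_itvoo.
    by rewrite in_itv /=; apply/andP; split; lra.
  apply: filterS => u; rewrite in_itv /= => /andP[u1 u2] _.
  split; apply: (@lifts_until_extend _ _ (k s)) => // v /andP[v1 v2];
    rewrite -[v]clampK; apply: ke; rewrite ltr_norml; apply/andP; split; lra.
exists (cst z); split=> // [u|u _]; last by apply: near_all => v _; exact: ls_refl.
rewrite val_zero /cst zk => u0; congr k.
have e : set_val (zero : I) = set_val u :> R.
  by apply/le_anti; rewrite val_zero u0 andbT; have /andP[] := unit_intervalP u.
exact: val_inj e.
Qed.

(** The lines in the direction of [I] are lifted one by one.  That the result
    increases near [(s, x)] is a property of [s] that is locally constant along
    each line. *)
Lemma homotopy_lift (X : topologicalType) (k : I * X -> P) (f0 : X -> L) :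
  germ_mono le k -> germ_mono lle f0 -> (forall x, pos (f0 x) = k (zero, x)) ->
  exists2 F, is_lift k F & forall x, F (zero, x) = f0 x.
Proof.
move=> mk mf0 f0k.
have line x : exists2 f, is_lift (fun t => k (t, x)) f & f zero = f0 x.
  apply: path_lift => //.
  exact: (germ_mono_comp (@slice_continuous _ _ x) mk).
have /choice[G GP] : forall x, exists f, is_lift (fun t => k (t, x)) f /\ f zero = f0 x.
  by move=> x; have [f] := line x; exists f.
exists (fun u => G u.2 u.1); last by move=> x; have [] := GP x.
split=> [[t x]|[t x] /=]; first by have [[/(_ t)]] := GP x.
have Gk u v : pos (G v u) = k (u, v) by have [[/(_ u)]] := GP v.
have mG v : germ_mono lle (G v) by have [[]] := GP v.
pose Q s := \forall u \near (s, x), lle (G x s) (G u.2 u.1).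
have nbhd (s : I) : exists A : set I, nbhs s A /\
    forall r, A r -> (\forall y \near x, lle (G x s) (G y r)) ->
    forall r', A r' -> Q r'.
  have [[A B] /= [nA nB] AB] := mk (s, x).
  have [A' [nA' A'A cA']] := unit_interval_locally_connected nA.
  exists (A'^°); split=> [|r /interior_subset A'r sr r' A'r'].
    exact: nbhs_interior.
  have zG y : B y -> forall v, A' v -> le (pos (G x s)) (pos (G y v)).
    by move=> By v /A'A Av; rewrite !Gk; exact: (AB (v, y)).
  have sx v : A' v -> lle (G x s) (G x v).
    move=> A'v; apply: (lift_compare (mG x) cA' _ (nbhs_singleton nA')) => //.
      exact: zG (nbhs_singleton nB).
    exact: ls_refl.
  (* a nearby line that is above [G x s] at time [r] is so on all of [A'] *)
  have xnear : \forall y \near x, forall v, A' v -> lle (G x s) (G y v).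
    apply: filterS2 nB sr => y By sry v A'v.
    exact: (lift_compare (mG y) cA' (zG _ By) A'r).
  have nr : nbhs (r', x) (A' `*` [set y | forall v, A' v -> lle (G x s) (G y v)]).
    by exists (A', [set y | forall v, A' v -> lle (G x s) (G y v)]).
  apply: filterS2 nr (mk (r', x)) => -[v y] /= [A'v xy] kvy.
  apply: (ls_fill_up (sx r' _) (xy v A'v)); first exact: interior_subset.
  by rewrite !Gk.
suff : Q t by [].
have restr s : Q s -> \forall y \near x, lle (G x s) (G y s).
  move=> [[A B] /= [nA nB] AB]; apply: filterS nB => y By.
  by apply: (AB (s, y)); split=> //; exact: nbhs_singleton nA.
apply: (connected_locally_constant (@unit_interval_connected R) (Q := Q) _
  (s := zero)) => // [s _|].
  have [A [nA AQ]] := nbhd s; have As := nbhs_singleton nA.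
  have sG : \forall u \near s, lle (G x s) (G x u) by exact: mG.
  apply: filterS2 nA sG => r Ar sr _.
  split=> [/restr Qs|/restr Qr].
    exact: AQ Qs _ Ar.
  apply: (AQ r Ar _ s As).
  by apply: filterS Qr => y; exact: ls_trans.
have [A [nA AQ]] := nbhd zero.
apply: (AQ _ (nbhs_singleton nA) _ _ (nbhs_singleton nA)).
by apply: filterS (mf0 x) => y; have [_ ->] := GP x; have [_ ->] := GP y.
Qed.

(** The two inequalities let [z] and [z'] live over cells larger than those
    where the path starts and ends, as the fibre over a point of [E] does. *)
Definition transport (k : I -> P) z z' : Prop :=
  exists f, [/\ is_lift k f, lle (f zero) z & lle (f one) z'].

Lemma transport_exists (k : I -> P) z c : germ_mono le k ->
  le (k zero) (pos z) -> le (k one) c ->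
  exists2 z', pos z' = c & transport k z z'.
Proof.
move=> mk kz kc; have [w wk wz] := ls_down kz.
have [f [fk mf] f0] := path_lift mk wk; rewrite -(fk one) in kc.
have [z' z'c fz'] := ls_up kc; exists z' => //.
by exists f; split=> //; rewrite f0.
Qed.

Lemma transport_unique (k : I -> P) z z1 z2 :
  transport k z z1 -> transport k z z2 -> le (pos z1) (pos z2) -> lle z1 z2.
Proof.
move=> [f [kf f0 f1]] [g [kg g0 g1]]; apply: (ls_fill_up f1).
apply: ls_trans g1; apply: (lift_unique (@unit_interval_connected R) kf kg (s := zero)).
by apply: (ls_down_unique f0 g0); rewrite kf.1 kg.1.
Qed.

Lemma transport_le (k : I -> P) z1 z2 z1' z2' :
  transport k z1 z1' -> lle z1 z2 -> lle z1' z2' -> transport k z2 z2'.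
Proof.
move=> [f [kf f0 f1]] z12 z12'; exists f; split=> //.
  exact: ls_trans f0 z12.
exact: ls_trans f1 z12'.
Qed.

Lemma transport_reverse (k : I -> P) z z' :
  transport k z z' -> transport (fun t => k (clamp (1 - set_val t))) z' z.
Proof.
move=> [f [[fk mf] f0 f1]]; exists (fun t => f (clamp (1 - set_val t))).
split; last 2 first.
- by rewrite val_zero subr0.
- by rewrite val_one subrr.
split; first by move=> t; exact: fk.
exact: (germ_mono_comp (@one_minus_continuous R) mf).
Qed.

(** The end of the lift over time [s] moves in a family that is below [z'] at
    one time, hence at all times. *)
Lemma transport_homotopy (k : I * I -> P) z z' c : germ_mono le k ->
  (forall s, k (zero, s) = c) -> (forall s, le (k (one, s)) (pos z')) ->
  transport (fun t => k (t, zero)) z z' -> transport (fun t => k (t, one)) z z'.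
Proof.
move=> mk k0 k1 [f [kf f0 f1]].
have [||F [Fk mF] F0] := @homotopy_lift I k (cst (f zero)) mk.
- by move=> s; apply: near_all => t; exact: ls_refl.
- by move=> s; rewrite kf.1 !k0.
have lift_slice s : is_lift (fun t => k (t, s)) (fun t => F (t, s)).
  split=> [t|]; first by rewrite Fk.
  exact: (germ_mono_comp (@slice_continuous _ _ s) mF).
exists (fun t => F (t, one)); split=> //; first by rewrite F0.
apply: (lift_compare_above (f := fun s => F (one, s)) _ (@unit_interval_connected R)
  _ (s := zero)).
- exact: (germ_mono_comp (@coslice_continuous _ _ _) mF).
- by move=> s; rewrite Fk.
apply: ls_trans f1.
apply: (lift_unique (@unit_interval_connected R) (lift_slice zero) kf (s := zero)).
by rewrite F0; exact: ls_refl.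
Qed.

End PathLifting.
End LocalSystem.

Lemma transport_map (R : realType) (P : Type) (le : P -> P -> Prop)
    (L M : local_system le) (h : L -> M) :
  (forall z, ls_pos (h z) = ls_pos z) ->
  (forall z w, ls_le z w -> ls_le (h z) (h w)) ->
  forall (k : unit_interval R -> P) z z',
  transport k z z' -> transport k (h z) (h z').
Proof.
move=> hpos hle k z z' [f [[fk mf] f0 f1]]; exists (h \o f).
split; try exact: hle; split=> [t|t]; first by rewrite /= hpos fk.
by apply: filterS (mf t) => u; exact: hle.
Qed.

(** * Irreducible sets and noetherian spectra *)

Lemma irreducible_image (X Y : topologicalType) (f : X -> Y) (A : set X) :
  continuous f -> irreducible A -> irreducible (f @` A).
Proof.
move=> cf [[x Ax] iA]; split; first by exists (f x), x.
move=> F G cF cG AFG.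
have clf (C : set Y) : closed C -> closed (f @^-1` C).
  by move=> cC; apply: closed_comp => // y _; exact: cf.
have [|AF|AG] := iA _ _ (clf _ cF) (clf _ cG).
- by move=> y Ay; apply: AFG; exists y.
- by left=> _ [y Ay <-]; exact: AF.
- by right=> _ [y Ay <-]; exact: AG.
Qed.

Lemma irreducible_closure (X : topologicalType) (A : set X) :
  irreducible A -> irreducible (closure A).
Proof.
move=> [[x Ax] iA]; split; first by exists x; exact: subset_closure.
move=> F G cF cG AFG.
have [y Ay|AF|AG] := iA F G cF cG.
- exact/AFG/subset_closure.
- by left; rewrite [F](closure_id _).1 //; exact: closure_subset.
- by right; rewrite [G](closure_id _).1 //; exact: closure_subset.
Qed.

Lemma irreducible_meet (X : topologicalType) (A U V : set X) :
  irreducible A -> open U -> open V -> A `&` U !=set0 -> A `&` V !=set0 ->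
  A `&` (U `&` V) !=set0.
Proof.
move=> [_ iA] oU oV [x [Ax Ux]] [y [Ay Vy]]; apply: contrapT => AUV.
have [z Az|/(_ x Ax)//|/(_ y Ay)//] := iA _ _ (open_closedC oU) (open_closedC oV).
apply: contrapT => /not_orP[/contrapT Uz /contrapT Vz].
by apply: AUV; exists z.
Qed.

Lemma irreducible_connected (X : topologicalType) (A : set X) :
  irreducible A -> connected A.
Proof.
move=> iA B [x Bx] [C oC BC] [D cD BD]; apply/seteqP; split=> y.
  by rewrite BC => -[].
move=> Ay; apply: contrapT => nBy.
have [||z [Az [Cz nDz]]] := irreducible_meet iA oC (closed_openC cD).
- by exists x; rewrite -BC.
- by exists y; split=> // Dy; apply: nBy; rewrite BD.
by have : B z by [rewrite BC]; rewrite BD => -[].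
Qed.

Section NoetherianSpectrum.
Variable A : comPzRingType.
Hypothesis noethA : noetherian_ring A.

Let vanishing (Z : set (spec A)) : set A :=
  [set a | forall p, Z p -> prime_of p a].

Let vanishing_ideal Z : is_ideal (vanishing Z).
Proof.
split=> [p _|x y Zx Zy p Zp|a x Zx p Zp]; have [[p0 pD pM] _ _] := prime_ofP p.
- exact: p0.
- by apply: pD; [exact: Zx|exact: Zy].
- exact/pM/Zx.
Qed.

Let vanishing_closed Z p : closed Z -> vanishing Z `<=` prime_of p -> Z p.
Proof.
move=> /closed_openC[J ZJ] Zp; apply: contrapT => nZp.
have : (~` Z) p by [].
rewrite ZJ /=; apply => x Jx; apply: Zp => q Zq; apply: contrapT => nqx.
suff : (~` Z) q by [].
by rewrite ZJ => /(_ _ Jx).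
Qed.

(** The vanishing ideals of a descending chain of closed sets ascend, and their
    union is finitely generated, hence equal to one of them. *)
Lemma spec_closed_dcc (Z : nat -> set (spec A)) : (forall n, closed (Z n)) ->
  (forall n, Z n.+1 `<=` Z n) -> exists n, Z n `<=` Z n.+1.
Proof.
move=> cZ dZ; pose J := \bigcup_n vanishing (Z n).
have mZ m n : (m <= n)%N -> vanishing (Z m) `<=` vanishing (Z n).
  move=> /subnK <-; elim: (n - m)%N => // k IH x /IH Zx p /dZ; exact: Zx.
have [n [g Jg]] : exists (n : nat) (g : 'I_n -> A),
    J = [set x | exists c : 'I_n -> A, x = \sum_(i < n) c i * g i].
  apply: noethA; split.
  - by exists 0%N => //; have [] := vanishing_ideal (Z 0%N).
  - move=> x y [i _ Zx] [j _ Zy]; exists (maxn i j) => //.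
    have [_ + _] := vanishing_ideal (Z (maxn i j)); apply.
      exact: mZ (leq_maxl i j) _ Zx.
    exact: mZ (leq_maxr i j) _ Zy.
  - move=> a x [i _ Zx]; exists i => //.
    by have [_ _] := vanishing_ideal (Z i); apply.
have /choice[m gm] (i : 'I_n) : exists m, vanishing (Z m) (g i).
  have : J (g i).
    rewrite Jg; exists (fun j => (j == i)%:R).
    by rewrite (bigD1 i) //= eqxx mul1r big1 ?addr0 // => j /negbTE ->; rewrite mul0r.
  by move=> [k _]; exists k.
pose N := (\max_(i < n) m i)%N.
have JN : J `<=` vanishing (Z N).
  rewrite Jg => _ [c ->]; have [Z0 ZD ZM] := vanishing_ideal (Z N).
  elim/big_ind: _ => // i _; apply: ZM.
  exact: mZ (leq_bigmax i) _ (gm i).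
exists N => p Zp; apply: vanishing_closed => // x Zx.
by apply: (JN x) => //; exists N.+1.
Qed.

Definition finite_union_irreducible (X : topologicalType) (Z : set X) : Prop :=
  exists D : set (set X), [/\ finite_set D, (forall B, D B -> irreducible B) &
    Z = \bigcup_(B in D) B].

(** A closed set that is not such a union is not irreducible, hence splits into
    two smaller closed sets, one of which is again not such a union; repeating
    this contradicts the descending chain condition. *)
Lemma spec_closed_finite_union (Z : set (spec A)) :
  closed Z -> finite_union_irreducible Z.
Proof.
move=> cZ; apply: contrapT => nZ.
pose bad (Y : set (spec A)) := closed Y /\ ~ finite_union_irreducible Y.
have /choice[f badf] (Y : set (spec A)) : exists Y',
    bad Y -> [/\ bad Y', Y' `<=` Y & ~ Y `<=` Y'].
  have [[cY nY]|nb] := pselect (bad Y); last by exists set0.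
  have Y0 : Y !=set0.
    apply/set0P/negP => /eqP Y0; apply: nY; exists set0.
    by split; rewrite ?bigcup_set0.
  have /existsNP[F /existsNP[G]] : ~ forall F G : set (spec A), closed F -> closed G ->
      Y `<=` F `|` G -> Y `<=` F \/ Y `<=` G.
    move=> iY; apply: nY; exists [set Y]; split; first exact: finite_set1.
      by move=> _ ->.
    by rewrite bigcup_set1.
  move=> /not_implyP[cF /not_implyP[cG /not_implyP[YFG /not_orP[nF nG]]]].
  have [fF|nfF] := pselect (finite_union_irreducible (Y `&` F)); last first.
    exists (Y `&` F) => _; split.
    - by split=> //; exact: closedI.
    - by move=> p [].
    - by move=> YF; apply: nF => p /YF[].
  have [fG|nfG] := pselect (finite_union_irreducible (Y `&` G)); last first.
    exists (Y `&` G) => _; split.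
    - by split=> //; exact: closedI.
    - by move=> p [].
    - by move=> YG; apply: nG => p /YG[].
  case: nY; have [D [fD iD YFD]] := fF; have [D' [fD' iD' YGD]] := fG.
  exists (D `|` D'); split; first by rewrite finite_setU.
    by move=> B [/iD|/iD'].
  rewrite bigcup_setU -YFD -YGD -setIUr; apply/seteqP; split=> [p Yp|p []//].
  by split=> //; exact: YFG.
have badn n : bad (iter n f Z) by elim: n => // n /badf[].
have [||n] := @spec_closed_dcc (fun n => iter n f Z).
- by move=> n; have [] := badn n.
- by move=> n; have [] := badf _ (badn n).
by have [] := badf _ (badn n).
Qed.

End NoetherianSpectrum.

(** The form in which the noetherian hypothesis is used.  For [F] the whole
    space it gives the local finiteness of irreducible components, for [F] a
    stratum the openness of its connected components. *)
Definition locally_finite_irreducible (E : topologicalType) : Prop :=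
  forall (F : set E) s, closed F -> F s ->
  exists D : set (set E), [/\ finite_set D,
    (forall B, D B -> [/\ irreducible B, closed B, B s & B `<=` F]) &
    \forall t \near s, F t -> exists2 B, D B & B t].

(** In a noetherian affine chart around [s], [F] is a finite union of
    irreducible sets; those whose closure misses [s] can be avoided by shrinking
    the neighbourhood, as they are finitely many. *)
Lemma locally_noetherian_finite (E : scheme) :
  locally_noetherian E -> locally_finite_irreducible E.
Proof.
move=> nE F s cF Fs.
have [U [A [Us [psi [theta [cpsi psiI opsi rpsi _]]] nA]]] := nE s.
have [D [fD iD FD]] : finite_union_irreducible (psi @^-1` F).
  apply: spec_closed_finite_union => //.
  by apply: closed_comp => // p _; exact: cpsi.
pose D1 := [set closure (psi @` B) | B in D].
have fD1 : finite_set D1 by exact: finite_image.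
exists (D1 `&` [set C | C s]); split.
- by apply: sub_finite_set fD1 => C [].
- move=> _ [[B DB <-] Bs]; split=> //.
  + exact/irreducible_closure/irreducible_image/iD.
  + exact: closed_closure.
  + rewrite [F](closure_id _).1 //; apply: closure_subset => _ [p Bp <-].
    have : (\bigcup_(B in D) B) p by exists B.
    by rewrite -FD.
have nU : nbhs s U by apply: open_nbhs_nbhs; split=> //; exact: open_setP.
have nC : nbhs s (~` \bigcup_(C in D1 `&` [set C | ~ C s]) C).
  apply: open_nbhs_nbhs; split; last by move=> [C []].
  apply/closed_openC/closed_bigcup => //.
    by apply: sub_finite_set fD1 => C [].
  by move=> _ [[B _ <-] _]; exact: closed_closure.
apply: filterS2 nU nC => t; rewrite -rpsi => -[p _ pt] nCt Ft.
have : (psi @^-1` F) p by rewrite /= pt.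
rewrite FD => -[B DB Bp].
have Ct : closure (psi @` B) t by apply: subset_closure; exists p.
exists (closure (psi @` B)) => //; split; first by exists B.
apply: contrapT => nCs; apply: nCt; exists (closure (psi @` B)) => //.
by split=> //; exists B.
Qed.

(** * Cells and their position around a point *)

Lemma set_seq_cons (T : eqType) (x : T) (s : seq T) :
  [set` x :: s] = x |` [set` s].
Proof.
apply/seteqP; split=> y; rewrite /= in_cons.
  by move=> /orP[/eqP|]; [left|right].
by move=> [->|->]; rewrite ?eqxx ?orbT.
Qed.

Lemma irreducible_finite_cover (X : topologicalType) (A : set X)
    (D : set (set X)) : irreducible A -> finite_set D ->
  (forall B, D B -> closed B) -> A `<=` \bigcup_(B in D) B ->
  exists2 B, D B & A `<=` B.
Proof.
move=> iA /finite_seqP[Ds ->]; elim: Ds => [|B Ds IH] cD.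
  by case: iA => -[x Ax] _ /(_ _ Ax)[].
rewrite set_seq_cons bigcup_setU1 => AD.
have cDs C : [set` Ds] C -> closed C.
  by move=> DC; apply: cD; rewrite /= in_cons; apply/orP; right.
have [|||AB|/(IH cDs)[C DC AC]] := iA.2 B (\bigcup_(C in [set` Ds]) C).
- by apply: cD; rewrite /= mem_head.
- by apply: closed_bigcup; [exact: finite_seq|exact: cDs].
- by [].
- by exists B => //=; left.
- by exists C => //; right.
Qed.

Lemma finite_maximal (X : Type) (D : set (set X)) : finite_set D -> D !=set0 ->
  exists2 B, D B & forall C, D C -> B `<=` C -> C `<=` B.
Proof.
move=> /finite_seqP[Ds ->]; elim: Ds => [[]//|C Ds IH _].
rewrite set_seq_cons; have [->|/eqP/eqP/set0P/IH[B DB Bmax]] := eqVneq [set` Ds] set0.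
  by exists C; [left|move=> B [->|]].
have [BC|nBC] := pselect (B `<=` C).
  exists C; first by left.
  move=> C' [->//|DC' CC']; apply: (subset_trans _ BC).
  by apply: Bmax => //; exact: subset_trans BC CC'.
exists B; first by right.
by move=> C' [->|]; last exact: Bmax.
Qed.

Section LocallyFinite.
Variable E : topologicalType.
Implicit Types (s t : E) (v : irr_comp E) (c d : cell E).

Lemma irr_compP v : irreducible_component (comp_set v).
Proof. exact: set_mem (valP v). Qed.

Lemma irr_comp_closed v : closed (comp_set v).
Proof.
have [iv vmax] := irr_compP v.
by rewrite -(vmax _ (irreducible_closure iv)); [exact: closed_closure|
  exact: subset_closure].
Qed.

Lemma stratum_closed (sigma : {fset irr_comp E}) : closed (stratum sigma).
Proof.
rewrite (_ : stratum sigma = \bigcap_(v in [set` sigma]) comp_set v); last by [].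
by apply: closed_bigI => v _; exact: irr_comp_closed.
Qed.

Lemma cell_setE c s : cell_set c s ->
  cell_set c = connected_component (stratum (cell_verts c)) s.
Proof.
by have [x _ ->] := cell_setP c; move=> /same_connected_component.
Qed.

Lemma cell_nonempty c : cell_set c !=set0.
Proof.
by have [x sx ->] := cell_setP c; exists x; exact: connected_component_refl.
Qed.

Lemma cell_connected c : connected (cell_set c).
Proof. by have [x _ ->] := cell_setP c; exact: component_connected. Qed.

(** The simplex of [c] is a face of that of [d].  The empty set of vertices has
    an empty simplex and is excluded: its stratum is all of [E], over which
    coverings need not split. *)
Definition cell_le c d : Prop :=
  [/\ cell_verts c != fset0, (cell_verts c `<=` cell_verts d)%fset &
      cell_set d `<=` cell_set c].

Lemma stratum_anti (sigma tau : {fset irr_comp E}) :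
  (sigma `<=` tau)%fset -> stratum tau `<=` stratum sigma.
Proof. by move=> /fsubsetP st x xt v /st; exact: xt. Qed.

(** [cell_set d] is a connected subset of the stratum of [c]. *)
Lemma cell_le_meet c d s : cell_verts c != fset0 ->
  (cell_verts c `<=` cell_verts d)%fset -> cell_set c s -> cell_set d s ->
  cell_le c d.
Proof.
move=> c0 cd cs ds; split=> // t dt; rewrite (cell_setE cs).
exists (cell_set d) => //; split=> //; last exact: cell_connected.
exact: subset_trans (@cell_sub _ d) (stratum_anti cd).
Qed.

Lemma cell_le_trans c d e : cell_le c d -> cell_le d e -> cell_le c e.
Proof.
move=> [c0 cd dc] [_ de ed]; split=> //; first exact: fsubset_trans cd de.
exact: subset_trans ed dc.
Qed.

Lemma cell_le_refl c : cell_verts c != fset0 -> cell_le c c.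
Proof. by move=> c0; split. Qed.

Lemma cell_eq c d :
  cell_verts c = cell_verts d -> cell_set c = cell_set d -> c = d.
Proof.
case: c d => [sigma A] [tau B]; rewrite /cell_verts /= => e; subst tau.
by rewrite /cell_set /= => /val_inj ->.
Qed.

Lemma cell_le_anti c d : cell_le c d -> cell_le d c -> c = d.
Proof.
move=> [_ cd dc] [_ dc' cd']; apply: cell_eq.
  by apply/eqP; rewrite eqEfsubset cd.
exact/seteqP.
Qed.

Definition mk_cell (sigma : {fset irr_comp E}) s (h : stratum sigma s) :
    cell E :=
  existT (fun tau => stratum_comp tau) sigma
    (exist _ (connected_component (stratum sigma) s)
      (mem_set (ex_intro2 _ _ s h erefl))).

Lemma mk_cell_mem sigma s (h : stratum sigma s) : cell_set (mk_cell h) s.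
Proof. exact: connected_component_refl. Qed.

(** [fset_set] returns the empty set on an infinite set; the set below is finite
    as soon as irreducible components are locally finite. *)
Definition comps_at s : {fset irr_comp E} := fset_set [set v | comp_set v s].

Lemma comps_at_stratum s : stratum (comps_at s) s.
Proof.
move=> v; rewrite /comps_at /fset_set; case: pselect => // fs.
by case: cid => F /= Fs vF; have : [set` F] v by []; rewrite -Fs.
Qed.

Definition top_cell s : cell E := mk_cell (@comps_at_stratum s).

Lemma top_cell_mem s : cell_set (top_cell s) s.
Proof. exact: mk_cell_mem. Qed.

Lemma cell_le_top_mem c s : cell_le c (top_cell s) -> cell_set c s.
Proof. by move=> [_ _]; apply; exact: top_cell_mem. Qed.

Hypothesis lfE : locally_finite_irreducible E.

Let irreducible_near s : exists D : set (set E), [/\ finite_set D,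
    (forall B, D B -> [/\ irreducible B, closed B & B s]), D !=set0 &
    \forall t \near s, forall A, irreducible A -> A t ->
      exists2 B, D B & A `<=` B].
Proof.
have [D [fD DP nD]] := lfE (@closedT E) (I : setT s).
have [B DB _] := nbhs_singleton nD I.
exists D; split=> //; [by move=> C /DP[]|by exists B|].
have : nbhs s [set t | setT t -> exists2 B, D B & B t] by [].
rewrite nbhsE => -[N [oN Ns] NP].
apply: (filterS _ (open_nbhs_nbhs (conj oN Ns))) => t Nt A iA At.
have [||x Ax||AN] := iA.2 (~` N) (\bigcup_(C in D) C).
- exact: open_closedC.
- by apply: closed_bigcup => // C /DP[].
- have [Nx|] := pselect (N x); last by left.
  by right; have [C DC Cx] := NP _ Nx I; exists C.
- by move=> /(_ _ At).
- by apply: (irreducible_finite_cover iA fD _ AN) => C /DP[].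
Qed.

Lemma comps_near s :
  \forall t \near s, forall v, comp_set v t -> comp_set v s.
Proof.
have [D [fD DP _ nD]] := irreducible_near s.
apply: filterS nD => t nt v vt; have [iv vmax] := irr_compP v.
have [B /DP[iB _ Bs] vB] := nt _ iv vt.
by rewrite -(vmax _ iB vB).
Qed.

Lemma comps_at_finite s : finite_set [set v | comp_set v s].
Proof.
have [D [fD DP _ nD]] := irreducible_near s.
have : finite_set ((@comp_set E) @` [set v | comp_set v s]).
  apply: (@sub_finite_set _ _ D) fD => _ [v vs <-].
  have [iv vmax] := irr_compP v.
  have [B DB vB] := nbhs_singleton nD _ iv vs; have [iB _ _] := DP _ DB.
  by rewrite -(vmax _ iB vB).
move=> fin; have -> : [set v | comp_set v s] =
    (@comp_set E) @^-1` ((@comp_set E) @` [set v | comp_set v s]).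
  apply/seteqP; split=> v; first by exists v.
  by move=> [w ws /val_inj <-].
by apply: (finite_preimage (f := @comp_set E)) => // v w _ _; exact: val_inj.
Qed.

(** A maximal member of the finite family of irreducible sets that fills a
    neighbourhood of [s] is an irreducible component. *)
Lemma comps_at_exists s : exists v, comp_set v s.
Proof.
have [D [fD DP D0 nD]] := irreducible_near s.
have [B DB Bmax] := finite_maximal fD D0; have [iB _ Bs] := DP _ DB.
have cB : irreducible_component B.
  split=> // C iC BC; apply/seteqP; split=> //.
  have [B' DB' CB'] := nbhs_singleton nD _ iC (BC _ Bs).
  by apply: (subset_trans CB'); apply: Bmax => //; exact: subset_trans BC CB'.
by exists (exist _ B (mem_set cB) : irr_comp E).
Qed.

Lemma comps_atP s v : (v \in comps_at s) <-> comp_set v s.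
Proof.
by rewrite /comps_at in_fset_set; [rewrite inE|exact: comps_at_finite].
Qed.

Lemma top_cell_verts s : cell_verts (top_cell s) != fset0.
Proof.
have [v /comps_atP vs] := comps_at_exists s.
by apply/fset0Pn; exists v.
Qed.

Lemma cell_le_top c s : cell_verts c != fset0 -> cell_set c s ->
  cell_le c (top_cell s).
Proof.
move=> c0 cs; apply: (cell_le_meet (s := s)) => //; last exact: top_cell_mem.
by apply/fsubsetP => v vc; apply/comps_atP; exact: (cell_sub cs).
Qed.

Lemma connected_component_near (F : set E) s : closed F -> F s ->
  \forall t \near s, F t -> connected_component F t s.
Proof.
move=> cF Fs; have [D [_ DP nD]] := lfE cF Fs.
apply: filterS nD => t nt /nt[B /DP[iB _ Bs BF] Bt].
by exists B => //; split=> //; exact: irreducible_connected.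
Qed.

(** Near [s] only components through [s] are met; and for each of the finitely
    many strata through [s], the nearby points lie in the same connected
    component as [s]. *)
Lemma top_cell_near : germ_mono (fun c d => cell_le d c) top_cell.
Proof.
move=> s.
have nF : \forall t \near s, forall tau, (tau `<=` comps_at s)%fset ->
    stratum tau t -> connected_component (stratum tau) t s.
  pose f tau := [set t | stratum tau t -> connected_component (stratum tau) t s].
  have : nbhs s (\bigcap_(tau in [set` fpowerset (comps_at s)]) f tau).
    apply: filter_bigI => tau; rewrite fpowersetE => taus.
    apply: connected_component_near; first exact: stratum_closed.
    exact: (stratum_anti taus (@comps_at_stratum s)).
  apply: filterS => t ft tau taus.
  by apply: (ft tau); rewrite /= fpowersetE.
apply: filterS2 nF (comps_near s) => t ft ts.
have sub : (comps_at t `<=` comps_at s)%fset.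
  by apply/fsubsetP => v /comps_atP vt; apply/comps_atP/ts.
apply: (cell_le_meet (s := s)) => //; first exact: top_cell_verts.
  exact: (ft _ sub (@comps_at_stratum t)).
exact: top_cell_mem.
Qed.

End LocallyFinite.

(** * Coverings split over cells *)

Section Sheets.
Variables (E : topologicalType) (C : covering E).
Implicit Types (A : set E) (y : C).
Local Notation p := (@cov_proj E C).

Definition is_sheet (V : set C) : Prop :=
  [/\ open V, {in V &, injective p} &
      forall W, open W -> W `<=` V -> open (p @` W)].

Lemma evenly_covered (s : E) : exists (U : set E) (I : Type) (V : I -> set C),
  [/\ open U, U s, trivIset setT V, (forall i, is_sheet (V i)) &
    (forall y, U (p y) -> exists i, V i y) /\
    (forall i t, U t -> exists2 y, V i y & p y = t)].
Proof.
have [U [oU Us [I [V [oV tV UV VU]]]]] := (cov_projP C).2 s.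
exists U, I, V; split=> // [i|].
  by have [[_ Vinj _] Vo] := VU i; split.
split=> [y Uy|i t Ut]; last first.
  by have [[_ _ Vsurj] _] := VU i; have [y] := Vsurj _ Ut; exists y.
have : (p @^-1` U) y by [].
by rewrite UV => -[i _ Viy]; exists i.
Qed.

Lemma sheet_exists y : exists V, is_sheet V /\ V y.
Proof.
have [U [I [V [oU Us _ Vs [UV _]]]]] := evenly_covered (p y).
by have [i Viy] := UV _ Us; exists (V i).
Qed.

Lemma sheet_open_image (V W : set C) : is_sheet V -> open W ->
  open (p @` (W `&` V)).
Proof. by move=> [oV _ Vo] oW; apply: Vo; [exact: openI|move=> z []]. Qed.

(** Over an irreducible [A], two points lie on the same sheet exactly when they
    cannot be separated over [A], since non-empty open subsets of [A] meet.
    Stated this way the relation refers to no choice of sheets. *)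
Definition same_sheet A y z : Prop :=
  forall O O' : set C, open O -> O y -> open O' -> O' z ->
  exists w, [/\ O w, O' w & A (p w)].

Lemma same_sheet_refl A y : A (p y) -> same_sheet A y y.
Proof. by move=> Ay O O' _ Ny _ My; exists y. Qed.

Lemma same_sheet_sym A y z : same_sheet A y z -> same_sheet A z y.
Proof.
move=> yz O O' oO Nz oO' My; have [w [w1 w2 Aw]] := yz _ _ oO' My oO Nz.
by exists w.
Qed.

Section Irreducible.
Variable A : set E.
Hypothesis iA : irreducible A.

Lemma same_sheet_trans z y w :
  same_sheet A y z -> same_sheet A z w -> same_sheet A y w.
Proof.
move=> yz zw O O' oO Ny oO' Mw.
have [V [sV Vz]] := sheet_exists z; have [oV Vi _] := sV.
have [a [Na Va Aa]] := yz _ _ oO Ny oV Vz.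
have [b [Vb Mb Ab]] := zw _ _ oV Vz oO' Mw.
have [||t [At [[a' [Na' Va'] a2t] [b' [Mb2 Vb'] b2t]]]] := irreducible_meet iA
  (sheet_open_image sV oO) (sheet_open_image sV oO').
- by exists (p a); split=> //; exists a.
- by exists (p b); split=> //; exists b.
exists a'; split=> //; last by rewrite a2t.
by rewrite (Vi a' b') ?inE // a2t.
Qed.

(** A sheet through [y] and an evenly covered neighbourhood of [t] have a common
    point over [A]; the wanted point lies on the sheet through it. *)
Lemma same_sheet_exists y t : A (p y) -> A t ->
  exists2 z, p z = t & same_sheet A y z.
Proof.
move=> Ay At; have [V [sV Vy]] := sheet_exists y; have [oV Vi Vo] := sV.
have [U [I [V' [oU Ut _ W2s [UW2 W2U]]]]] := evenly_covered t.
have [||r [Ar [[a [_ Va] ar] Ur]]] := irreducible_meet iA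
  (sheet_open_image sV (@openT _)) oU.
- by exists (p y); split=> //; exists y.
- by exists t.
have [i W2ia] : exists i, V' i a by apply: UW2; rewrite ar.
have [oV' W2i W2o] := W2s i.
have [z W2z zt] := W2U i t Ut; exists z => //.
move=> O O' oO Ny oO' Mz.
(* over a common point of [O], [O'] and the two sheets all choices agree *)
have [||r1 Ar1] := irreducible_meet iA
  (sheet_open_image sV oO) (sheet_open_image (W2s i) oO').
- by exists (p y); split=> //; exists y.
- by exists t; split=> //; exists z.
have [||q [Aq [[[b [Nb Vb] bq] [b' [Mb2 W2b2] b2q]] [c [Vc W2c] cq]]]] :=
    irreducible_meet iA (openI (sheet_open_image sV oO)
      (sheet_open_image (W2s i) oO')) (sheet_open_image (W2s i) oV).
- by exists r1.
- by exists r; split=> //; exists a.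
have bc : b = c by apply: Vi; rewrite ?inE // bq.
have b2c : b' = c by apply: W2i; rewrite ?inE // b2q.
by exists c; split; rewrite ?cq // -?bc // bc -b2c.
Qed.

Lemma same_sheet_unique y z1 z2 : same_sheet A y z1 -> same_sheet A y z2 ->
  p z1 = p z2 -> z1 = z2.
Proof.
move=> yz1 yz2 z12; have [V [sV Vy]] := sheet_exists y; have [oV Vi _] := sV.
have [U [I [V' [oU Uz tW2 W2s [UW2 _]]]]] := evenly_covered (p z1).
have [i W2z1] : exists i, V' i z1 by exact: UW2.
have [j W2z2] : exists j, V' j z2 by apply: UW2; rewrite -z12.
have [oi W2i _] := W2s i; have [oj _ _] := W2s j.
have [a1 [Va1 W2a1 Aa1]] := yz1 _ _ oV Vy oi W2z1.
have [a2 [Va2 W2a2 Aa2]] := yz2 _ _ oV Vy oj W2z2.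
have [||r [Ar [[b1 [Vb1 W2b1] b1r] [b2 [W2b2 Vb2] b2r]]]] := irreducible_meet iA
  (sheet_open_image sV oi) (sheet_open_image sV oj).
- by exists (p a1); split=> //; exists a1.
- by exists (p a2); split=> //; exists a2.
have b12 : b1 = b2 by apply: Vi; rewrite ?inE // b1r.
have ij : i = j by apply: tW2 => //; exists b1; split=> //; rewrite b12.
by apply: W2i; rewrite ?inE // ij.
Qed.

Lemma same_sheet_in V y z : is_sheet V -> V y -> V z -> A (p y) -> A (p z) ->
  same_sheet A y z.
Proof.
move=> sV Vy Vz Ay Az O O' oO Ny oO' Mz; have [_ Vi _] := sV.
have [||r [Ar [[b [Nb Vb] br] [c [Mc Vc] cr]]]] := irreducible_meet iA
  (sheet_open_image sV oO) (sheet_open_image sV oO').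
- by exists (p y); split=> //; exists y.
- by exists (p z); split=> //; exists z.
exists b; split; rewrite ?br //; suff -> : b = c by [].
by apply: Vi; rewrite ?inE // br.
Qed.

(** The points on the same sheet as [y] form the image of a continuous section
    over [B], whose graph is connected like [B]. *)
Lemma section_connected (B : set E) y : connected B -> B `<=` A -> B (p y) ->
  exists g : E -> C, [/\ forall t, B t -> p (g t) = t /\ same_sheet A y (g t),
    g (p y) = y & connected (g @` B)].
Proof.
move=> cB BA By; have Ay := BA _ By.
have /choice[g gP] (t : E) : exists z, B t -> p z = t /\ same_sheet A y z.
  have [Bt|] := pselect (B t); last by exists y.
  by have [z zt yz] := same_sheet_exists Ay (BA _ Bt); exists z.
exists g; split=> //.
  have [gy ygy] := gP _ By.
  by apply: (same_sheet_unique ygy) => //; exact: same_sheet_refl.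
apply: connected_continuous_connected => //.
apply/subspace_continuousP => t Bt O nO.
have [gt ygt] := gP _ Bt.
have [V [sV Vgt]] := sheet_exists (g t).
have nW : nbhs t (p @` (O^° `&` V)).
  apply: open_nbhs_nbhs; split; last by exists (g t).
  by apply: sheet_open_image => //; exact: open_interior.
rewrite /nbhs /= /within /=; apply: filterS nW => r [z [Nz Vz] zr] Br.
have [gr ygr] := gP _ Br.
suff grz : g r = z by rewrite /from_subspace grz; exact: interior_subset.
apply: (same_sheet_unique ygr); last by rewrite gr zr.
apply: (same_sheet_trans ygt); apply: (same_sheet_in sV) => //.
  by rewrite gt; exact: BA.
by rewrite zr; exact: BA.
Qed.

Lemma same_sheet_connected (K : set C) y z : connected K ->
  K `<=` p @^-1` A -> K y -> K z -> same_sheet A y z.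
Proof.
move=> cK KA Ky Kz.
apply: (connected_locally_constant cK (Q := same_sheet A y) _ Ky) => //.
  move=> w Kw; have [V [sV Vw]] := sheet_exists w; have [oV _ _] := sV.
  apply: filterS (open_nbhs_nbhs (conj oV Vw)) => w' Vw' Kw'.
  have ww' : same_sheet A w w' by apply: (same_sheet_in sV) => //; exact: KA.
  split=> [yw|yw']; first exact: same_sheet_trans yw ww'.
  exact: same_sheet_trans yw' (same_sheet_sym ww').
by apply: same_sheet_refl; exact: KA.
Qed.

End Irreducible.

Section Cells.
Variable c : cell E.
Hypothesis c0 : cell_verts c != fset0.

(** Over a cell, the graphs of the sections of a covering are the connected
    components of the inverse image.  Unlike [same_sheet], this makes sense
    without singling out a vertex of the cell, and restriction to a smaller set
    is evident. *)
Definition same_leaf y z : Prop := connected_component (p @^-1` cell_set c) y z.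

Lemma same_leaf_refl y : cell_set c (p y) -> same_leaf y y.
Proof. by move=> cy; exact: connected_component_refl. Qed.

Lemma same_leaf_exists y t : cell_set c (p y) -> cell_set c t ->
  exists2 z, p z = t & same_leaf y z.
Proof.
move=> cy ct; have /fset0Pn[v vc] := c0.
have cv : cell_set c `<=` comp_set v by move=> s /cell_sub; apply.
have [g [gP gy cg]] := section_connected (irr_compP v).1
  (@cell_connected _ c) cv cy.
exists (g t); first by have [] := gP _ ct.
exists (g @` cell_set c); last by exists t.
split=> //; first by exists (p y).
by move=> _ [s cs <-]; rewrite /= (gP _ cs).1.
Qed.

(** Being on the same sheet as [y] is a locally constant property. *)
Lemma same_leaf_sheet v y z : v \in cell_verts c -> same_leaf y z ->
  same_sheet (comp_set v) y z.
Proof.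
move=> vc [K [Ky Kc cK] Kz].
apply: (same_sheet_connected (irr_compP v).1 cK) => // w /Kc /cell_sub; exact.
Qed.

Lemma same_leaf_unique y z1 z2 : same_leaf y z1 -> same_leaf y z2 ->
  p z1 = p z2 -> z1 = z2.
Proof.
move=> y1 y2; have /fset0Pn[v vc] := c0.
exact: (same_sheet_unique (irr_compP v).1 (same_leaf_sheet vc y1)
  (same_leaf_sheet vc y2)).
Qed.

Lemma same_leaf_sym y z : same_leaf y z -> same_leaf z y.
Proof. exact: connected_component_sym. Qed.

Lemma same_leaf_trans z y w : same_leaf y z -> same_leaf z w -> same_leaf y w.
Proof. exact: connected_component_trans. Qed.

End Cells.

Lemma same_leaf_le c d y z : cell_le c d -> same_leaf d y z -> same_leaf c y z.
Proof.
move=> [_ _ dc] [K [Ky Kd cK] Kz]; exists K => //; split=> //.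
by move=> w /Kd /dc.
Qed.

Definition leaf : Type :=
  {z : cell E * C | cell_verts z.1 != fset0 /\ cell_set z.1 (p z.2)}.

Definition leaf_le (z w : leaf) : Prop :=
  cell_le (sval z).1 (sval w).1 /\ same_leaf (sval z).1 (sval z).2 (sval w).2.

Definition mk_leaf c y (c0 : cell_verts c != fset0) (cy : cell_set c (p y)) :
  leaf := exist _ (c, y) (conj c0 cy).

Lemma leaf_refl z : leaf_le z z.
Proof.
case: z => [[c y] [c0 cy]]; split; first exact: cell_le_refl.
exact: same_leaf_refl.
Qed.

Lemma leaf_trans w z u : leaf_le z w -> leaf_le w u -> leaf_le z u.
Proof.
move=> [zw yw] [wu y2u]; split; first exact: cell_le_trans wu.
exact: same_leaf_trans yw (same_leaf_le zw y2u).
Qed.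

Lemma leaf_up (z : leaf) d : cell_le (sval z).1 d ->
  exists2 w : leaf, (sval w).1 = d & leaf_le z w.
Proof.
case: z => [[c y] [c0 cy]] /= cd; have [t dt] := cell_nonempty d.
have [_ cd' dc] := cd.
have [z zt yz] := same_leaf_exists c0 cy (dc _ dt).
have d0 : cell_verts d != fset0.
  by apply: contra_neq c0 => d0; apply/eqP; rewrite -fsubset0 -d0.
have dz : cell_set d (p z) by rewrite zt.
by exists (mk_leaf d0 dz).
Qed.

Lemma leaf_down (w : leaf) c : cell_le c (sval w).1 ->
  exists2 z : leaf, (sval z).1 = c & leaf_le z w.
Proof.
case: w => [[d y] [d0 dy]] /= cd; have [c0 _ dc] := cd.
exists (mk_leaf c0 (dc _ dy)) => //; split=> //.
exact/same_leaf_refl/dc.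
Qed.

Lemma leaf_up_unique (z w w' : leaf) : leaf_le z w -> leaf_le z w' ->
  (sval w).1 = (sval w').1 -> leaf_le w w'.
Proof.
case: z w w' => [[c y] [c0 cy]] [[d a] [d0 da]] [[d' b] [d'0 db]].
rewrite /leaf_le /= => -[cd ya] [_ yb] e; subst d'.
split; first exact: cell_le_refl.
have [b' b2t ab2] := same_leaf_exists d0 da db.
suff -> : b = b' by [].
apply: (same_leaf_unique c0 yb) => //.
exact: same_leaf_trans ya (same_leaf_le cd ab2).
Qed.

Lemma leaf_down_unique (w z z' : leaf) : leaf_le z w -> leaf_le z' w ->
  (sval z).1 = (sval z').1 -> leaf_le z z'.
Proof.
case: z z' w => [[c a] [c0 ca]] [[c' b] [c'0 cb]] [[d y] [d0 dy]].
rewrite /leaf_le /= => -[cd ay] [_ yb] e; subst c'.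
split; first exact: cell_le_refl.
exact: same_leaf_trans ay (same_leaf_sym yb).
Qed.

(** The local system of a covering [C]: over a cell, the points of [C] above it
    up to the relation of lying on one leaf. *)
Definition leaf_system : local_system (@cell_le E) :=
  @LocalSystem _ _ leaf (fun z => (sval z).1) leaf_le leaf_refl leaf_trans
    (fun z w zw => zw.1) leaf_up leaf_down leaf_up_unique leaf_down_unique.

Hypothesis lfE : locally_finite_irreducible E.

Definition top_leaf y : leaf_system :=
  mk_leaf (top_cell_verts lfE (p y)) (@top_cell_mem _ (p y)).

(** The leaf system remembers the topology of [C]: near [y] all points lie on
    the leaf of [y] over their own top cell. *)
Lemma top_leaf_near y :
  \forall z \near y, ls_le (top_leaf z) (top_leaf y).
Proof.
have [V [sV Vy]] := sheet_exists y; have [oV _ _] := sV.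
have pcont : continuous p := (cov_projP C).1.
have ny : \forall z \near y, cell_le (top_cell (p z)) (top_cell (p y)).
  exact: (pcont y _ (top_cell_near lfE _)).
apply: filterS2 ny (open_nbhs_nbhs (conj oV Vy)) => z zy Vz; split=> //=.
have zc := @top_cell_mem _ (p z); have yc := cell_le_top_mem zy.
have z0 := top_cell_verts lfE (p z).
have [y' y2y zy2] := same_leaf_exists z0 zc yc.
have /fset0Pn[v vz] := z0.
suff -> : y = y' by [].
apply: (same_sheet_unique (irr_compP v).1 _ (same_leaf_sheet vz zy2)) => //.
apply: (same_sheet_in (irr_compP v).1 sV) => //.
  exact: (cell_sub zc).
exact: (cell_sub yc).
Qed.

End Sheets.

Lemma same_leaf_image (E : topologicalType) (C D : covering E)
    (h : cov_hom C D) c (y z : C) :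
  same_leaf c y z -> same_leaf c (h y) (h z).
Proof.
move=> [K [Ky Kc cK] Kz]; exists (h @` K); last by exists z.
split; first by exists y.
  by move=> _ [w Kw <-]; rewrite /= cov_fun_proj; exact: Kc.
apply: connected_continuous_connected => //.
exact/continuous_subspaceT/cov_fun_continuous.
Qed.

(** * The covering glued from a local system *)

Section TotalSpace.
Variables (E : topologicalType) (L : local_system (@cell_le E)).
Implicit Types z w : L.

(** A point over [s] is a class of equivalent elements over [top_cell s]; the
    class is recorded as a set. *)
Definition etale_space : Type := set_type [set u : E * set L |
  exists2 z, ls_pos z = top_cell u.1 &
    u.2 = [set w | ls_pos w = top_cell u.1 /\ ls_le z w]].
HB.instance Definition _ := Choice.on etale_space.
Implicit Types u v : etale_space.

Definition etale_proj u : E := (set_val u).1.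

Definition etale_germ u : set L := (set_val u).2.

Lemma etale_germP u : exists2 z, ls_pos z = top_cell (etale_proj u) &
  etale_germ u = [set w | ls_pos w = top_cell (etale_proj u) /\ ls_le z w].
Proof. exact: set_mem (valP u). Qed.

Lemma etale_germ_pos u z : etale_germ u z -> ls_pos z = top_cell (etale_proj u).
Proof. by have [w wu ->] := etale_germP u; case. Qed.

Lemma etale_germ_exists u : exists z, etale_germ u z.
Proof.
by have [z zu ->] := etale_germP u; exists z; split=> //; exact: ls_refl.
Qed.

Lemma etale_germ_le u z w : etale_germ u z -> etale_germ u w -> ls_le z w.
Proof.
have [x xu ->] := etale_germP u => -[zu xz] [wu xw].
by apply: (ls_up_unique xz xw); rewrite zu wu.
Qed.

Lemma etale_germ_closed u z w : etale_germ u z -> ls_le z w ->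
  ls_pos w = ls_pos z -> etale_germ u w.
Proof.
have [x xu ->] := etale_germP u => -[zu xz] zw wz.
by split; [rewrite wz zu|exact: ls_trans xz zw].
Qed.

Lemma etale_exists (s : E) z : ls_pos z = top_cell s ->
  exists2 u, etale_proj u = s & etale_germ u z.
Proof.
move=> zs.
have us : exists2 z', ls_pos z' = top_cell s &
    [set w | ls_pos w = top_cell s /\ ls_le z w] =
    [set w | ls_pos w = top_cell s /\ ls_le z' w] by exists z.
exists (exist _ (s, _) (mem_set us)) => //.
by split=> //; exact: ls_refl.
Qed.

Lemma etale_inj u v z w : etale_proj u = etale_proj v ->
  etale_germ u z -> etale_germ v w -> ls_le z w -> u = v.
Proof.
move=> uv uz vw zw.
have vz : etale_germ v z.
  have pzw : ls_pos z = ls_pos w by rewrite (etale_germ_pos uz) uv (etale_germ_pos vw).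
  apply: (etale_germ_closed vw) => //.
  exact: (ls_up_unique zw (ls_refl z)).
have germE : etale_germ u = etale_germ v.
  apply/seteqP; split=> x xuv.
    apply: (etale_germ_closed vz (etale_germ_le uz xuv)).
    by rewrite (etale_germ_pos xuv) (etale_germ_pos uz).
  apply: (etale_germ_closed uz (etale_germ_le vz xuv)).
  by rewrite (etale_germ_pos xuv) (etale_germ_pos vz).
apply: val_inj; move: uv germE; rewrite /etale_proj /etale_germ /set_val /=.
by case: (\val u) (\val v) => s A [t B] /= -> ->.
Qed.

(** [u] lies on the sheet through [v]; its projection is then a point near that
    of [v], with a smaller top cell. *)
Definition etale_le u v : Prop :=
  exists z w, [/\ etale_germ u z, etale_germ v w & ls_le z w].

Lemma etale_leP u v z w : etale_le u v -> etale_germ u z -> etale_germ v w ->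
  ls_le z w.
Proof.
move=> [z' [w' [uz' vw' zw']]] uz vw.
exact: ls_trans (etale_germ_le uz uz') (ls_trans zw' (etale_germ_le vw' vw)).
Qed.

Lemma etale_le_refl u : etale_le u u.
Proof.
by have [z uz] := etale_germ_exists u; exists z, z; split=> //; exact: ls_refl.
Qed.

Lemma etale_le_trans v u (w : etale_space) : etale_le u v -> etale_le v w -> etale_le u w.
Proof.
move=> [a [b [ua vb ab]]] [b' [c [vb' wc b'c]]]; exists a, c; split=> //.
exact: ls_trans ab (ls_trans (etale_germ_le vb vb') b'c).
Qed.

Lemma etale_le_top u v : etale_le u v ->
  cell_le (top_cell (etale_proj u)) (top_cell (etale_proj v)).
Proof.
move=> [z [w [uz vw /ls_mono]]].
by rewrite (etale_germ_pos uz) (etale_germ_pos vw).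
Qed.

Definition etale_open (W : set etale_space) : Prop := forall u, W u ->
  \forall s \near etale_proj u, forall v, etale_proj v = s ->
    etale_le v u -> W v.

Lemma etale_openT : etale_open setT.
Proof. by move=> u _; apply: near_all. Qed.

Lemma etale_openI : setI_closed etale_open.
Proof.
move=> V W oV oW u [Vu Wu]; apply: filterS2 (oV u Vu) (oW u Wu) => s Vs Ws v vs vu.
by split; [exact: Vs|exact: Ws].
Qed.

Lemma etale_open_bigU (I : Type) (W : I -> set etale_space) :
  (forall i, etale_open (W i)) -> etale_open (\bigcup_i W i).
Proof.
move=> oW u [i _ Wu]; apply: filterS (oW i u Wu) => s Ws v vs vu.
by exists i => //; exact: Ws.
Qed.

HB.instance Definition _ := isOpenTopological.Build etale_space
  etale_openT etale_openI etale_open_bigU.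

Lemma etale_openE (W : set etale_space) : open W = etale_open W.
Proof. by []. Qed.

Lemma etale_proj_continuous : continuous etale_proj.
Proof.
apply/continuousP => N oN; rewrite etale_openE => u Nu.
by apply: filterS (open_nbhs_nbhs (conj oN Nu)) => s Ns v /= ->.
Qed.

Hypothesis lfE : locally_finite_irreducible E.

Lemma etale_basic_open u : open [set v | etale_le v u].
Proof.
rewrite etale_openE => v vu; apply: near_all => s w _ wv.
exact: etale_le_trans wv vu.
Qed.

Lemma etale_nbhs u (W : set etale_space) :
  (\forall s \near etale_proj u, forall v, etale_proj v = s ->
    etale_le v u -> W v) -> nbhs u W.
Proof.
move=> nW.
have nu : nbhs u [set v | etale_le v u].
  by apply: open_nbhs_nbhs; split; [exact: etale_basic_open|exact: etale_le_refl].
have := @etale_proj_continuous u _ nW; apply: filterS2 nu => v vu; exact.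
Qed.

Lemma etale_nbhs_le u (W : set etale_space) : nbhs u W ->
  \forall s \near etale_proj u, forall v, etale_proj v = s ->
    etale_le v u -> W v.
Proof.
rewrite nbhsE => -[N [oN Nu] NW]; rewrite etale_openE in oN.
by apply: filterS (oN u Nu) => s Ns v vs vu; apply: NW; exact: Ns.
Qed.

Lemma etale_le_exists u (s : E) : cell_le (top_cell s) (top_cell (etale_proj u)) ->
  exists2 v, etale_proj v = s & etale_le v u.
Proof.
have [z uz] := etale_germ_exists u; rewrite -(etale_germ_pos uz) => sz.
have [w ws wz] := ls_down sz.
by have [v vs vw] := etale_exists ws; exists v => //; exists w, z.
Qed.

Lemma etale_le_inj u v (w : etale_space) : etale_le v u -> etale_le w u ->
  etale_proj v = etale_proj w -> v = w.
Proof.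
move=> vu wu vw; have [z uz] := etale_germ_exists u.
have [a va] := etale_germ_exists v; have [b wb] := etale_germ_exists w.
apply: (etale_inj vw va wb).
apply: (ls_down_unique (etale_leP vu va uz) (etale_leP wu wb uz)).
by rewrite (etale_germ_pos va) (etale_germ_pos wb) vw.
Qed.

(** Over the points [t] with [top_cell t] below [top_cell s], the sheet through
    a point over [s] consists of the points below it; unique lifting downwards
    makes it a bijection onto the base. *)
Lemma etale_covering : is_covering etale_proj.
Proof.
split; first exact: etale_proj_continuous.
move=> s; pose U := [set t | cell_le (top_cell t) (top_cell s)].
exists U; split.
- rewrite openE => t ts; apply: filterS (top_cell_near lfE t) => r rt.
  exact: cell_le_trans rt ts.
- exact/cell_le_refl/top_cell_verts.
exists {u | etale_proj u = s},
  (fun i : {u | etale_proj u = s} => [set v | etale_le v (sval i)]); split.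
- by move=> i; exact: etale_basic_open.
- move=> i j _ _ [w [wu wv]]; apply: eq_sig_hprop => //.
  have [[a ua] [b vb]] := (etale_germ_exists (sval i), etale_germ_exists (sval j)).
  have [c wc] := etale_germ_exists w.
  have uv : etale_proj (sval i) = etale_proj (sval j).
    by rewrite (svalP i) (svalP j).
  apply: (etale_inj uv ua vb).
  apply: (ls_up_unique (etale_leP wu wc ua) (etale_leP wv wc vb)).
  by rewrite (etale_germ_pos ua) (etale_germ_pos vb) uv.
- apply/seteqP; split=> [v vs|v [[u us] _ vu]]; last first.
    by rewrite /= /U /= -us; exact: etale_le_top.
  have [z vz] := etale_germ_exists v.
  have : cell_le (ls_pos z) (top_cell s) by rewrite (etale_germ_pos vz).
  move=> zs; have [w ws zw] := ls_up zs; have [u us uw] := etale_exists ws.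
  by exists (exist _ u us) => //; exists z, w.
- move=> [u us]; split; first split=> [v vu|v w|t tU].
  + by rewrite /U /= -us; exact: etale_le_top.
  + by rewrite !inE => vu wu; exact: etale_le_inj vu wu.
  + by rewrite /U /= -us in tU; have [v] := etale_le_exists tU; exists v.
  + move=> W oW Wu; rewrite openE => _ [v Wv <-].
    have oW' : etale_open W by [].
    apply: filterS2 (oW' v Wv) (top_cell_near lfE (etale_proj v)) => t tW.
    by move=> /etale_le_exists[w wt wv]; exists w => //; exact: tW wv.
Qed.

Definition etale_cover : covering E := Covering etale_covering.

(** [z] defines a section of the covering over the whole set of its cell; [u]
    is one of its values. *)
Definition germ_over z u : Prop := exists2 w, etale_germ u w & ls_le z w.

Lemma germ_over_exists z (s : E) : cell_le (ls_pos z) (top_cell s) ->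
  exists2 u, etale_proj u = s & germ_over z u.
Proof.
move=> zs; have [w ws zw] := ls_up zs; have [u us uw] := etale_exists ws.
by exists u => //; exists w.
Qed.

Lemma germ_over_inj z u v : germ_over z u -> germ_over z v ->
  etale_proj u = etale_proj v -> u = v.
Proof.
move=> [a ua za] [b vb zb] uv; apply: (etale_inj uv ua vb).
by apply: (ls_up_unique za zb); rewrite (etale_germ_pos ua) (etale_germ_pos vb) uv.
Qed.

Lemma germ_over_le z w u : ls_le z w -> germ_over w u -> germ_over z u.
Proof. by move=> zw [v uv wv]; exists v => //; exact: ls_trans zw wv. Qed.

Lemma germ_over_mem z u : germ_over z u -> cell_set (ls_pos z) (etale_proj u).
Proof.
move=> [w uw /ls_mono]; rewrite (etale_germ_pos uw); exact: cell_le_top_mem.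
Qed.

(** The section defined by [z] is continuous, so its image is connected. *)
Lemma germ_over_leaf z u v : germ_over z u -> germ_over z v ->
  @same_leaf _ etale_cover (ls_pos z) u v.
Proof.
move=> zu zv; set c := ls_pos z.
have c0 : cell_verts c != fset0 by have [] := ls_mono (ls_refl z).
have /choice[g gP] (s : E) : exists u,
    cell_set c s -> etale_proj u = s /\ germ_over z u.
  have [cs|] := pselect (cell_set c s); last by exists u.
  by have [u' us zu'] := germ_over_exists (cell_le_top lfE c0 cs); exists u'.
have gE (w : etale_space) : germ_over z w -> g (etale_proj w) = w.
  by move=> zw; have [gw zgw] := gP _ (germ_over_mem zw); exact: (germ_over_inj zgw zw gw).
exists (g @` cell_set c); last first.
  by exists (etale_proj v); [exact: germ_over_mem|exact: gE].
split; first by exists (etale_proj u); [exact: germ_over_mem|exact: gE].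
  by move=> _ [s cs <-]; rewrite /= (gP s cs).1.
apply: connected_continuous_connected; first exact: cell_connected.
apply/subspace_continuousP => s cs W nW.
have [gs [a ga za]] := gP s cs.
rewrite /nbhs /= /within /=; have := etale_nbhs_le nW.
rewrite /from_subspace gs; apply: filterS2 (top_cell_near lfE s) => t ts Wt ct.
have [gt [b gb zb]] := gP t ct; apply: (Wt _ gt); exists b, a; split=> //.
apply: (ls_fill_up zb za).
by rewrite (etale_germ_pos ga) (etale_germ_pos gb) gs gt.
Qed.

(** [L] maps to the leaf system of the covering glued from it, so transport in
    [L] computes transport in that covering. *)
Lemma germ_leaf_map : exists h : L -> leaf_system etale_cover,
  [/\ forall z, ls_pos (h z) = ls_pos z,
      forall z w, ls_le z w -> ls_le (h z) (h w) &
      forall z (u : leaf_system etale_cover), ls_pos u = ls_pos z ->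
        germ_over z (sval u).2 -> ls_le (h z) u].
Proof.
have /choice[h hP] z : exists u : leaf_system etale_cover,
    ls_pos u = ls_pos z /\ germ_over z (sval u).2.
  have c0 : cell_verts (ls_pos z) != fset0 by have [] := ls_mono (ls_refl z).
  have [s cs] := cell_nonempty (ls_pos z).
  have [u us zu] := germ_over_exists (cell_le_top lfE c0 cs).
  have cu : cell_set (ls_pos z) (@cov_proj _ etale_cover u) by rewrite /= us.
  by exists (mk_leaf c0 cu).
exists h; split=> [z|z w zw|z u uz zu].
- by have [] := hP z.
- have [hz zhz] := hP z; have [hw whw] := hP w; split.
    have := ls_mono zw; rewrite -hz -hw; exact.
  have -> : (sval (h z)).1 = ls_pos z by [].
  apply: germ_over_leaf => //; exact: germ_over_le zw whw.
- have [hz zhz] := hP z; split.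
    have := ls_mono (ls_refl (h z)); rewrite {2}hz -uz; exact.
  have -> : (sval (h z)).1 = ls_pos z by [].
  exact: germ_over_leaf.
Qed.

End TotalSpace.

Section EtaleMaps.
Variables (E : topologicalType) (L : local_system (@cell_le E)).
Hypothesis lfE : locally_finite_irreducible E.

(** Continuity amounts to preserving sheets. *)
Lemma etale_to_covering (C : covering E) (h : etale_space L -> C) :
  (forall u, cov_proj (h u) = etale_proj u) ->
  (forall u v, etale_le v u ->
    ls_le (top_leaf lfE (h v)) (top_leaf lfE (h u))) ->
  exists f : cov_hom (etale_cover L lfE) C, cov_fun f = h.
Proof.
move=> ph hle.
suff ch : continuous (h : etale_cover L lfE -> C) by exists (CovHom ch ph).
move=> u W nW; have [V [sV Vh]] := sheet_exists (h u); have [oV _ _] := sV.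
pose W' := [set y | W y /\ ls_le (top_leaf lfE y) (top_leaf lfE (h u))]^°.
have nW' : W' (h u) by apply: filterI => //; exact: top_leaf_near.
change (nbhs (u : etale_space L) (h @^-1` W)); apply: etale_nbhs.
have nI : nbhs (etale_proj u) (@cov_proj _ C @` (W' `&` V)).
  apply: open_nbhs_nbhs; split; last by exists (h u).
  by apply: sheet_open_image => //; exact: open_interior.
apply: filterS nI => s [y [/interior_subset[Wy yh] _] ys] v vs vu.
suff hvy : h v = y by rewrite /= hvy.
have hvh := hle _ _ vu.
have pe : cov_proj (h v) = cov_proj y by rewrite ph vs ys.
have [_] : ls_le (top_leaf lfE y) (top_leaf lfE (h v)).
  by apply: (ls_down_unique yh hvh); rewrite /= pe.
move=> yhv; apply: (same_leaf_unique (top_cell_verts lfE (cov_proj y)) yhv) => //.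
by apply: same_leaf_refl; exact: top_cell_mem.
Qed.

Lemma etale_map (M : local_system (@cell_le E)) (m : L -> M) :
  (forall z, ls_pos (m z) = ls_pos z) ->
  (forall z w, ls_le z w -> ls_le (m z) (m w)) ->
  exists f : cov_hom (etale_cover L lfE) (etale_cover M lfE),
    forall z u, germ_over z u -> germ_over (m z) (f u).
Proof.
move=> mpos mle.
have /choice[h hP] (u : etale_space L) : exists v : etale_space M,
    etale_proj v = etale_proj u /\ forall z, etale_germ u z -> etale_germ v (m z).
  have [z uz] := etale_germ_exists u.
  have [|v vu vz] := @etale_exists _ M (etale_proj u) (m z).
    by rewrite mpos (etale_germ_pos uz).
  exists v; split=> // w uw; apply: (etale_germ_closed vz).
    exact/mle/(etale_germ_le uz uw).
  by rewrite !mpos (etale_germ_pos uz) (etale_germ_pos uw).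
have hle u v : etale_le v u -> etale_le (h v) (h u).
  move=> [z [w [vz uw zw]]]; exists (m z), (m w); split; last exact: mle.
  - exact: (hP v).2.
  - exact: (hP u).2.
have ch : continuous (h : etale_cover L lfE -> etale_cover M lfE).
  move=> u W nW; change (nbhs (u : etale_space L) (h @^-1` W)); apply: etale_nbhs.
  have := etale_nbhs_le nW; rewrite (hP u).1; apply: filterS => s Ws v vs vu.
  by apply: (Ws (h v)); [rewrite (hP v).1|exact: hle].
exists (@CovHom _ (etale_cover L lfE) (etale_cover M lfE) h ch (fun u => (hP u).1)).
by move=> z u [w uw zw]; exists (m w); [exact: (hP u).2|exact: mle].
Qed.

End EtaleMaps.

(** * Points of the dual complex *)

Section Carrier.
Variables (R : realType) (E : topologicalType).
Local Notation Gamma := (dual_complex R E).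
Local Notation I := (unit_interval R).
Implicit Types (x y : dual_cells R E) (z a : Gamma) (c d : cell E).

Lemma cell_le_eq c c' d : cell_le c d -> cell_le c' d ->
  cell_verts c = cell_verts c' -> c = c'.
Proof.
move=> [c0 cd dc] [c'0 c'd dc'] e; have [s ds] := cell_nonempty d.
apply: cell_le_anti; apply: (cell_le_meet (s := s)) => //;
  by [exact: dc|exact: dc'|rewrite e].
Qed.

Lemma simplexP (sigma : {fset irr_comp E}) (t : simplex R sigma) :
  [/\ (forall v, 0 <= simplex_coord t v),
      (forall v, v \notin sigma -> simplex_coord t v = 0) &
      \sum_(v <- sigma) simplex_coord t v = 1].
Proof. exact: set_mem (valP t). Qed.

Definition dual_coord x : irr_comp E -> R := simplex_coord (tagged x).

Definition bary_support x : {fset irr_comp E} :=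
  [fset v in cell_verts (tag x) | dual_coord x v != 0]%fset.

Lemma supportP x v : (v \in bary_support x) = (dual_coord x v != 0).
Proof.
have [_ x0 _] := simplexP (tagged x).
rewrite !inE /=; case: (boolP (v \in _)) => //= vx.
by rewrite /dual_coord x0 // eqxx.
Qed.

Lemma support_sub x : (bary_support x `<=` cell_verts (tag x))%fset.
Proof. exact: fset_sub. Qed.

Lemma support_neq0 x : bary_support x != fset0.
Proof.
have [_ _ x1] := simplexP (tagged x).
apply/negP => /eqP x0; have := oner_neq0 R; rewrite -x1 big1_seq ?eqxx // => v _.
apply/eqP/negPn/negP => xv; have : v \in bary_support x by rewrite supportP.
by rewrite x0 inE.
Qed.

Lemma carrier_subproof x : stratum (bary_support x) (projT1 (cid (cell_nonempty (tag x)))).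
Proof.
by case: cid => s /= xs; apply: (stratum_anti (support_sub x)); exact: cell_sub.
Qed.

(** The cell whose open simplex contains the point.  It must contain the set of
    the given cell, so any point of that set serves to define it. *)
Definition cells_carrier x : cell E := mk_cell (@carrier_subproof x).

Lemma cells_carrier_le x : cell_le (cells_carrier x) (tag x).
Proof.
pose s := projT1 (cid (cell_nonempty (tag x))).
apply: (cell_le_meet (s := s)); first exact: support_neq0.
- exact: support_sub.
- exact: mk_cell_mem.
- by rewrite /s; case: cid.
Qed.

Lemma face_glue_le x y : face_glue x y -> cell_le (tag x) (tag y).
Proof.
move=> [xy yx _]; split=> //; have [x0 xx _] := cells_carrier_le x.
by apply: contra_neq x0 => e; apply/eqP; rewrite -fsubset0 -e.
Qed.

Lemma face_glue_carrier x y : face_glue x y -> cells_carrier x = cells_carrier y.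
Proof.
move=> xy; apply: (cell_le_eq (d := tag y)); last 1 first.
- by apply/fsetP => v; rewrite !supportP /dual_coord; case: xy => _ _ ->.
- exact: cell_le_trans (cells_carrier_le x) (face_glue_le xy).
- exact: cells_carrier_le.
Qed.

Definition carrier z : cell E := cells_carrier (repr z).
Definition bary z : irr_comp E -> R := dual_coord (repr z).

Lemma carrier_neq0 z : cell_verts (carrier z) != fset0.
Proof. exact: support_neq0. Qed.

Lemma carrier_refl z : cell_le (carrier z) (carrier z).
Proof. by apply: cell_le_refl; exact: carrier_neq0. Qed.

Lemma dual_point_repr z : dual_point (repr z) = z.
Proof. exact: reprK. Qed.

Lemma glue_carrier x y : clos_refl_sym_trans _ (@face_glue R E) x y ->
  cells_carrier x = cells_carrier y /\ dual_coord x = dual_coord y.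
Proof.
elim=> {x y} [x y xy|//|x y _ [-> ->]//|x y z _ [-> ->] _ [-> ->]//].
by split; [exact: face_glue_carrier|case: xy].
Qed.

Lemma carrier_dual_point x : carrier (dual_point x) = cells_carrier x.
Proof.
by have /dual_pointP/glue_carrier[] := dual_point_repr (dual_point x).
Qed.

Lemma bary_dual_point x : bary (dual_point x) = dual_coord x.
Proof.
by have /dual_pointP/glue_carrier[] := dual_point_repr (dual_point x).
Qed.

Lemma carrier_le_dual_point x : cell_le (carrier (dual_point x)) (tag x).
Proof. by rewrite carrier_dual_point; exact: cells_carrier_le. Qed.

Lemma bary_ge0 z v : 0 <= bary z v.
Proof. by have [+ _ _] := simplexP (tagged (repr z)); apply. Qed.

Lemma carrier_vertsP z v : (v \in cell_verts (carrier z)) = (0 < bary z v).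
Proof. by rewrite lt_neqAle bary_ge0 andbT eq_sym; exact: supportP. Qed.

Lemma bary_simplex z (sigma : {fset irr_comp E}) :
  (cell_verts (carrier z) `<=` sigma)%fset ->
  [/\ (forall v, 0 <= bary z v), (forall v, v \notin sigma -> bary z v = 0) &
      \sum_(v <- sigma) bary z v = 1].
Proof.
move=> /fsubsetP zs.
have out v : v \notin cell_verts (carrier z) -> bary z v = 0.
  by rewrite carrier_vertsP -leNgt => z0; apply/le_anti; rewrite z0 bary_ge0.
split=> [v|v vs|]; first exact: bary_ge0.
  by apply: out; apply: contra vs; exact: zs.
have [_ _ <-] := simplexP (tagged (repr z)).
rewrite -[LHS](big_fset_incl _ (A := cell_verts (carrier z))) /=; last 2 first.
- exact/fsubsetP.
- by move=> v _ vz; exact: out.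
apply: big_fset_incl; first exact: support_sub.
by move=> v _ vz; exact: out.
Qed.

Lemma cell_le_verts c d : cell_le c d -> (cell_verts c `<=` cell_verts d)%fset.
Proof. by case. Qed.

Definition in_cell z c (zc : cell_le (carrier z) c) : dual_cells R E :=
  existT (fun c => simplex R (cell_verts c)) c
    (exist _ (bary z : {ptws irr_comp E -> R})
      (mem_set (bary_simplex (cell_le_verts zc)))).

Lemma in_cell_glue z c d (zc : cell_le (carrier z) c) (zd : cell_le (carrier z) d) :
  cell_le c d -> dual_point (in_cell zc) = dual_point (in_cell zd).
Proof. by move=> [_ cd dc]; apply/dual_pointP/rst_step; split. Qed.

Lemma in_cellE z c (zc : cell_le (carrier z) c) : dual_point (in_cell zc) = z.
Proof.
rewrite -(in_cell_glue (carrier_refl z) zc zc) -[RHS]dual_point_repr.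
have [_ zr rz] : cell_le (carrier z) (tag (repr z)) by exact: cells_carrier_le.
by apply/dual_pointP/rst_step; split.
Qed.

(** Barycentric coordinates alone do not determine a point, as several cells may
    have the same vertices; a common cell settles the ambiguity. *)
Lemma dual_ext z a c : cell_le (carrier z) c -> cell_le (carrier a) c ->
  bary z = bary a -> z = a.
Proof.
move=> zc ac e; rewrite -(in_cellE zc) -(in_cellE ac).
by apply/dual_pointP/rst_step; split.
Qed.

Lemma bary_continuous v : continuous (fun z => bary z v).
Proof.
apply/quotient_continuous.
rewrite (_ : _ \o _ = fun x => dual_coord x v); last first.
  by apply/funext => x; exact: (congr1 (fun f => f v) (bary_dual_point x)).
apply: (@sigT_continuous (cell E) (fun c => simplex R (cell_verts c)) _
  (fun c t => simplex_coord t v)) => c.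
exact: simplex_coord_continuous.
Qed.

Lemma carrier_star c d (t : simplex R (cell_verts d)) :
  cell_le c (cells_carrier (existT (fun c => simplex R (cell_verts c)) d t)) <->
  cell_le c d /\ forall v, v \in cell_verts c -> 0 < simplex_coord t v.
Proof.
set x := existT _ d t; have xd := cells_carrier_le x; split=> [cx|[cd ct]].
  split=> [|v vc]; first exact: cell_le_trans cx xd.
  have [_ /fsubsetP/(_ _ vc) + _] := cx.
  rewrite [_ \in _]supportP lt_neqAle eq_sym => ->.
  by have [+ _ _] := simplexP t; apply.
have [c0 _ dc] := cd; have [_ _ dx] := xd; have [s ds] := cell_nonempty d.
apply: (cell_le_meet (s := s)) => //; [|exact: dc|exact: dx].
apply/fsubsetP => v vc; rewrite [_ \in _]supportP.
by have := ct v vc; rewrite lt0r => /andP[].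
Qed.

Lemma star_open c : open [set z | cell_le c (carrier z)].
Proof.
change (open (@dual_point R E @^-1` [set z | cell_le c (carrier z)])).
apply/sigT_openP => d.
have [cd|ncd] := pselect (cell_le c d); last first.
  rewrite (_ : _ @^-1` _ = set0); first exact: open0.
  apply/seteqP; split=> // t /=.
  by rewrite carrier_dual_point => /carrier_star[].
rewrite openE => t /=; rewrite carrier_dual_point => /carrier_star[_ ct].
have : nbhs t (\bigcap_(v in [set` cell_verts c])
    [set t' : simplex R (cell_verts d) | 0 < simplex_coord t' v]).
  apply: filter_bigI => v vc.
  apply: (@simplex_coord_continuous R _ _ v t [set r | 0 < r]).
  by apply: lt_nbhsr; exact: ct.
apply: filterS => t' ct' /=; rewrite carrier_dual_point; apply/carrier_star.
by split=> // v vc; exact: (ct' v).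
Qed.

Lemma carrier_near : germ_mono (@cell_le E) carrier.
Proof.
move=> z; apply: (@open_nbhs_nbhs _ z [set a | cell_le (carrier z) (carrier a)]).
by split; [exact: star_open|exact: carrier_refl].
Qed.

Lemma cell_point c : cell_verts c != fset0 -> exists a, cell_le (carrier a) c.
Proof.
move=> /fset0Pn[v vc]; pose t (w : irr_comp E) : R := (w == v)%:R.
have tP : [/\ forall w, 0 <= t w, forall w, w \notin cell_verts c -> t w = 0 &
    \sum_(w <- cell_verts c) t w = 1].
  split=> [w|w wc|]; first exact: ler0n.
    by rewrite /t; case: eqP => // wv; rewrite wv vc in wc.
  rewrite (bigD1_seq v) ?fset_uniq //= /t eqxx big1 ?addr0 // => w /negbTE ->.
  by [].
pose x : dual_cells R E := existT (fun c => simplex R (cell_verts c)) c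
  (exist _ (t : {ptws irr_comp E -> R}) (mem_set tP)).
by exists (dual_point x); exact: (carrier_le_dual_point x).
Qed.

End Carrier.

(** * Segments in simplices and contraction of open stars *)

Section Segments.
Variables (R : realType) (E : topologicalType).
Local Notation Gamma := (dual_complex R E).
Local Notation I := (unit_interval R).
Implicit Types (z a : Gamma) (c d : cell E) (u : I).

Definition segment_coord z a u : irr_comp E -> R :=
  fun v => (1 - set_val u) * bary z v + set_val u * bary a v.

(** Given [c], the point is singled out by its coordinates; choosing it by them
    avoids carrying proofs that [z] and [a] lie in the simplex of [c]. *)
Definition cell_segment c a z u : Gamma :=
  xget z [set w | cell_le (carrier w) c /\ bary w = segment_coord z a u].

Lemma segment_coord_simplex c a z u :
  cell_le (carrier z) c -> cell_le (carrier a) c ->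
  [/\ (forall v, 0 <= segment_coord z a u v),
      (forall v, v \notin cell_verts c -> segment_coord z a u v = 0) &
      \sum_(v <- cell_verts c) segment_coord z a u v = 1].
Proof.
move=> [_ zc _] [_ ac _]; have /andP[u0 u1] := unit_intervalP u.
have [z0 zo z1] := bary_simplex zc; have [a0 ao a1] := bary_simplex ac.
rewrite /segment_coord; split=> [v|v vc|].
- by apply: addr_ge0; apply: mulr_ge0; rewrite ?subr_ge0.
- by rewrite zo // ao // !mulr0 addr0.
- by rewrite big_split /= -!mulr_sumr z1 a1 !mulr1 subrK.
Qed.

Lemma cell_segmentP c a z u :
  cell_le (carrier z) c -> cell_le (carrier a) c ->
  cell_le (carrier (cell_segment c a z u)) c /\
  bary (cell_segment c a z u) = segment_coord z a u.
Proof.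
move=> zc ac; rewrite /cell_segment; case: xgetP => [w -> //|nw].
pose x : dual_cells R E := existT (fun c => simplex R (cell_verts c)) c
  (exist _ (segment_coord z a u : {ptws irr_comp E -> R})
    (mem_set (segment_coord_simplex u zc ac))).
case: (nw (dual_point x)); split; first exact: (carrier_le_dual_point x).
by rewrite bary_dual_point.
Qed.

Lemma cell_segment_eq c a z u w : cell_le (carrier z) c ->
  cell_le (carrier a) c -> cell_le (carrier w) c ->
  (forall v, bary w v = segment_coord z a u v) -> cell_segment c a z u = w.
Proof.
move=> zc ac wc e; have [sc se] := cell_segmentP u zc ac.
by apply: (dual_ext sc wc); rewrite se; apply/funext => v; rewrite e.
Qed.

Lemma cell_segment0 c a z : cell_le (carrier z) c -> cell_le (carrier a) c ->
  cell_segment c a z zero = z.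
Proof.
move=> zc ac; apply: cell_segment_eq => // v.
by rewrite /segment_coord val_zero subr0 mul1r mul0r addr0.
Qed.

Lemma cell_segment1 c a z : cell_le (carrier z) c -> cell_le (carrier a) c ->
  cell_segment c a z one = a.
Proof.
move=> zc ac; apply: cell_segment_eq => // v.
by rewrite /segment_coord val_one subrr mul0r mul1r add0r.
Qed.

Lemma cell_segment_id c a u : cell_le (carrier a) c -> cell_segment c a a u = a.
Proof.
move=> ac; apply: cell_segment_eq => // v.
by rewrite /segment_coord -mulrDl subrK mul1r.
Qed.

Lemma cell_segment_le c d a z u : cell_le c d -> cell_le (carrier z) c ->
  cell_le (carrier a) c -> cell_segment c a z u = cell_segment d a z u.
Proof.
move=> cd zc ac; have [sc se] := cell_segmentP u zc ac.
have up w : cell_le (carrier w) c -> cell_le (carrier w) d.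
  by move=> wc; exact: cell_le_trans cd.
by apply/esym/cell_segment_eq => [|||v]; rewrite ?se //; exact: up.
Qed.

Lemma segment_coord_continuous (T : topologicalType) (e : T -> irr_comp E -> R)
    (h : T -> I) (t : irr_comp E -> R) v :
  continuous (fun x => e x v) -> continuous h ->
  continuous (fun x => (1 - set_val (h x)) * e x v + set_val (h x) * t v).
Proof.
move=> ce ch x.
have cv : {for x, continuous (fun x => set_val (h x) : R)}.
  exact: (comp_continuous ch (@set_val_continuous R)).
apply: cvgD; apply: cvgM.
- by apply: cvgB; [exact: cvg_cst|exact: cv].
- exact: ce.
- exact: cv.
- exact: cvg_cst.
Qed.

Lemma dual_point_continuous c : continuous (fun t : simplex R (cell_verts c) =>
  dual_point (existT (fun c => simplex R (cell_verts c)) c t)).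
Proof.
exact: (@comp_continuous _ (dual_cells R E) _ _ (@dual_point R E)
  (@existT_continuous _ (fun c : cell E => simplex R (cell_verts c)) c)
  (@pi_continuous _ _)).
Qed.

Lemma in_cell_continuous (T : topologicalType) c (f : T -> Gamma)
    (e : T -> irr_comp E -> R) : (forall x, cell_le (carrier (f x)) c) ->
  (forall x, bary (f x) = e x) -> (forall v, continuous (fun x => e x v)) ->
  continuous f.
Proof.
move=> fc fe ce.
have tP x : [/\ (forall v, 0 <= e x v),
    (forall v, v \notin cell_verts c -> e x v = 0) &
    \sum_(v <- cell_verts c) e x v = 1].
  by rewrite -fe; apply: bary_simplex; have [] := fc x.
pose g x : simplex R (cell_verts c) :=
  exist _ (e x : {ptws irr_comp E -> R}) (mem_set (tP x)).
have cg : continuous g.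
  by apply: continuous_comp_initial; apply: ptws_continuous => v; exact: ce.
rewrite (_ : f = fun x => dual_point (existT (fun c => simplex R (cell_verts c)) c (g x))).
  exact: (comp_continuous cg (@dual_point_continuous c)).
apply/funext => x.
pose y : dual_cells R E := existT (fun c => simplex R (cell_verts c)) c (g x).
by apply: (dual_ext (fc x) (carrier_le_dual_point y)); rewrite fe bary_dual_point.
Qed.

Lemma cell_segment_continuous (T : topologicalType) c a (f : T -> Gamma)
    (h : T -> I) : continuous f -> continuous h ->
  (forall x, cell_le (carrier (f x)) c) -> cell_le (carrier a) c ->
  continuous (fun x => cell_segment c a (f x) (h x)).
Proof.
move=> cf ch fc ac; apply: (in_cell_continuous (c := c)
  (e := fun x => segment_coord (f x) a (h x))) => [x|x|v].
- exact: (cell_segmentP _ (fc x) ac).1.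
- exact: (cell_segmentP _ (fc x) ac).2.
- exact: (@segment_coord_continuous T (fun x => bary (f x)) h (bary a) v
    (comp_continuous cf (@bary_continuous R E v)) ch).
Qed.

(** For [z] in the open star of [a], this is the straight-line contraction onto
    [a], performed in the closed simplex that carries [z]. *)
Definition cone a z u : Gamma := cell_segment (carrier z) a z u.

Lemma coneE c a z u : cell_le (carrier a) (carrier z) -> cell_le (carrier z) c ->
  cone a z u = cell_segment c a z u.
Proof.
by move=> az zc; apply: cell_segment_le => //; exact: carrier_refl.
Qed.

(** The dual complex carries a quotient topology, and its product with the
    interval need not obviously be a quotient.  Around a compact [J] in the
    interval, the points whose segment over [J] stays in an open set form an open
    set, which can be checked simplex by simplex by the tube lemma. *)
Lemma cone_nbhs a z u (W : set Gamma) : cell_le (carrier a) (carrier z) ->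
  nbhs (cone a z u) W ->
  \forall y \near (z, u), cell_le (carrier a) (carrier y.1) -> W (cone a y.1 y.2).
Proof.
move=> az; rewrite nbhsE => -[N1 [oN N1z] NW].
have zz := carrier_refl z.
have cz : continuous (fun u => cone a z u).
  apply: (cell_segment_continuous (f := cst z)) => //; first exact: cst_continuous.
  by move=> v; exact: cvg_id.
have [J [nJ cJ JN]] : exists J : set I, [/\ nbhs u J, compact J &
    forall v, J v -> N1 (cone a z v)].
  have : nbhs u [set v | N1 (cone a z v)].
    by apply: cz; apply: open_nbhs_nbhs.
  move=> /unit_interval_ball[e e0 eN].
  exists (@clamp R @` `[set_val u - e / 2, set_val u + e / 2]); split.
  - have : \forall v \near u, set_val v \in `]set_val u - e / 2, set_val u + e / 2[.
      by apply: near_val_itv; apply: near_in_itvoo; rewrite in_itv /=; apply/andP; split; lra.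
    apply: filterS => v; rewrite in_itv /= => /andP[v1 v2].
    by exists (set_val v); [rewrite /= in_itv /=; apply/andP; split; lra|exact: clampK].
  - apply: continuous_compact; last exact: segment_compact.
    exact/continuous_subspaceT/clamp_continuous.
  - move=> _ [v + <-]; rewrite /= in_itv /= => /andP[v1 v2]; apply: eN.
    by rewrite ltr_norml; apply/andP; split; lra.
pose V := [set y | cell_le (carrier a) (carrier y) /\ forall v, J v -> N1 (cone a y v)].
suff oV : open V.
  have nV : nbhs z V by apply: open_nbhs_nbhs.
  have nVJ : nbhs (z, u) (V `*` J) by exists (V, J).
  by apply: filterS nVJ => -[y v] /= [[_ Vy] Jv] _; apply: NW; exact: Vy.
change (open (@dual_point R E @^-1` V)); apply/sigT_openP => d.
rewrite openE => t /= [atc Nt].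
set pt := fun t' : simplex R (cell_verts d) =>
  dual_point (existT (fun c => simplex R (cell_verts c)) d t').
have cpt : continuous pt by exact: dual_point_continuous.
have ptd t' : cell_le (carrier (pt t')) d by exact: carrier_le_dual_point.
have ad : cell_le (carrier a) d by exact: cell_le_trans atc (ptd t).
have nstar : \forall t' \near t, cell_le (carrier a) (carrier (pt t')).
  have nst : nbhs (pt t) [set y | cell_le (carrier a) (carrier y)].
    by apply: open_nbhs_nbhs; split; first exact: star_open.
  exact: (cpt t _ nst).
have ntube : \forall t' \near t, J `<=` [set v | N1 (cell_segment d a (pt t') v)].
  have /compact_near_coveringP coverJ := cJ.
  apply: (coverJ _ (nbhs t) (fun t' v => N1 (cell_segment d a (pt t') v))).
  move=> v Jv.
  have cseg : continuous (fun y : I * simplex R (cell_verts d) =>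
      cell_segment d a (pt y.2) y.1).
    apply: cell_segment_continuous => //.
    - by apply: (comp_continuous _ cpt) => y; exact: cvg_snd.
    - by move=> y; exact: cvg_fst.
  have nN : nbhs (cell_segment d a (pt t) v) N1.
    apply: open_nbhs_nbhs; split=> //.
    by rewrite -(coneE v atc (ptd t)); exact: Nt.
  exact: (cseg (v, t) _ nN).
apply: filterS2 nstar ntube => t' at' Jt'; split=> // v Jv.
by rewrite (coneE v at' (ptd t')); exact: Jt'.
Qed.

Lemma cone_continuous (T : topologicalType) a (f : T -> Gamma) (h : T -> I) :
  continuous f -> continuous h ->
  (forall x, cell_le (carrier a) (carrier (f x))) ->
  continuous (fun x => cone a (f x) (h x)).
Proof.
move=> cf ch fa x W nW.
have nc : \forall y \near x, cell_le (carrier a) (carrier (f y)) ->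
    W (cone a (f y) (h y)) := pair_continuous cf ch (cone_nbhs (fa x) nW).
by apply: filterS nc => y; exact.
Qed.

End Segments.

(** * The local system of paths *)

Section Concatenation.
Variables (R : realType) (X : topologicalType).
Local Notation I := (unit_interval R).
Implicit Types p q : I -> X.

Definition join_path p q (t : I) : X :=
  if set_val t <= 2^-1 :> R then p (clamp (2 * set_val t))
  else q (clamp (2 * set_val t - 1)).

Lemma join_path0 p q : join_path p q zero = p zero.
Proof. by rewrite /join_path val_zero invr_ge0 ler0n mulr0. Qed.

Lemma join_path1 p q : join_path p q one = q one.
Proof.
rewrite /join_path val_one ifF; last by apply/negbTE; rewrite -ltNge; lra.
by rewrite mulr1 (_ : 2 - 1 = 1 :> R); last lra.
Qed.

Lemma cat_family_continuous (T : topologicalType) (F G : T -> I -> X) :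
  continuous (fun y : T * I => F y.1 y.2) ->
  continuous (fun y : T * I => G y.1 y.2) ->
  (forall s, F s one = G s zero) ->
  continuous (fun y : T * I => join_path (F y.1) (G y.1) y.2).
Proof.
move=> cF cG FG.
have c1 : continuous (fun y : T * I => y.1) by move=> y; exact: cvg_fst.
have c2 : continuous (fun y : T * I => y.2) by move=> y; exact: cvg_snd.
apply: pasting.
- exact: (comp_continuous c2 (@set_val_continuous R)).
- exact: (comp_continuous (pair_continuous c1 (first_half_continuous c2)) cF).
- exact: (comp_continuous (pair_continuous c1 (second_half_continuous c2)) cG).
- by move=> [s t] /= ->; rewrite divff // subrr; exact: FG.
Qed.

Lemma join_path_continuous p q : continuous p -> continuous q ->
  p one = q zero -> continuous (join_path p q).
Proof.
move=> cp cq pq.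
have c2 : continuous (fun y : I * I => y.2) by move=> y; exact: cvg_snd.
exact: (comp_continuous (@coslice_continuous I I zero)
  (@cat_family_continuous I (fun=> p) (fun=> q)
    (comp_continuous c2 cp) (comp_continuous c2 cq) (fun=> pq))).
Qed.

End Concatenation.

Section PathSystem.
Variables (R : realType) (E : topologicalType) (x : dual_complex R E).
Local Notation Gamma := (dual_complex R E).
Local Notation I := (unit_interval R).
Implicit Types (a : Gamma) (p q : I -> Gamma) (c d : cell E).

Definition path_into c q : Prop :=
  [/\ continuous q, q zero = x & cell_le (carrier (q one)) c].

(** The endpoint may move inside the closed simplex of [c].  The transition from
    [c] to a larger cell is then the identity on paths. *)
Definition endpoint_homotopy c p q : Prop := exists H : I * I -> Gamma,
  [/\ continuous H, forall t, H (zero, t) = p t, forall t, H (one, t) = q t &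
      forall s, H (s, zero) = x /\ cell_le (carrier (H (s, one))) c].

Definition endpoint_homotopic c : (I -> Gamma) -> (I -> Gamma) -> Prop :=
  clos_refl_sym_trans _ (endpoint_homotopy c).

Lemma endpoint_homotopy_slice c (H : I * I -> Gamma) s : continuous H ->
  (forall s, H (s, zero) = x /\ cell_le (carrier (H (s, one))) c) ->
  path_into c (fun t => H (s, t)).
Proof.
move=> cH Hx; have [H0 H1] := Hx s; split=> //.
exact: (comp_continuous (@coslice_continuous _ _ s) cH).
Qed.

Lemma endpoint_homotopy_path c p q : endpoint_homotopy c p q ->
  path_into c p /\ path_into c q.
Proof.
move=> [H [cH H0 H1 Hx]].
have -> : p = (fun t => H (zero, t)) by apply/funext => t; rewrite H0.
have -> : q = (fun t => H (one, t)) by apply/funext => t; rewrite H1.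
by split; exact: endpoint_homotopy_slice.
Qed.

Lemma endpoint_homotopic_le c d p q : cell_le c d ->
  endpoint_homotopic c p q -> endpoint_homotopic d p q.
Proof.
move=> cd; elim=> {p q} [p q [H [cH H0 H1 Hx]]|p|p q _|p q r _ pq _ qr].
- apply: rst_step; exists H; split=> // s; split; first exact: (Hx s).1.
  exact: cell_le_trans (Hx s).2 cd.
- exact: rst_refl.
- exact: rst_sym.
- exact: rst_trans pq qr.
Qed.

Definition slide c a p : I -> Gamma := join_path p (cell_segment c a (p one)).

Lemma segment_continuous c a z : cell_le (carrier z) c -> cell_le (carrier a) c ->
  continuous (cell_segment c a z).
Proof.
move=> zc ac; apply: (cell_segment_continuous (f := cst z)) => //.
  exact: cst_continuous.
by move=> u; exact: cvg_id.
Qed.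

Lemma slide_end c a p : cell_le (carrier (p one)) c -> cell_le (carrier a) c ->
  slide c a p one = a.
Proof. by move=> pc ac; rewrite /slide join_path1 cell_segment1. Qed.

Lemma slide_path c d a p : path_into c p -> cell_le (carrier a) c ->
  cell_le (carrier a) d -> path_into d (slide c a p).
Proof.
move=> [cp p0 pc] ac ad; split; last by rewrite slide_end.
  apply: join_path_continuous => //; first exact: segment_continuous.
  by rewrite cell_segment0.
by rewrite /slide join_path0.
Qed.

Lemma slide_le c d a p : cell_le c d -> cell_le (carrier (p one)) c ->
  cell_le (carrier a) c -> slide c a p = slide d a p.
Proof.
move=> cd pc ac; rewrite /slide; congr join_path; apply/funext => u.
exact: cell_segment_le.
Qed.

Lemma slide_const c p : cell_le (carrier (p one)) c ->
  slide c (p one) p = join_path p (fun=> p one).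
Proof.
move=> pc; rewrite /slide; congr join_path; apply/funext => u.
exact: cell_segment_id.
Qed.

(** First reparametrize to stop at the end of [p], then let the segment grow. *)
Lemma slide_homotopic c a p : path_into c p -> cell_le (carrier a) c ->
  endpoint_homotopic c p (slide c a p).
Proof.
move=> [cp p0 pc] ac; apply: (rst_trans _ _ _ (join_path p (fun=> p one))).
  apply/rst_sym/rst_step.
  exists (fun y => p (clamp ((1 - set_val y.1) * (2 * set_val y.2) +
                             set_val y.1 * set_val y.2))); split.
  - apply: (comp_continuous _ cp); apply: clamp_comp => y.
    have cf : {for y, continuous (fun y : I * I => set_val y.1 : R)}.
      by apply: (comp_continuous _ (@set_val_continuous R)) => ?; exact: cvg_fst.
    have cs : {for y, continuous (fun y : I * I => set_val y.2 : R)}.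
      by apply: (comp_continuous _ (@set_val_continuous R)) => ?; exact: cvg_snd.
    apply: cvgD; apply: cvgM => //.
      by apply: cvgB; [exact: cvg_cst|exact: cf].
    by apply: cvgM; [exact: cvg_cst|exact: cs].
  (* clamping makes [p (2 t)] stay at the end of [p] from time 1/2 on *)
  - move=> t /=; rewrite val_zero subr0 mul1r mul0r addr0 /join_path.
    case: leP => // t2; congr p; apply: val_inj => /=.
    by rewrite !min_l // ; lra.
  - by move=> t /=; rewrite val_one subrr mul0r mul1r add0r clampK.
  - move=> s /=; rewrite val_zero val_one !mulr0 addr0; split=> //.
    rewrite (_ : clamp _ = one) //; apply: val_inj => /=.
    have /andP[s0 s1] := unit_intervalP s.
    by rewrite !min_l //; lra.
apply/rst_step.
pose f (y : I * I) : I := clamp (set_val y.1 * set_val y.2).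
have cf : continuous f.
  apply: clamp_comp => y; apply: cvgM.
    by apply: (comp_continuous _ (@set_val_continuous R)) => ?; exact: cvg_fst.
  by apply: (comp_continuous _ (@set_val_continuous R)) => ?; exact: cvg_snd.
have f0 s : f (s, zero) = zero by rewrite /f /= val_zero mulr0.
exists (fun y => join_path p (fun u => cell_segment c a (p one) (f (y.1, u))) y.2).
split.
- apply: (cat_family_continuous (F := fun=> p)
    (G := fun s u => cell_segment c a (p one) (f (s, u)))).
  + by apply: (comp_continuous _ cp) => y; exact: cvg_snd.
  + have cseg := segment_continuous pc ac.
    rewrite (_ : (fun _ => _) = (fun y => cell_segment c a (p one) (f y))).
      exact: (comp_continuous cf cseg).
    by apply/funext => -[].
  + by move=> s; rewrite f0 cell_segment0.
- move=> t /=; congr (join_path _ _ t); apply/funext => u.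
  by rewrite /f /= val_zero mul0r cell_segment0.
- move=> t /=; rewrite /slide; congr (join_path _ _ t); apply/funext => u.
  by rewrite /f /= val_one mul1r clampK.
- move=> s /=; rewrite join_path0 join_path1; split=> //.
  by have [] := cell_segmentP (f (s, one)) pc ac.
Qed.

(** Prolonging every stage of the homotopy fixes the endpoint. *)
Lemma slide_homotopy d a p q : endpoint_homotopy d p q ->
  cell_le (carrier a) d -> exists H : I * I -> Gamma,
  [/\ continuous H, forall t, H (zero, t) = slide d a p t,
      forall t, H (one, t) = slide d a q t &
      forall s, H (s, zero) = x /\ H (s, one) = a].
Proof.
move=> [H [cH H0 H1 Hx]] ad.
exists (fun y => slide d a (fun t => H (y.1, t)) y.2); split.
- apply: (cat_family_continuous (F := fun s t => H (s, t))
    (G := fun s => cell_segment d a (H (s, one)))).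
  + rewrite (_ : (fun _ => _) = H) //; by apply/funext => -[].
  + apply: cell_segment_continuous => //.
    * apply: (comp_continuous _ cH); apply: pair_continuous => [y|].
        exact: cvg_fst.
      exact: cst_continuous.
    * by move=> y; exact: cvg_snd.
    * by move=> y; exact: (Hx y.1).2.
  + by move=> s; rewrite cell_segment0 //; exact: (Hx s).2.
- by move=> t /=; congr (slide _ _ _ t); apply/funext => u; exact: H0.
- by move=> t /=; congr (slide _ _ _ t); apply/funext => u; exact: H1.
- move=> s /=; split; first by rewrite /slide join_path0; exact: (Hx s).1.
  by rewrite slide_end //; exact: (Hx s).2.
Qed.

Lemma slide_endpoint_homotopic c d a p q : endpoint_homotopic d p q ->
  cell_le (carrier a) d -> cell_le (carrier a) c ->
  endpoint_homotopic c (slide d a p) (slide d a q).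
Proof.
move=> pq ad ac; elim: pq => {p q} [p q pq|p|p q _|p q r _ pq _ qr].
- have [H [cH H0 H1 Hx]] := slide_homotopy pq ad.
  by apply: rst_step; exists H; split=> // s; have [-> ->] := Hx s.
- exact: rst_refl.
- exact: rst_sym.
- exact: rst_trans pq qr.
Qed.

(** After sliding the endpoint to a point of the smaller simplex, it no longer
    moves in the larger one. *)
Lemma endpoint_homotopic_down c d p q : cell_le c d ->
  path_into c p -> path_into c q ->
  endpoint_homotopic d p q -> endpoint_homotopic c p q.
Proof.
move=> cd cp cq pq; have [_ _ pc] := cp; have [_ _ qc] := cq.
have pd := cell_le_trans pc cd.
have := slide_endpoint_homotopic pq pd pc.
rewrite -!(slide_le cd) // => spq.
apply: (rst_trans _ _ _ _ _ (slide_homotopic cp pc)).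
exact: (rst_trans _ _ _ _ _ spq (rst_sym _ _ _ _ (slide_homotopic cq pc))).
Qed.

Definition pathed_cell : Type := {z : cell E * (I -> Gamma) | path_into z.1 z.2}.

Definition pathed_le (z w : pathed_cell) : Prop :=
  cell_le (sval z).1 (sval w).1 /\
  endpoint_homotopic (sval w).1 (sval z).2 (sval w).2.

Definition mk_pathed c q (cq : path_into c q) : pathed_cell := exist _ (c, q) cq.

Lemma path_into_neq0 c q : path_into c q -> cell_verts c != fset0.
Proof.
move=> [_ _ [q0 /fsubsetP qc _]]; have /fset0Pn[v /qc vc] := q0.
by apply/fset0Pn; exists v.
Qed.

Lemma path_into_le c d q : cell_le c d -> path_into c q -> path_into d q.
Proof. by move=> cd [cq q0 qc]; split=> //; exact: cell_le_trans cd. Qed.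

Lemma pathed_refl z : pathed_le z z.
Proof.
case: z => -[c q] cq; split; last exact: rst_refl.
by apply: cell_le_refl; exact: path_into_neq0 cq.
Qed.

Lemma pathed_trans w z u : pathed_le z w -> pathed_le w u -> pathed_le z u.
Proof.
move=> [zw pq] [wu qr]; split; first exact: cell_le_trans wu.
exact: rst_trans (endpoint_homotopic_le wu pq) qr.
Qed.

Lemma pathed_up (z : pathed_cell) d : cell_le (sval z).1 d ->
  exists2 w : pathed_cell, (sval w).1 = d & pathed_le z w.
Proof.
case: z => -[c q] cq /= cd; exists (mk_pathed (path_into_le cd cq)) => //.
by split=> //; exact: rst_refl.
Qed.

Lemma pathed_down (w : pathed_cell) c : cell_le c (sval w).1 ->
  exists2 z : pathed_cell, (sval z).1 = c & pathed_le z w.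
Proof.
case: w => -[d q] dq /= cd; have [c0 _ _] := cd.
have [a ac] := cell_point R c0; have ad := cell_le_trans ac cd.
exists (mk_pathed (slide_path dq ad ac)) => //; split=> //.
exact/rst_sym/slide_homotopic.
Qed.

Lemma pathed_up_unique (z w w' : pathed_cell) : pathed_le z w ->
  pathed_le z w' -> (sval w).1 = (sval w').1 -> pathed_le w w'.
Proof.
move=> [zw pw] [zw' pw'] e; split.
  rewrite -e; apply: cell_le_refl; exact: path_into_neq0 (svalP w).
by apply: (rst_trans _ _ _ (sval z).2) => //; rewrite -e; exact: rst_sym.
Qed.

Lemma pathed_down_unique (w z z' : pathed_cell) : pathed_le z w ->
  pathed_le z' w -> (sval z).1 = (sval z').1 -> pathed_le z z'.
Proof.
move=> [zw pw] [zw' pw'] e; split.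
  rewrite -e; apply: cell_le_refl; exact: path_into_neq0 (svalP z).
apply: (endpoint_homotopic_down zw'); [rewrite -e; exact: (svalP z)|exact: (svalP z')|].
exact: rst_trans pw (rst_sym _ _ _ _ pw').
Qed.

(** The universal cover of the dual complex, as a local system. *)
Definition path_system : local_system (@cell_le E) :=
  @LocalSystem _ _ pathed_cell (fun z => (sval z).1) pathed_le pathed_refl
    pathed_trans (fun z w zw => zw.1) pathed_up pathed_down pathed_up_unique
    pathed_down_unique.

Section Prefixes.
Variable q : I -> Gamma.
Hypotheses (cq : continuous q) (q0 : q zero = x).

Definition prefix (t : I) : I -> Gamma :=
  fun u => q (clamp (set_val t * set_val u)).

Lemma prefix_continuous (T : topologicalType) (f g : T -> I) :
  continuous f -> continuous g -> continuous (fun y => prefix (f y) (g y)).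
Proof.
move=> cf cg; apply: (comp_continuous _ cq); apply: clamp_comp => y.
by apply: cvgM; [exact: (comp_continuous cf (@set_val_continuous R))|
  exact: (comp_continuous cg (@set_val_continuous R))].
Qed.

Lemma prefix_end t : prefix t one = q t.
Proof. by rewrite /prefix val_one mulr1 clampK. Qed.

Lemma prefix_start t : prefix t zero = x.
Proof. by rewrite /prefix val_zero mulr0. Qed.

Lemma prefix_path c t : cell_le (carrier (q t)) c -> path_into c (prefix t).
Proof.
split; last by rewrite prefix_end.
  by apply: prefix_continuous => [|u]; [exact: cst_continuous|exact: cvg_id].
exact: prefix_start.
Qed.

(** Near time [t] the path stays in the open star of [q t], so the prefixes can
    be prolonged by the contraction of the star to a family ending at [q t]; the
    prolongations are in turn homotopic to the prefixes. *)
Lemma prefix_near t : \forall u \near t, cell_le (carrier (q t)) (carrier (q u)) /\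
  endpoint_homotopic (carrier (q u)) (prefix t) (prefix u).
Proof.
have /unit_interval_ball[e e0 qe] :
    \forall u \near t, cell_le (carrier (q t)) (carrier (q u)).
  exact: (cq (carrier_near (q t))).
have : \forall u \near t, set_val u \in `]set_val t - e, set_val t + e[.
  by apply: near_val_itv; apply: near_in_itvoo; rewrite in_itv /=; apply/andP; split; lra.
apply: filterS => u; rewrite in_itv /= => /andP[u1 u2].
(* [m] runs from [t] to [u] without leaving the ball of radius [e] *)
pose m (s : I) : I := clamp ((set_val u - set_val t) * set_val s + set_val t).
have m0 : m zero = t by rewrite /m val_zero mulr0 add0r clampK.
have m1 : m one = u by rewrite /m val_one mulr1 subrK clampK.
have cm : continuous m.
  by apply: clamp_comp; apply: affine_comp => s; exact: cvg_id.
have c1 : continuous (fun y : I * I => y.1) by move=> y; exact: cvg_fst.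
have c2 : continuous (fun y : I * I => y.2) by move=> y; exact: cvg_snd.
have self z : cell_le (carrier z) (carrier z) by exact: carrier_refl.
set a := q t.
have star s : cell_le (carrier a) (carrier (q (m s))).
  apply: qe; rewrite addrK; have /andP[s0 s1] := unit_intervalP s.
  rewrite normrM (ger0_norm s0).
  apply: (@le_lt_trans _ _ `|set_val u - set_val t|); first by rewrite ler_piMr.
  by rewrite ltr_norml; apply/andP; split; lra.
have tu : cell_le (carrier a) (carrier (q u)) by rewrite -m1; exact: star.
split=> //.
have steps : endpoint_homotopy (carrier a) (slide (carrier a) a (prefix t))
    (slide (carrier (q u)) a (prefix u)).
  exists (fun y => join_path (prefix (m y.1)) (cone a (q (m y.1))) y.2); split.
  - apply: (cat_family_continuous (F := fun s => prefix (m s))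
      (G := fun s => cone a (q (m s)))).
    + exact: (prefix_continuous (comp_continuous c1 cm) c2).
    + apply: cone_continuous => //.
      exact: (comp_continuous (comp_continuous c1 cm) cq).
    + by move=> s; rewrite prefix_end /cone cell_segment0.
  - by move=> r /=; rewrite m0 /slide prefix_end.
  - by move=> r /=; rewrite m1 /slide prefix_end.
  - by move=> s /=; rewrite join_path0 join_path1 prefix_start /cone cell_segment1.
have pt := prefix_path (carrier_refl (q t)).
apply: (rst_trans _ _ _ (slide (carrier a) a (prefix t))).
  by apply: (endpoint_homotopic_le tu); exact: slide_homotopic.
apply: (rst_trans _ _ _ (slide (carrier (q u)) a (prefix u))).
  by apply: (endpoint_homotopic_le tu); exact: rst_step.
apply: rst_sym; apply: slide_homotopic => //.
exact: prefix_path (carrier_refl (q u)).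
Qed.

(** The prefixes of [q] lift [q] to the local system of paths. *)
Lemma path_transport (z w : path_system) : ls_pos z = carrier x ->
  (sval z).2 = (fun=> x) -> ls_pos w = carrier (q one) -> (sval w).2 = q ->
  transport (fun t => carrier (q t)) z w.
Proof.
move=> zx ze wq we.
exists (fun t => mk_pathed (prefix_path (carrier_refl (q t)))); split.
- split=> // t; apply: filterS (prefix_near t) => u [tu pu]; exact: (conj tu pu).
- split=> /=; first by rewrite [(sval z).1]zx q0; rewrite -q0; exact: carrier_refl.
  rewrite ze (_ : prefix zero = fun=> x); first exact: rst_refl.
  by apply/funext => u; rewrite /prefix val_zero mul0r.
- split=> /=; first by rewrite [(sval w).1]wq; exact: carrier_refl.
  rewrite we (_ : prefix one = q); first exact: rst_refl.
  by apply/funext => u; rewrite /prefix val_one mul1r clampK.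
Qed.

End Prefixes.
End PathSystem.

(** * Transport and homotopy classes of paths *)

Lemma transport_const (R : realType) (P : Type) (le : P -> P -> Prop)
    (L : local_system le) (z : L) c : le c (ls_pos z) ->
  transport (fun _ : unit_interval R => c) z z.
Proof.
move=> cz; have [w wc wz] := ls_down cz; exists (fun=> w); split=> //.
by split=> // t; apply: near_all => u; exact: ls_refl.
Qed.

Section PathTransport.
Variables (R : realType) (E : topologicalType).
Local Notation I := (unit_interval R).

Lemma carrier_path_mono (q : I -> dual_complex R E) : continuous q ->
  germ_mono (@cell_le E) (fun t => carrier (q t)).
Proof. by move=> cq; exact: (germ_mono_comp cq (@carrier_near R E)). Qed.

Variables (L : local_system (@cell_le E)) (x : dual_complex R E).

Lemma transport_endpoint_homotopic c (p q : I -> dual_complex R E) (z z' : L) :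
  endpoint_homotopic x c p q -> ls_pos z' = c ->
  transport (fun t => carrier (p t)) z z' <->
  transport (fun t => carrier (q t)) z z'.
Proof.
move=> pq z'c.
have half H : continuous H ->
    (forall s, H (s, zero) = x /\ cell_le (carrier (H (s, one))) c) ->
    transport (fun t : I => carrier (H (zero : I, t))) z z' ->
    transport (fun t => carrier (H (one, t))) z z'.
  move=> cH Hx; pose k (y : I * I) := carrier (H (y.2, y.1)).
  apply: (@transport_homotopy _ _ L R k z z' (carrier x)).
  - apply: (germ_mono_comp (f := @carrier R E) _ (@carrier_near R E)).
    apply: (comp_continuous _ cH).
    by apply: pair_continuous => y; [exact: cvg_snd|exact: cvg_fst].
  - by move=> s; rewrite /k /= (Hx s).1.
  - by move=> s; rewrite /k /= z'c; exact: (Hx s).2.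
elim: pq => {p q} [p q [H [cH H0 H1 Hx]]|p|p q _ [pq qp]|p q r _ [pq qp] _ [qr rq]].
- have -> : p = (fun t => H (zero, t)) by apply/funext => t; rewrite H0.
  have -> : q = (fun t => H (one, t)) by apply/funext => t; rewrite H1.
  split; first exact: half.
  have := half (fun y => H (clamp (1 - set_val y.1), y.2)).
  rewrite /= val_zero val_one subr0 subrr; apply.
    apply: (comp_continuous _ cH); apply: pair_continuous => [|y].
      by apply: (comp_continuous _ (@one_minus_continuous R)) => y; exact: cvg_fst.
    exact: cvg_snd.
  by move=> s; exact: Hx.
- by [].
- by split.
- by split=> [/pq/qr|/rq/qp].
Qed.

End PathTransport.

Section FiberTransport.
Variables (E : topologicalType) (lfE : locally_finite_irreducible E).
Variable C : covering E.

Lemma top_leaf_inj (y z : C) : ls_le (top_leaf lfE y) (top_leaf lfE z) ->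
  cov_proj y = cov_proj z -> y = z.
Proof.
move=> [_ yz] e; apply: (same_leaf_unique (top_cell_verts lfE (cov_proj y)) _ yz e).
by apply: same_leaf_refl; exact: top_cell_mem.
Qed.

Lemma top_leaf_exists (w : leaf_system C) (t : E) : ls_pos w = top_cell t ->
  exists2 y, cov_proj y = t & ls_le w (top_leaf lfE y).
Proof.
case: w => -[c y] [c0 cy] /= cE; have ct : cell_set c t.
  by rewrite cE; exact: top_cell_mem.
have [z zt yz] := same_leaf_exists c0 cy ct; exists z => //.
by split=> //=; rewrite zt -cE; exact: cell_le_refl.
Qed.

End FiberTransport.

Section LoopClasses.
Variables (R : realType) (E : topologicalType) (x : dual_complex R E).
Local Notation I := (unit_interval R).

Lemma loop_path_into (g : loop R x) : path_into x (carrier x) g.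
Proof.
split; first exact: (@cts_fun _ _ g).
  exact: (@path_zero I _ _ _ g).
by rewrite (@path_one I _ _ _ g); exact: carrier_refl.
Qed.

Definition loop_elt (g : loop R x) : path_system x := mk_pathed (loop_path_into g).

Lemma const_path_into : path_into x (carrier x) (fun=> x).
Proof. by split=> //; [exact: cst_continuous|exact: carrier_refl]. Qed.

Definition const_elt : path_system x := mk_pathed const_path_into.

Lemma path_loop c q : path_into x c q -> q one = x -> exists g : loop R x, g = q :> (I -> _).
Proof. by move=> [cq q0 _] q1; exists (mk_path cq q0 q1). Qed.

(** Sliding the endpoint back to [x] turns the free homotopies of endpoints into
    homotopies of loops. *)
Lemma homotopic_slide c p q : cell_le (carrier x) c ->
  endpoint_homotopic x c p q ->
  (path_into x c p <-> path_into x c q) /\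
  (path_into x c p -> forall g h : loop R x,
    g = slide c x p :> (I -> _) -> h = slide c x q :> (I -> _) -> homotopic g h).
Proof.
move=> xc; elim=> {p q} [p q pq|p|p q _ [pq H]|p q r _ [pq Hpq] _ [qr Hqr]].
- have [pp pq'] := endpoint_homotopy_path pq; split=> // _ g h gp hq.
  have [H [cH H0 H1 Hx]] := slide_homotopy pq xc.
  by exists H; split=> // t; rewrite ?H0 ?H1 ?gp ?hq.
- split=> // _ g h gp hp; have -> : g = h by apply/path_eqP => t; rewrite gp hp.
  exact: homotopic_refl.
- split; first by split=> /pq.
  by move=> qp g h gq hp; apply/homotopic_sym/H => //; exact/pq.
- split; first by split=> [/pq/qr|/qr/pq].
  move=> pp g h gp hr; have pq' := pq.1 pp; have [_ _ qc] := pq'.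
  have [|k kq] := path_loop (slide_path pq' xc xc); first exact: slide_end.
  exact: homotopic_trans (Hpq pp _ _ gp kq) (Hqr pq' _ _ kq hr).
Qed.

Lemma loop_slide (g : loop R x) c : cell_le (carrier x) c ->
  concat g (const_loop R x) = slide c x g :> (I -> _).
Proof.
move=> xc; have g1 : g one = x := @path_one I _ _ _ g.
have := @slide_const R E c g; rewrite g1 => ->; first by [].
exact: xc.
Qed.

Lemma loop_elt_homotopic (g h : loop R x) :
  ls_le (loop_elt g) (loop_elt h) -> homotopic g h.
Proof.
move=> [_ gh]; have xx := carrier_refl x.
have [_ H] := homotopic_slide xx gh.
apply: homotopic_trans (concat_const h).
apply: homotopic_trans (homotopic_sym (concat_const g)) _.
exact: (H (loop_path_into g)) (loop_slide g xx) (loop_slide h xx).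
Qed.

Lemma homotopic_loop_elt (g h : loop R x) : homotopic g h ->
  ls_le (loop_elt g) (loop_elt h).
Proof.
move=> [H [cH H0 H1 Hx]]; split; first exact: carrier_refl.
apply: rst_step; exists H; split=> // t; have [-> ->] := Hx t.
by split=> //; exact: carrier_refl.
Qed.

Lemma loop_below (z : path_system x) : cell_le (carrier x) (ls_pos z) ->
  exists g : loop R x, ls_le (loop_elt g) z.
Proof.
case: z => -[c q] /= cq xc; have [_ _ qc] := cq.
have [|g gq] := path_loop (slide_path cq xc xc); first exact: slide_end.
exists g; split=> //=; rewrite gq; exact/rst_sym/slide_homotopic.
Qed.

Lemma cat_loop_into (g : loop R x) c q : path_into x c q -> path_into x c (join_path g q).
Proof.
move=> [cq q0 qc]; split; last by rewrite join_path1.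
  apply: join_path_continuous => //; first exact: (@cts_fun _ _ g).
  by rewrite q0; exact: (@path_one I _ _ _ g).
by rewrite join_path0; exact: (@path_zero I _ _ _ g).
Qed.

Lemma cat_loop_homotopic (g : loop R x) c p q :
  endpoint_homotopic x c p q -> endpoint_homotopic x c (join_path g p) (join_path g q).
Proof.
elim=> {p q} [p q [H [cH H0 H1 Hx]]|p|p q _|p q r _ pq _ qr].
- apply: rst_step; exists (fun y => join_path g (fun t => H (y.1, t)) y.2); split.
  + apply: (cat_family_continuous (F := fun=> g) (G := fun s t => H (s, t))).
    * by apply: (comp_continuous _ (@cts_fun _ _ g)) => y; exact: cvg_snd.
    * rewrite (_ : (fun _ => _) = H) //; by apply/funext => -[].
    * by move=> s; rewrite (Hx s).1; exact: (@path_one I _ _ _ g).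
  + by move=> t /=; congr (join_path _ _ t); apply/funext => u.
  + by move=> t /=; congr (join_path _ _ t); apply/funext => u.
  + move=> s; rewrite /= join_path0 join_path1; split; last exact: (Hx s).2.
    exact: (@path_zero I _ _ _ g).
- exact: rst_refl.
- exact: rst_sym.
- exact: rst_trans pq qr.
Qed.

(** The action of loops on [path_system], which becomes the group of deck
    transformations of the covering. *)
Definition cat_loop (g : loop R x) (z : path_system x) : path_system x :=
  mk_pathed (cat_loop_into g (svalP z)).

Lemma cat_loop_le g z w : ls_le z w -> ls_le (cat_loop g z) (cat_loop g w).
Proof. by move=> [zw pq]; split=> //; exact: cat_loop_homotopic. Qed.

Lemma cat_loop_elt g h : cat_loop g (loop_elt h) = loop_elt (concat g h).
Proof. exact: eq_sig_hprop. Qed.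

Lemma cat_loop_const g : ls_le (loop_elt g) (cat_loop g const_elt).
Proof.
split=> /=; first exact: carrier_refl.
have xx := carrier_refl x; have g1 : g one = x := @path_one I _ _ _ g.
have -> : join_path g (fun=> x) = slide (carrier x) x g by rewrite -loop_slide.
exact: slide_homotopic (loop_path_into g) xx.
Qed.

End LoopClasses.

(** * Monodromy *)

Section Monodromy.
Variables (R : realType) (E : topologicalType).
Hypothesis lfE : locally_finite_irreducible E.
Variables (s : E) (x : dual_complex R E).
Hypothesis sx : cell_le (carrier x) (top_cell s).
Local Notation I := (unit_interval R).
Local Notation U := (etale_cover (path_system x) lfE).

Lemma base_point_subproof :
  exists u : fiber s U, germ_over (const_elt x) (sval u).
Proof.
have [u us xu] := @germ_over_exists _ (path_system x) (const_elt x) s sx.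
by exists (exist (fun y : U => cov_proj y = s) u us).
Qed.

Definition base_point : fiber s U := projT1 (cid base_point_subproof).

Lemma base_pointP : germ_over (const_elt x) (sval base_point).
Proof. exact: projT2 (cid base_point_subproof). Qed.

Lemma fiber_loop (u : fiber s U) : exists g : loop R x,
  germ_over (loop_elt g) (sval u).
Proof.
have [z uz] := etale_germ_exists (sval u : etale_space _).
have us : etale_proj (sval u : etale_space (path_system x)) = s := svalP u.
have xz : cell_le (carrier x) (ls_pos z) by rewrite (etale_germ_pos uz) us.
by have [g gz] := loop_below xz; exists g, z.
Qed.

Lemma germ_over_loop (g h : loop R x) (u : etale_space (path_system x)) :
  germ_over (loop_elt g) u -> germ_over (loop_elt h) u -> homotopic g h.
Proof.
move=> [z uz gz] [w uw hw]; apply: loop_elt_homotopic.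
exact: (ls_down_unique (ls_trans gz (etale_germ_le uz uw)) hw erefl).
Qed.

(** The fibre over [s] of the universal covering consists of loop classes; the
    value at the constant path describes the automorphism. *)
Definition monodromy (a : pi1cs s) : pi1 R x :=
  loop_class (projT1 (cid (fiber_loop (a U base_point)))).

Lemma monodromyP (a : pi1cs s) (g : loop R x) :
  monodromy a = loop_class g <-> germ_over (loop_elt g) (sval (a U base_point)).
Proof.
rewrite /monodromy; case: cid => h /= ha; split=> [/loop_classP hg|ga].
  by apply: germ_over_le ha; apply: homotopic_loop_elt; exact: homotopic_sym.
exact/loop_classP/(germ_over_loop ha ga).
Qed.

Lemma etale_fiber_eq (z : path_system x) (u v : fiber s U) :
  germ_over z (sval u) -> germ_over z (sval v) -> u = v.
Proof.
move=> zu zv; apply: fiber_inj; apply: (germ_over_inj zu zv).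
exact: etrans (svalP u) (esym (svalP v)).
Qed.

(** Prefixing a loop is an automorphism of the covering, and automorphisms of
    the fibre functor commute with it.  With [h] and [g] the classes of [b] and
    [a], one gets [a (b 1) = a (h . 1) = h . a 1 = h . g]. *)
Lemma monodromy_mul (a b : pi1cs s) :
  monodromy (cs_mul a b) = (monodromy b * monodromy a)%g.
Proof.
have [g gE] : exists g, monodromy a = loop_class g.
  by exists (repr (monodromy a)); rewrite loop_class_repr.
have [h hE] : exists h, monodromy b = loop_class h.
  by exists (repr (monodromy b)); rewrite loop_class_repr.
have /monodromyP ga := gE; have /monodromyP hb := hE.
have -> : (monodromy b * monodromy a)%g = loop_class (concat h g).
  by rewrite gE hE; exact: pi1_mulE.
apply/monodromyP => /=.
have [f fP] := etale_map lfE (m := cat_loop h) (fun z => erefl)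
  (fun z w zw => cat_loop_le h zw).
have fb : fiber_map f base_point = b U base_point.
  apply: (etale_fiber_eq (z := loop_elt h)) => //=.
  apply: germ_over_le (cat_loop_const h) _; exact: (fP _ _ base_pointP).
rewrite -fb cs_nat /=; rewrite -cat_loop_elt; exact: fP.
Qed.

Section Injective.
Variables (C : covering E) (y : fiber s C).

Let track (z : path_system x) (w : leaf_system C) : Prop :=
  transport (fun t => carrier ((sval z).2 t)) (top_leaf lfE (sval y)) w.

Let track_le (z z' : path_system x) (w : leaf_system C) :
  ls_le z z' -> ls_pos w = ls_pos z' -> track z w <-> track z' w.
Proof. by move=> [_ zz'] wz; exact: transport_endpoint_homotopic zz' wz. Qed.

(** Universality of the covering: send the class of a path to the transport of
    [y] along it. *)
Lemma etale_hom_exists : exists f : cov_hom U C, fiber_map f base_point = y.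
Proof.
have ys : ls_pos (top_leaf lfE (sval y)) = top_cell s by rewrite /= (svalP y).
have /choice[h hP] (u : etale_space (path_system x)) : exists y' : C,
    cov_proj y' = etale_proj u /\
    forall z, etale_germ u z -> track z (top_leaf lfE y').
  have [z uz] := etale_germ_exists u; have [cq q0 qc] := svalP z.
  have [|||w wu zw] := @transport_exists _ _ (leaf_system C) R
    (fun t => carrier ((sval z).2 t)) (top_leaf lfE (sval y)) (top_cell (etale_proj u)).
  - exact: carrier_path_mono.
  - by rewrite q0 ys.
  - by rewrite -(etale_germ_pos uz).
  have [y' y'u wy'] := top_leaf_exists lfE wu; exists y'; split=> // z' uz'.
  have zy' : track z (top_leaf lfE y').
    exact: transport_le zw (ls_refl _) wy'.
  apply/(track_le (etale_germ_le uz uz')) => //.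
  by rewrite (etale_germ_pos uz') -y'u.
have hle u v : etale_le v u ->
    ls_le (top_leaf lfE (h v)) (top_leaf lfE (h u)).
  move=> vu; have [z [w [vz uw zw]]] := vu.
  have hvu : cell_le (ls_pos (top_leaf lfE (h v))) (top_cell (etale_proj u)).
    by rewrite /= (hP v).1; exact: etale_le_top.
  have [t tu vt] := ls_up hvu.
  have wt : track w t.
    apply/(track_le zw); first by rewrite tu (etale_germ_pos uw).
    exact: transport_le ((hP v).2 z vz) (ls_refl _) vt.
  apply: ls_trans vt _; apply: (transport_unique wt ((hP u).2 w uw)).
  by rewrite tu /= (hP u).1; apply: cell_le_refl; exact: top_cell_verts.
have [f fh] := etale_to_covering (fun u => (hP u).1) hle.
exists f; apply: fiber_inj; rewrite /= fh.
have [z uz xz] := base_pointP.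
have bs : etale_proj (sval base_point : etale_space (path_system x)) = s.
  exact: svalP base_point.
have zpos : ls_pos z = top_cell s by rewrite (etale_germ_pos uz) bs.
have hs : cov_proj (h (sval base_point)) = s by rewrite (hP _).1 bs.
have zy : track z (top_leaf lfE (sval y)).
  apply/(track_le xz); first by rewrite ys zpos.
  have xy : cell_le (carrier x) (ls_pos (top_leaf lfE (sval y))) by rewrite ys.
  exact: (transport_const R xy).
apply: (@top_leaf_inj _ lfE); last by rewrite hs (svalP y).
apply: (transport_unique ((hP _).2 z uz) zy).
by rewrite ys /= hs; apply: cell_le_refl; exact: top_cell_verts.
Qed.

End Injective.

(** By naturality, the value at the base point determines all others. *)
Lemma monodromy_inj : injective monodromy.
Proof.
move=> a b ab; apply: pi1csP => C y.
have [f <-] := etale_hom_exists y; rewrite !cs_nat; congr fiber_map.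
have bE : monodromy b = loop_class (repr (monodromy a)).
  by rewrite loop_class_repr.
have aE : monodromy a = loop_class (repr (monodromy a)).
  by rewrite loop_class_repr.
move/monodromyP: aE => aE; move/monodromyP: bE => bE.
exact: etale_fiber_eq aE bE.
Qed.

Section Surjective.

(** The fibre over [s] is identified with the elements over [top_cell s], a cell
    whose closed simplex contains both ends of the loop. *)
Definition fiber_transport (g : loop R x) (C : covering E) (y y' : fiber s C) : Prop :=
  transport (fun t => carrier (g t)) (top_leaf lfE (sval y)) (top_leaf lfE (sval y')).

Let top_pos (C : covering E) (y : fiber s C) :
  ls_pos (top_leaf lfE (sval y)) = top_cell s.
Proof. by rewrite /= (svalP y). Qed.

Lemma fiber_transport_exists g (C : covering E) (y : fiber s C) :
  exists y', fiber_transport g y y'.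
Proof.
have [cg g0 g1] := loop_path_into g.
have [|||w ws gw] := @transport_exists _ _ (leaf_system C) R
  (fun t => carrier (g t)) (top_leaf lfE (sval y)) (top_cell s).
- exact: carrier_path_mono.
- by rewrite g0 top_pos.
- exact: cell_le_trans g1 sx.
have [y' y's wy'] := top_leaf_exists lfE ws.
exists (exist (fun y : C => cov_proj y = s) y' y's).
exact: transport_le gw (ls_refl _) wy'.
Qed.

Lemma fiber_transport_unique g (C : covering E) (y y1 y2 : fiber s C) :
  fiber_transport g y y1 -> fiber_transport g y y2 -> y1 = y2.
Proof.
move=> gy1 gy2; apply: fiber_inj; apply: (@top_leaf_inj _ lfE).
  apply: (transport_unique gy1 gy2); rewrite !top_pos.
  by apply: cell_le_refl; exact: top_cell_verts.
by rewrite (svalP y1) (svalP y2).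
Qed.

Lemma fiber_transport_reverse g (C : covering E) (y y' : fiber s C) :
  fiber_transport g y y' -> fiber_transport (reverse g) y' y.
Proof. exact: transport_reverse. Qed.

Definition loop_act g (C : covering E) (y : fiber s C) : fiber s C :=
  projT1 (cid (fiber_transport_exists g y)).

Lemma loop_actP g (C : covering E) (y : fiber s C) :
  fiber_transport g y (loop_act g y).
Proof. exact: projT2 (cid (fiber_transport_exists g y)). Qed.

Lemma reverseK (g : loop R x) : reverse (reverse g) = g.
Proof.
apply/path_eqP => t; rewrite [LHS]reverseE [LHS]reverseE.
have /andP[t0 t1] := unit_intervalP t.
by rewrite val_clamp ?opprB; [rewrite addrC subrK clampK|apply/andP; split; lra].
Qed.

Lemma loop_act_bij g (C : covering E) : bijective (@loop_act g C).
Proof.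
exists (@loop_act (reverse g) C) => y.
  apply: (fiber_transport_unique (loop_actP (reverse g) (loop_act g y))).
  exact/fiber_transport_reverse/loop_actP.
apply: (fiber_transport_unique (loop_actP g (loop_act (reverse g) y))).
by have := fiber_transport_reverse (loop_actP (reverse g) y); rewrite reverseK.
Qed.

Lemma leaf_map (C D : covering E) (f : cov_hom C D) :
  exists h : leaf_system C -> leaf_system D,
  [/\ forall z, ls_pos (h z) = ls_pos z,
      forall z w, ls_le z w -> ls_le (h z) (h w) &
      forall y : C, ls_le (h (top_leaf lfE y)) (top_leaf lfE (f y))].
Proof.
have fc (z : leaf_system C) : cell_set (sval z).1 (cov_proj (f (sval z).2)).
  by rewrite cov_fun_proj; have [] := svalP z.
have z0 (z : leaf_system C) : cell_verts (sval z).1 != fset0.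
  by have [] := svalP z.
exists (fun z => mk_leaf (z0 z) (fc z)); split=> // [z w [zw yy']|y].
  by split=> //; exact: same_leaf_image.
split=> /=; first by rewrite cov_fun_proj; apply: cell_le_refl; exact: top_cell_verts.
by apply: same_leaf_refl; rewrite cov_fun_proj; exact: top_cell_mem.
Qed.

Lemma loop_act_nat g (C D : covering E) (f : cov_hom C D) (y : fiber s C) :
  loop_act g (fiber_map f y) = fiber_map f (loop_act g y).
Proof.
apply: (fiber_transport_unique (loop_actP g (fiber_map f y))).
have [h [hpos hle htop]] := leaf_map f.
exact: (transport_le (transport_map hpos hle (loop_actP g y))).
Qed.

Definition loop_aut g : pi1cs s := Pi1cs (loop_act_bij g) (loop_act_nat g).

(** Transport in the universal covering is transport in [path_system], where the
    constant path goes to [g]. *)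
Lemma monodromy_loop_aut g : monodromy (loop_aut g) = loop_class g.
Proof.
apply/monodromyP => /=.
have [cg g0 g1] := loop_path_into g.
have [h [hpos hle hover]] := germ_leaf_map (path_system x) lfE.
have [v vs gv] := @germ_over_exists _ (path_system x) (loop_elt g) s sx.
pose w : fiber s U := exist (fun y : U => cov_proj y = s) v vs.
suff -> : loop_act g base_point = w by [].
apply: (fiber_transport_unique (loop_actP g base_point)).
have g1' : carrier x = carrier (g one) by rewrite (@path_one I _ _ _ g).
have gt : transport (fun t => carrier (g t)) (const_elt x) (loop_elt g).
  exact: (path_transport cg g0).
have below z (u : fiber s U) : ls_pos z = carrier x -> germ_over z (sval u) ->
    ls_le (h z) (top_leaf lfE (sval u)).
  move=> zx zu; have x0 := carrier_neq0 x.
  have cu : cell_set (carrier x) (cov_proj (sval u)).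
    by rewrite (svalP u); exact: cell_le_top_mem.
  apply: (ls_trans (z2 := mk_leaf x0 cu : leaf_system U)).
    by apply: hover => //=; rewrite zx.
  split=> /=; first by rewrite (svalP u : etale_proj _ = s).
  exact: same_leaf_refl.
apply: (transport_le (transport_map hpos hle gt)).
  by apply: below => //; exact: base_pointP.
exact: below.
Qed.

End Surjective.

Lemma monodromy_bij : bijective monodromy.
Proof.
exists (fun a => loop_aut (repr a)) => a; last first.
  by rewrite monodromy_loop_aut loop_class_repr.
by apply: monodromy_inj; rewrite monodromy_loop_aut loop_class_repr.
Qed.

End Monodromy.

(** * Change of base point *)

Section GroupLaws.
Variables (S : topologicalType) (s : S).
Implicit Types a b : pi1cs s.

Lemma cs_inv_unique a b : cs_mul b a = cs_one s -> b = cs_inv a.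
Proof. by move=> ba; rewrite -[LHS]cs_mulg1 -(cs_mulgV a) cs_mulA ba cs_mul1g. Qed.

Lemma cs_invK : involutive (@cs_inv S s).
Proof. by move=> a; apply/esym/cs_inv_unique/cs_mulgV. Qed.

Lemma cs_inv_mul a b : cs_inv (cs_mul a b) = cs_mul (cs_inv b) (cs_inv a).
Proof.
apply/esym/cs_inv_unique.
by rewrite cs_mulA -(cs_mulA (cs_inv b)) cs_mulVg cs_mulg1 cs_mulVg.
Qed.

End GroupLaws.

Section FiberIso.
Variable E : topologicalType.
Implicit Types s t : E.

Definition fiber_natural s t (T : forall C : covering E, fiber s C -> fiber t C) : Prop :=
  forall (C D : covering E) (h : cov_hom C D) y, T D (fiber_map h y) = fiber_map h (T C y).

Definition fiber_iso s t : Prop :=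
  exists (T : forall C : covering E, fiber s C -> fiber t C)
    (T' : forall C : covering E, fiber t C -> fiber s C),
  [/\ forall C, cancel (T C) (T' C), forall C, cancel (T' C) (T C),
      fiber_natural T & fiber_natural T'].

Lemma fiber_iso_refl s : fiber_iso s s.
Proof. by exists (fun C y => y), (fun C y => y). Qed.

Lemma fiber_iso_sym s t : fiber_iso s t -> fiber_iso t s.
Proof. by move=> [T [T' [TK T'K nT nT']]]; exists T', T. Qed.

Lemma fiber_iso_trans t s r : fiber_iso s t -> fiber_iso t r -> fiber_iso s r.
Proof.
move=> [T [T' [TK T'K nT nT']]] [V [V' [VK V'K nV nV']]].
exists (fun C y => V C (T C y)), (fun C y => T' C (V' C y)).
split=> [C y|C y|C D h y|C D h y].
- by rewrite VK TK.
- by rewrite T'K V'K.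
- by rewrite nT nV.
- by rewrite nV' nT'.
Qed.

Lemma fiber_iso_pi1cs s t : fiber_iso s t ->
  exists Phi : pi1cs s -> pi1cs t, bijective Phi /\
    forall a b, Phi (cs_mul a b) = cs_mul (Phi a) (Phi b).
Proof.
have conj r r' (T : forall C : covering E, fiber r C -> fiber r' C)
    (T' : forall C : covering E, fiber r' C -> fiber r C) :
    (forall C, cancel (T C) (T' C)) -> (forall C, cancel (T' C) (T C)) ->
    fiber_natural T -> fiber_natural T' ->
    exists Phi : pi1cs r -> pi1cs r', forall a C y, Phi a C y = T C (a C (T' C y)).
  move=> TK T'K nT nT'.
  have bij (a : pi1cs r) C : bijective (fun y => T C (a C (T' C y))).
    apply: (bij_comp (f := T C) (h := fun y => a C (T' C y))).
      by exists (T' C).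
    apply: (bij_comp (f := a C) (h := T' C)); first exact: cs_bij.
    by exists (T C).
  have nat (a : pi1cs r) (C D : covering E) (h : cov_hom C D) y :
      T D (a D (T' D (fiber_map h y))) = fiber_map h (T C (a C (T' C y))).
    by rewrite nT' cs_nat nT.
  by exists (fun a => Pi1cs (bij a) (nat a)).
move=> [T [T' [TK T'K nT nT']]].
have [Phi PhiE] := conj _ _ _ _ TK T'K nT nT'.
have [Psi PsiE] := conj _ _ _ _ T'K TK nT' nT.
exists Phi; split; last first.
  by move=> a b; apply: pi1csP => C y /=; rewrite !PhiE TK.
by exists Psi => a; apply: pi1csP => C y; rewrite !(PsiE, PhiE) ?TK ?T'K.
Qed.

(** Two points of one cell: follow the leaves over it. *)
Lemma fiber_iso_cell (c : cell E) s t : cell_verts c != fset0 ->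
  cell_set c s -> cell_set c t -> fiber_iso s t.
Proof.
move=> c0; have follow r r' : cell_set c r -> cell_set c r' ->
    exists T : forall C : covering E, fiber r C -> fiber r' C,
    forall C y, same_leaf c (sval y) (sval (T C y)).
  move=> cr cr'; have ex C (y : fiber r C) : exists y' : fiber r' C,
      same_leaf c (sval y) (sval y').
    have cy : cell_set c (cov_proj (sval y)) by rewrite (svalP y).
    have [z zr yz] := same_leaf_exists c0 cy cr'.
    by exists (exist _ z zr).
  by exists (fun C y => projT1 (cid (ex C y))) => C y; exact: projT2 (cid (ex C y)).
move=> cs ct; have [T TP] := follow _ _ cs ct; have [T' T'P] := follow _ _ ct cs.
have uniq r (C : covering E) (y : C) (y1 y2 : fiber r C) :
    same_leaf c y (sval y1) -> same_leaf c y (sval y2) -> y1 = y2.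
  move=> l1 l2; apply: fiber_inj; apply: (same_leaf_unique c0 l1 l2).
  by rewrite (svalP y1) (svalP y2).
exists T, T'; split=> [C y|C y|C D h y|C D h y].
- by apply: (uniq _ _ _ _ _ (T'P C (T C y))); apply: same_leaf_sym; exact: TP.
- by apply: (uniq _ _ _ _ _ (TP C (T' C y))); apply: same_leaf_sym; exact: T'P.
- by apply: (uniq _ _ _ _ _ (TP D (fiber_map h y))); exact: same_leaf_image.
- by apply: (uniq _ _ _ _ _ (T'P D (fiber_map h y))); exact: same_leaf_image.
Qed.

(** Nearby points share a cell, so the points whose fibre functor is isomorphic
    to that at [s] form an open and closed set. *)
Lemma fiber_iso_connected s t : locally_finite_irreducible E ->
  connected [set: E] -> fiber_iso s t.
Proof.
move=> lfE cE; apply: (connected_locally_constant cE (Q := fiber_iso s) _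
  (s := s)) => //; last exact: fiber_iso_refl.
move=> r _; apply: filterS (top_cell_near lfE r) => r' r'r _.
have rr' : fiber_iso r r'.
  apply: (@fiber_iso_cell (top_cell r')); first exact: top_cell_verts.
    exact: cell_le_top_mem.
  exact: top_cell_mem.
split=> sr; first exact: fiber_iso_trans sr rr'.
exact: fiber_iso_trans sr (fiber_iso_sym rr').
Qed.

End FiberIso.

Lemma incident_carrier (R : realType) (E : topologicalType) (s : E)
    (x : dual_complex R E) : locally_finite_irreducible E ->
  incident s x -> cell_le (carrier x) (top_cell s).
Proof.
move=> lfE [y ys ->]; have xy := carrier_le_dual_point y.
apply: (cell_le_trans xy); apply: cell_le_top => //.
have [/fset0Pn[v vx] /fsubsetP/(_ _ vx) vy _] := xy.
by apply/fset0Pn; exists v.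
Qed.

(** Only for incident [s] and [x] is there a canonical isomorphism; in the other
    case one conjugates with a chosen isomorphism between fibre functors. *)
Lemma pi1cs_iso_exists (R : realType) (E : topologicalType) (s : E)
    (x : dual_complex R E) (lfE : locally_finite_irreducible E) :
  connected [set: E] -> exists gamma : pi1cs s -> pi1 R x,
  [/\ bijective gamma,
      forall a b, gamma (cs_mul a b) = (gamma a * gamma b)%g &
      forall (sx : cell_le (carrier x) (top_cell s)) a,
        gamma a = monodromy lfE sx (cs_inv a)].
Proof.
move=> cE.
have inv_bij r : bijective (@cs_inv E r) by exists (@cs_inv E r); exact: cs_invK.
have [sx|nsx] := pselect (cell_le (carrier x) (top_cell s)).
  exists (fun a => monodromy lfE sx (cs_inv a)); split.
  - exact: bij_comp (monodromy_bij lfE sx) (inv_bij s).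
  - by move=> a b; rewrite cs_inv_mul monodromy_mul.
  - by move=> sx' a; rewrite (Prop_irrelevance sx sx').
(* any [t] in the set of the carrier of [x] is incident to [x] *)
have [t xt] := cell_nonempty (carrier x).
have tx : cell_le (carrier x) (top_cell t).
  by apply: cell_le_top => //; exact: carrier_neq0.
have [Phi [bPhi mPhi]] := fiber_iso_pi1cs (fiber_iso_connected s t lfE cE).
exists (fun a => monodromy lfE tx (cs_inv (Phi a))); split=> //.
- exact: bij_comp (bij_comp (monodromy_bij lfE tx) (inv_bij t)) bPhi.
- by move=> a b; rewrite mPhi cs_inv_mul monodromy_mul.
Qed.

(** * Functoriality *)

Section Functoriality.
Variables (R : realType) (E' E : topologicalType) (f : continuousType E' E).
Variable phi : irr_comp E' -> irr_comp E.
Hypothesis f_phi : forall v, f @` comp_set v `<=` comp_set (phi v).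
Hypotheses (lfE' : locally_finite_irreducible E')
  (lfE : locally_finite_irreducible E).
Local Notation I := (unit_interval R).
Local Notation push c := (push_cell f_phi c).
Local Notation F := (@dual_map R E' E f phi f_phi).

Lemma push_cell_mem (c : cell E') t : cell_set c t -> cell_set (push c) (f t).
Proof.
move=> ct; exists t => //; apply: connected_component_refl.
exact/(push_stratum f_phi)/cell_sub.
Qed.

Lemma push_cell_neq0 (c : cell E') : cell_verts c != fset0 ->
  cell_verts (push c) != fset0.
Proof.
move=> /fset0Pn[v vc]; apply/fset0Pn; exists (phi v); exact: push_vertsP.
Qed.

Lemma push_cell_le (c d : cell E') : cell_le c d -> cell_le (push c) (push d).
Proof.
move=> [c0 cd dc]; have [t dt] := cell_nonempty d.
apply: (cell_le_meet (s := f t)).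
- exact: push_cell_neq0.
- apply/fsubsetP => _ /imfsetP[v /= vc ->]; apply: push_vertsP.
  exact: (fsubsetP cd).
- exact/push_cell_mem/dc.
- exact: push_cell_mem.
Qed.

Lemma push_top_cell t : cell_le (push (top_cell t)) (top_cell (f t)).
Proof.
apply: cell_le_top => //; first exact/push_cell_neq0/top_cell_verts.
exact/push_cell_mem/top_cell_mem.
Qed.

Lemma carrier_dual_map (z : dual_complex R E') :
  cell_le (carrier (F z)) (push (carrier z)).
Proof.
have zz := carrier_refl z.
rewrite -{1}(in_cellE zz) [F _](dual_map_funE f_phi).
exact: (carrier_le_dual_point (push_cells f_phi (in_cell zz))).
Qed.

Lemma push_carrier_le (z : dual_complex R E') c :
  cell_le (carrier z) c -> cell_le (carrier (F z)) (push c).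
Proof.
by move=> zc; apply: cell_le_trans (carrier_dual_map z) _; exact: push_cell_le.
Qed.

Variable x : dual_complex R E'.

Lemma push_path_into c q : path_into x c q -> path_into (F x) (push c) (F \o q).
Proof.
move=> [cq q0 qc]; split; last exact: push_carrier_le.
  exact: (comp_continuous cq (@cts_fun _ _ F)).
by rewrite /= q0.
Qed.

Lemma push_endpoint_homotopic c p q : endpoint_homotopic x c p q ->
  endpoint_homotopic (F x) (push c) (F \o p) (F \o q).
Proof.
elim=> {p q} [p q [H [cH H0 H1 Hx]]|p|p q _|p q r _ pq _ qr].
- apply: rst_step; exists (F \o H); split.
  + exact: (comp_continuous cH (@cts_fun _ _ F)).
  + by move=> t; rewrite /= H0.
  + by move=> t; rewrite /= H1.
  + move=> s; rewrite /= (Hx s).1; split=> //; exact/push_carrier_le/(Hx s).2.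
- exact: rst_refl.
- exact: rst_sym.
- exact: rst_trans pq qr.
Qed.

Definition push_pathed (z : path_system x) : path_system (F x) :=
  mk_pathed (push_path_into (svalP z)).

Lemma push_pathed_le z w : ls_le z w -> ls_le (push_pathed z) (push_pathed w).
Proof.
by move=> [zw pq]; split; [exact: push_cell_le|exact: push_endpoint_homotopic].
Qed.

(** Pushing paths forward by the dual map covers [f], and defines a map from the
    universal covering of [E'] to the inverse image of that of [E]. *)
Lemma push_etale : exists h : cov_hom (etale_cover (path_system x) lfE')
    (pullback f (etale_cover (path_system (F x)) lfE)),
  forall z u, germ_over z u -> germ_over (push_pathed z) (pullback_snd (h u)).
Proof.
pose U := etale_space (path_system (F x)).
have /choice[g gP] (u : etale_space (path_system x)) : exists v : U,
    etale_proj v = f (etale_proj u) /\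
    forall z, etale_germ u z -> germ_over (push_pathed z) v.
  have [z uz] := etale_germ_exists u.
  have zf : cell_le (ls_pos (push_pathed z)) (top_cell (f (etale_proj u))).
    change (cell_le (push (ls_pos z)) (top_cell (f (etale_proj u)))).
    rewrite (etale_germ_pos uz); exact: push_top_cell.
  have [v vf zv] := germ_over_exists zf; exists v; split=> // w uw.
  apply: germ_over_le zv; apply: push_pathed_le; exact: etale_germ_le uw uz.
have cg : continuous (g : etale_cover _ lfE' -> etale_cover (path_system (F x)) lfE).
  move=> u W nW.
  change (nbhs (u : etale_space (path_system x)) (g @^-1` W)); apply: etale_nbhs.
  have := etale_nbhs_le nW; rewrite (gP u).1 => nfu.
  have cf : continuous f := @cts_fun _ _ f.
  have nW' : \forall t \near etale_proj u, forall v, etale_proj v = f t ->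
      etale_le v (g u) -> W v := cf _ _ nfu.
  have ntop : \forall t \near etale_proj u,
      cell_le (top_cell (f t)) (top_cell (f (etale_proj u))).
    exact: (cf _ _ (top_cell_near lfE (f (etale_proj u)))).
  apply: filterS2 nW' ntop => t Wt tu v vt vu; apply: (Wt (g v)); first by rewrite (gP v).1 vt.
  have [z [w [vz uw zw]]] := vu.
  have [a ga za] := (gP v).2 z vz; have [b gb wb] := (gP u).2 w uw.
  exists a, b; split=> //; apply: (ls_fill_up za).
    exact: ls_trans (push_pathed_le zw) wb.
  by rewrite (etale_germ_pos ga) (etale_germ_pos gb) (gP v).1 (gP u).1 vt.
pose h (u : etale_cover (path_system x) lfE') :
    pullback f (etale_cover (path_system (F x)) lfE) :=
  pullback_pair (C := etale_cover (path_system (F x)) lfE) (esym (gP u).1).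
have ch : continuous h.
  apply: continuous_comp_initial; apply: pair_continuous => //.
  exact: etale_proj_continuous.
exists (@CovHom _ (etale_cover (path_system x) lfE') (pullback f _) h ch (fun u => erefl)).
move=> z u [w uw zw]; apply: germ_over_le (push_pathed_le zw) _.
exact: (gP u).2.
Qed.

Variable s : E'.
Hypothesis sx : cell_le (carrier x) (top_cell s).

Lemma push_incident : cell_le (carrier (F x)) (top_cell (f s)).
Proof. exact: cell_le_trans (push_carrier_le sx) (push_top_cell s). Qed.

(** Both sides are read off from the image of the base point of the universal
    covering of [E'] in the inverse image of that of [E]. *)
Lemma monodromy_natural (a : pi1cs s) :
  monodromy lfE push_incident (pi1cs_map f a) = pi1_map F (monodromy lfE' sx a).
Proof.
have [g gE] : exists g, monodromy lfE' sx a = loop_class g.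
  by exists (repr (monodromy lfE' sx a)); rewrite loop_class_repr.
rewrite gE pi1_mapE; move/monodromyP: gE => ga; apply/monodromyP.
have [h hP] := push_etale.
have base : fiber_pair (base_point lfE push_incident) =
    fiber_map h (base_point lfE' sx).
  apply: (can_inj (@fiber_sndK _ _ f s _)); rewrite fiber_pairK.
  apply: (etale_fiber_eq (z := const_elt (F x))); first exact: base_pointP.
  apply: (germ_over_le _ (hP _ _ (base_pointP lfE' sx))).
  split; first exact: carrier_dual_map.
  exact: rst_refl.
rewrite /= base cs_nat /=.
apply: (germ_over_le _ (hP _ _ ga)).
split; first exact: carrier_dual_map.
exact: rst_refl.
Qed.

End Functoriality.

Lemma pi1cs_map_inv (S' S : topologicalType) (f : continuousType S' S) (s : S')
    (a : pi1cs s) : cs_inv (pi1cs_map f a) = pi1cs_map f (cs_inv a).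
Proof.
apply/esym/cs_inv_unique/pi1csP => C y /=; rewrite fiber_sndK.
have -> : cs_inv a (pullback f C) (a (pullback f C) (fiber_pair y)) =
    cs_mul (cs_inv a) a (pullback f C) (fiber_pair y) by [].
by rewrite cs_mulVg fiber_pairK.
Qed.

Theorem proposition10p6 (R : realType) :
  exists gamma : forall (E : scheme) (s : E) (x : dual_complex R E),
      pi1cs s -> pi1 R x,
    (forall E : scheme, locally_noetherian E -> connected [set: E] ->
       forall (s : E) (x : dual_complex R E),
         bijective (gamma E s x) /\
         forall a b : pi1cs s,
           gamma E s x (cs_mul a b) = (gamma E s x a * gamma E s x b)%g) /\
    (forall E' E : scheme,
       locally_noetherian E' -> connected [set: E'] ->
       locally_noetherian E -> connected [set: E] ->
       forall (f : continuousType E' E) (phi : irr_comp E' -> irr_comp E)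
         (f_phi : forall v : irr_comp E', f @` comp_set v `<=` comp_set (phi v))
         (s' : E') (x' : dual_complex R E'), incident s' x' ->
       forall a : pi1cs s',
         gamma E (f s') (dual_map f_phi x') (pi1cs_map f a) =
         pi1_map (dual_map f_phi) (gamma E' s' x' a)).
Proof.
have iso (E : topologicalType) (s : E) (x : dual_complex R E) :
    exists gamma : pi1cs s -> pi1 R x,
    forall (lfE : locally_finite_irreducible E), connected [set: E] ->
    [/\ bijective gamma,
      forall a b, gamma (cs_mul a b) = (gamma a * gamma b)%g &
      forall (sx : cell_le (carrier x) (top_cell s)) a,
        gamma a = monodromy lfE sx (cs_inv a)].
  have [[lfE cE]|nE] := pselect (locally_finite_irreducible E /\ connected [set: E]).
    have [gamma [bij mul mono]] := pi1cs_iso_exists s x lfE cE.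
    exists gamma => lfE' _; split=> // sx a.
    by rewrite mono (Prop_irrelevance lfE lfE').
  by exists (fun=> 1%g) => lfE cE; case: nE.
exists (fun E s x => projT1 (cid (iso E s x))); split.
  move=> E nE cE s x; case: cid => gamma /= gammaP.
  by have [] := gammaP (locally_noetherian_finite nE) cE.
move=> E' E nE' cE' nE cE f phi f_phi s' x' inc a.
have lfE' := locally_noetherian_finite nE'.
have lfE := locally_noetherian_finite nE.
have sx := incident_carrier lfE' inc.
case: cid => gamma /= /(_ lfE cE)[_ _ gammaE].
case: cid => gamma' /= /(_ lfE' cE')[_ _ gammaE'].
rewrite (gammaE (push_incident f_phi lfE' lfE sx)) (gammaE' sx) pi1cs_map_inv.
exact: monodromy_natural.
Qed.
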